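(* Let $d\in\mathbb N$ and let ${\bf k}=(k_1,\dots,k_d)$ be a vector of positive integers (the spline orders). For any positive function $\sigma$ on $[0,\infty)$ with $\liminf_{t\to\infty}\sigma(t)=0$, there exists a non-negative function $\varphi$ on $[0,1]^d$ such that (i) the function $\sigma(\varphi)\cdot\varphi\cdot(\log^+\varphi)^{d-1}$ is integrable; (ii) there exists a subset $B\subset[0,1]^d$ of positive Lebesgue measure and a sequence of partitions $({\bf\Delta}_n)$ of $[0,1]^d$ with $|{\bf\Delta}_n|\to0$ such that, for all $x\in B$, \[ \limsup_{n\to\infty}|P_{{\bf\Delta}_n}\varphi(x)|=\infty. \]
   Context: $\log^+ t:=\max\{0,\log t\}$. Partitions. For each $\mu\in\{1,\dots,d\}$, $k_\mu$ is the order (degree plus 1) of polynomials in the $\mu$-th coordinate direction. A partition of $[0,1]$ in direction $\mu$ is a finite sequence $\Delta_\mu=(t_i^{(\mu)})_{i=1}^{n_\mu+k_\mu}$, $n_\mu\in\mathbb N$, with $t_i^{(\mu)}\le t_{i+1}^{(\mu)}$ for $i<n_\mu+k_\mu$, $t_j^{(\mu)}<t_{j+k_\mu}^{(\mu)}$ for $j\le n_\mu$, $t_1^{(\mu)}=\dots=t_{k_\mu}^{(\mu)}=0$ and $t_{n_\mu+1}^{(\mu)}=\dots=t_{n_\mu+k_\mu}^{(\mu)}=1$. A partition of $[0,1]^d$ is a tuple ${\bf\Delta}=(\Delta_1,\dots,\Delta_d)$; put $|\Delta_\mu|:=\max_i|t_{i+1}^{(\mu)}-t_i^{(\mu)}|$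 and $|{\bf\Delta}|:=\max_{1\le\mu\le d}|\Delta_\mu|$. B-splines. $(N_i^{(\mu)})_{i=1}^{n_\mu}$ is the sequence of B-splines of order $k_\mu$ on $\Delta_\mu$, with $\operatorname{supp}N_i^{(\mu)}=[t_i^{(\mu)},t_{i+k_\mu}^{(\mu)}]$, $N_i^{(\mu)}\ge0$ and $\sum_{i=1}^{n_\mu}N_i^{(\mu)}\equiv1$. Their span consists of the piecewise polynomials of order $k_\mu$ with grid points $\Delta_\mu$ that are $k_\mu-1-m$ times continuously differentiable at each grid point $t$ occurring $m$ times in $\Delta_\mu$ (no smoothness condition if $m=k_\mu$). The tensor product B-splines are $N_{\bf i}(x_1,\dots,x_d):=N_{i_1}^{(1)}(x_1)\cdots N_{i_d}^{(d)}(x_d)$, where ${\bf i}=(i_1,\dots,i_d)$ with $1\le i_\mu\le n_\mu$ for all $\mu$. Projection. $P_{\bf\Delta}$ is the orthogonal projection operator from $L_2[0,1]^d$ onto the linear span of all the $N_{\bf i}$ with respect to the standard inner product $\langle f,g\rangle=\int_{[0,1]^d}fg\,\mathrm dx$. Since the B-splines are contained in $L_\infty$, this operator extends naturally to $L_1$-functions: $P_{\bf\Delta}f$ is the element of the span with $\langle P_{\bf\Delta}f,N_{\bf i}\rangle=\langle f,N_{\bf i}\rangle$ for all ${\bf i}$.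
   Formalization: For d=1 no integrable φ can satisfy (ii), since P_Δ f→f a.e. for all f in L_1; so for non-integrable φ≥0, P_Δ φ is read as the limit of P_Δ(min(φ,m)) as m→∞ in the extended reals. For d≥2, φ is integrable and P_Δ is the L_1 projection. *)

(* Defs.v *)
From HB Require Import structures.
From mathcomp Require Import all_boot all_order all_algebra.
From mathcomp Require Import all_classical all_reals all_analysis.

Set Implicit Arguments.
Unset Strict Implicit.
Unset Printing Implicit Defensive.

Import Order.TTheory GRing.Theory Num.Theory.
Import numFieldNormedType.Exports.

Local Open Scope classical_set_scope.
Local Open Scope ring_scope.

(* A point of R^d is a d-tuple; its measurable sets are those of the product
   of d copies of the Borel sigma-algebra. *)
Notation Rd R d := (d.-tuple (measurableTypeR R)).

Section lebesgue_cons.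
Context (R : realType) (d : nat).

Definition tcons (p : measurableTypeR R * Rd R d) : Rd R d.+1 :=
  [tuple of p.1 :: p.2].

Lemma measurable_tcons : measurable_fun setT tcons.
Proof.
exact: (@measurable_cons _ _ _ _ (fst : _ * Rd R d -> _) _ snd).
Qed.

Variable m : {sigma_finite_measure set (Rd R d) -> \bar R}.

Definition lebesgue_cons : set (Rd R d.+1) -> \bar R :=
  pushforward ((@lebesgue_measure R) \x m)%E tcons.

Let lebesgue_cons0 : lebesgue_cons set0 = 0%E.
Proof. by rewrite /lebesgue_cons /pushforward preimage_set0 measure0. Qed.

Let lebesgue_cons_ge0 A : (0 <= lebesgue_cons A)%E.
Proof. by rewrite /lebesgue_cons /pushforward measure_ge0. Qed.

Let lebesgue_cons_sigma_additive : semi_sigma_additive lebesgue_cons.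
Proof.
move=> F mF tF mUF; rewrite /lebesgue_cons /pushforward preimage_bigcup.
apply: measure_semi_sigma_additive.
- by move=> n; rewrite -[X in measurable X]setTI; exact: measurable_tcons.
- apply/trivIsetP => /= i j _ _ ij; rewrite -preimage_setI.
  by move/trivIsetP : tF => /(_ _ _ _ _ ij) ->//; rewrite preimage_set0.
- rewrite -preimage_bigcup -[X in measurable X]setTI.
  exact: measurable_tcons.
Qed.

HB.instance Definition _ := isMeasure.Build _ _ _ lebesgue_cons
  lebesgue_cons0 lebesgue_cons_ge0 lebesgue_cons_sigma_additive.

Let lebesgue_cons_sigma_finite : sigma_finite setT lebesgue_cons.
Proof.
have /sigma_finiteP[F [FT ndF Foo]] := sigma_finiteT (@lebesgue_measure R).
have /sigma_finiteP[G [GT ndG Goo]] := sigma_finiteT m.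
pose unc (t : Rd R d.+1) := (thead t, [tuple of behead t] : Rd R d).
have uncK p : unc (tcons p) = p.
  by case: p => x t; rewrite /unc/= theadE; congr pair; apply: val_inj.
have munc : measurable_fun setT unc.
  apply/measurable_fun_pairP; split.
    exact: (measurable_tnth (ord0 : 'I_d.+1)).
  exact: measurable_behead.
exists (fun n => unc @^-1` (F n `*` G n)).
  rewrite -preimage_bigcup (_ : \bigcup_n _ = setT) ?preimage_setT//.
  apply/seteqP; split => // -[x y] _.
  have [n _ Fx] : (\bigcup_n F n) x by rewrite -FT.
  have [l _ Gy] : (\bigcup_n G n) y by rewrite -GT.
  exists (maxn n l) => //; split => /=.
    by move: x Fx; exact/subsetPset/ndF/leq_maxl.
  by move: y Gy; exact/subsetPset/ndG/leq_maxr.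
move=> n; have [mF Fn] := Foo n; have [mG Gn] := Goo n; split.
  by rewrite -[X in measurable X]setTI; apply: munc => //; exact: measurableX.
rewrite /lebesgue_cons /pushforward -comp_preimage.
rewrite (_ : unc \o tcons = id); last exact/funext.
by rewrite preimage_id product_measure1E// lte_mul_pinfty// ge0_fin_numE.
Qed.

HB.instance Definition _ := @Measure_isSigmaFinite.Build _ _ _
  lebesgue_cons lebesgue_cons_sigma_finite.

End lebesgue_cons.

(* Lebesgue measure on (the Borel sets of) R^d, as a d-fold product. *)
Fixpoint lebesgue_tuple (R : realType) (d : nat) :
    {sigma_finite_measure set (Rd R d) -> \bar R} :=
  match d return {sigma_finite_measure set (Rd R d) -> \bar R} with
  | 0%N => \d_([tuple] : Rd R 0)
  | d'.+1 => lebesgue_cons (lebesgue_tuple R d')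
  end.

Lemma lebesgue_tuple_box (R : realType) (d : nat)
    (A : 'I_d -> set (measurableTypeR R)) : (forall i, measurable (A i)) ->
  lebesgue_tuple R d [set x | forall i, A i (tnth x i)] =
  (\prod_(i < d) lebesgue_measure (A i))%E.
Proof.
elim: d A => [|d IH] A mA.
  rewrite big_ord0 /= diracE mem_set//= => i; by case: i.
rewrite big_ord_recl -IH//= /lebesgue_cons /pushforward.
rewrite -product_measure1E//; last first.
  rewrite (_ : [set _ | _] = \bigcap_(i in [set: 'I_d])
     ((fun x : Rd R d => tnth x i) @^-1` A (lift ord0 i))).
    apply: fin_bigcap_measurable => // i _.
    by rewrite -[X in measurable X]setTI; exact: measurable_tnth.
  by apply/seteqP; split => x /=; [move=> Ax i _; exact: Ax | move=> + i; exact].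
congr ((_ \x _)%E _); apply/seteqP; split => -[x t] /=.
  move=> At; split; first exact: (At ord0).
  by move=> i; have := At (lift ord0 i); rewrite tnthS.
case=> /= Ax At i; case: (unliftP ord0 i) => [j ->|->//].
by rewrite tnthS; exact: At.
Qed.

Definition unit_cube (R : realType) (d : nat) : set (Rd R d) :=
  [set x | forall mu : 'I_d, 0 <= tnth x mu <= 1].
Arguments unit_cube : clear implicits.

Section tensor_splines.
Context (R : realType).
Implicit Types (d k : nat).

Definition logp (t : R) : R := Num.max 0 (ln t).

(* Knots are numbered from 0: [knot D j] is t_{j+1}. *)
Record partition k := Partition {
  pdim : nat;
  knots : (pdim + k).-tuple R;
  knots_nondecreasing : forall j, (j.+1 < pdim + k)%N ->
    knots`_j <= knots`_j.+1;
  knots_mult : forall j, (j < pdim)%N -> knots`_j < knots`_(j + k);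
  knots_left : forall j, (j < k)%N -> knots`_j = 0;
  knots_right : forall j, (j < k)%N -> knots`_(pdim + j) = 1 }.

Definition knot k (D : partition k) (j : nat) : R := (knots D)`_j.

Definition mesh1 k (D : partition k) : R :=
  \big[Num.max/0]_(j < (pdim D + k).-1) `|knot D j.+1 - knot D j|.

(* Cox-de Boor recurrence for the [i]-th B-spline of degree [p] (order p + 1)
   on the knots [t]. Division by 0 is 0, as the recurrence requires. The last
   nonempty cell is closed on the right, so that the B-splines sum to 1 at the
   point 1 too. *)
Fixpoint bspline (t : nat -> R) (p i : nat) (x : R) : R :=
  match p with
  | 0%N => ((t i <= x < t i.+1) || [&& t i < t i.+1, t i.+1 == 1 & x == 1])%:R
  | q.+1 =>
      (x - t i) / (t (i + p)%N - t i) * bspline t q i x +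
      (t (i + p).+1 - x) / (t (i + p).+1 - t i.+1) * bspline t q i.+1 x
  end.

Definition multipartition d (k : 'I_d -> nat) :=
  forall mu : 'I_d, partition (k mu).

Section projection.
Context (d : nat) (k : 'I_d -> nat).
Implicit Types (D : multipartition k) (f g : Rd R d -> R).

Definition mesh D : R := \big[Num.max/0]_(mu < d) mesh1 (D mu).

Definition multi_index D := {dffun forall mu : 'I_d, 'I_(pdim (D mu))}.

Definition tensor_bspline D (i : multi_index D) (x : Rd R d) : R :=
  \prod_(mu < d) bspline (knot (D mu)) (k mu).-1 (i mu) (tnth x mu).

Definition spline_space D : set (Rd R d -> R) :=
  [set g | exists c : multi_index D -> R,
    g = fun x => \sum_(i : multi_index D) c i * tensor_bspline i x].

Definition inner f g : R :=
  \int[lebesgue_tuple R d]_(x in unit_cube R d) (f x * g x).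

(* The orthogonal projection, extended to L_1; the element selected by [xget]
   exists and is unique when [f] is integrable. *)
Definition spline_proj D f : Rd R d -> R :=
  xget (fun=> 0) [set g | spline_space D g /\
    forall i : multi_index D,
      inner g (tensor_bspline i) = inner f (tensor_bspline i)].

(* For a nonnegative [f] that is not integrable, the pairings with the B-splines
   may be infinite; the value is then the limit, in the extended reals, of the
   projections of the truncations of [f]. This case matters only for d = 1,
   where the projections of an L_1 function converge to it almost everywhere,
   so that a function with divergent projections cannot be integrable. *)
Definition spline_proj_ext D f (x : Rd R d) : \bar R :=
  if (lebesgue_tuple R d).-integrable (unit_cube R d) (EFin \o f)
  then (spline_proj D f x)%:E
  else limn (fun m => (spline_proj D (fun y => Num.min (f y) m%:R) x)%:E).

End projection.
End tensor_splines.

(* Main.v *)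
Require Import Defs.
From HB Require Import structures.
From mathcomp Require Import all_boot all_order all_algebra.
From mathcomp Require Import all_classical all_reals all_analysis.
From mathcomp Require Import measurable_realfun zify ring lra.

Set Implicit Arguments.
Unset Strict Implicit.
Unset Printing Implicit Defensive.

Import Order.TTheory GRing.Theory Num.Theory.
Import numFieldNormedType.Exports.

Local Open Scope classical_set_scope.
Local Open Scope ring_scope.

(* If all knots of a partition have full multiplicity, the splines satisfy no
   smoothness condition and the projection is, on each cell, the projection on
   polynomials. On the uniform grid with N cells its kernel is of order N on the
   cell of x and bounded below by a multiple of N near the corners of the cells.
   The function phi takes the value h_i on the "spikes" of scale i, the corners
   of side q^-(scale (i+1)) of the grid cubes of side q^-(scale i).

   For d >= 2 consider, in each cube of scale i, all dyadic-like rectangles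
   (with side ratios q^-a_mu, the sum of the a_mu being fixed) that share the
   corner of the cube with the spike. A grid whose cells are these rectangles
   makes the projection of phi large near the corner of each of them, and the
   union of the rectangles over all the eccentricities a is larger than one of
   them by a factor (log h_i)^(d-1). This is the factor in the integral in (i):
   since sigma(h_i) may be taken arbitrarily small, phi can be made integrable,
   and the integral in (i) finite, while the measures of the unions have an
   infinite sum. As these unions are equidistributed with respect to coarser
   grids, almost every point lies in infinitely many of them. The point must
   also avoid the spikes themselves, which have small total measure, because an
   earlier spike containing it would contribute to the projection.

   For d = 1 condition (i) only asks that sigma(phi) phi be integrable, so each
   scale may carry a mass of order 1 in every interval. Then phi is not
   integrable on any cell. The kernel has mean 1 over a cell, and spikes of high
   scale are equidistributed, so that, outside the spikes, the projections of the
   truncations of phi tend to infinity at each stage. *)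

(** * Splines on uniform grids with knots of full multiplicity *)

(** The kernel changes sign, so the spike of interest cannot be isolated by positivity. For d >= 2
    the later spikes, being equidistributed in the cell, contribute at most their total mass times
    the supremum of the kernel times the volume of the cell, and the last two factors multiply to a
    constant that does not depend on the grid.

    The base [q] comes from the kernel: the reproducing kernel of the polynomials is positive at a
    corner, hence bounded below when both variables are within 1/q of it. Sets are described by
    digits in base [q]. The digits of a bad point vanish up to one place beyond its rectangle, which
    puts it in this corner; the next digit does not vanish, so the shape of the rectangle can be
    read off the point. Hence different shapes give disjoint sets and their measures add up.

    An infinite sum of measures is compatible with finite integrals because at each height the
    integrals are a small multiple of the measure of the bad set. Repeating the height about as
    often as the inverse of this measure adds a term of order 1 to the former sum and a
    geometrically small one to the latter. *)

Section uniform_partition.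
Context (R : realType) (k : nat) (k_gt0 : (0 < k)%N).

Definition unif_knot (N j : nat) : R := (j %/ k)%:R / N%:R.

Let knotE N j : (j < N * k + k)%N ->
  (mktuple (fun j : 'I_(N * k + k) => unif_knot N j))`_j = unif_knot N j.
Proof. by move=> jN; rewrite -(tnth_nth 0 _ (Ordinal jN)) tnth_mktuple. Qed.

Definition uniform_partition (N : nat) (N_gt0 : (0 < N)%N) : Defs.partition R k.
Proof.
refine (@Defs.Partition R k (N * k) (mktuple (fun j => unif_knot N j)) _ _ _ _).
- move=> j jN; rewrite !knotE// ?(ltnW jN)// /unif_knot.
  by rewrite ler_pM2r ?invr_gt0 ?ltr0n// ler_nat leq_div2r.
- move=> j jN; rewrite !knotE ?ltn_add2r//; last exact: ltn_addr.
  by rewrite /unif_knot divnDr// divnn k_gt0 addn1 ltr_pM2r ?invr_gt0 ?ltr0n// ltr_nat.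
- by move=> j jk; rewrite knotE ?ltn_addl// /unif_knot divn_small// mul0r.
- move=> j jk; rewrite knotE ?ltn_add2l// /unif_knot divnMDl// divn_small//.
  by rewrite addn0 divff// pnatr_eq0 -lt0n.
Defined.

Lemma knot_uniform N (N_gt0 : (0 < N)%N) j : (j < N * k + k)%N ->
  knot (uniform_partition N_gt0) j = unif_knot N j.
Proof. exact: knotE. Qed.

Lemma mesh1_uniform N (N_gt0 : (0 < N)%N) :
  mesh1 (uniform_partition N_gt0) <= N%:R^-1.
Proof.
rewrite /mesh1; elim/big_ind : _ => [|x y xN yN|j _].
- by rewrite invr_ge0 ler0n.
- by rewrite ge_max xN.
have jN : (j.+1 < N * k + k)%N by have := ltn_ord j; rewrite /=; lia.
rewrite !knot_uniform// ?(ltnW jN)// /unif_knot -mulrBl.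
rewrite ger0_norm; last first.
  by rewrite mulr_ge0 ?invr_ge0 ?ler0n// subr_ge0 ler_nat leq_div2r.
rewrite ler_piMl ?invr_ge0 ?ler0n// lerBlDr nat1r ler_nat.
have <- : ((j + k) %/ k = (j %/ k).+1)%N by rewrite divnDr// divnn k_gt0 addn1.
by rewrite leq_div2r// -addn1 leq_add2l.
Qed.

Definition bern (p l : nat) (u : R) : R :=
  'C(p, l)%:R * u ^+ l * (1 - u) ^+ (p - l).

(** Half-open cells, except that the cell ending at 1 contains 1; this matches the convention of
    [bspline] in degree 0. *)
Definition in_cell (N c : nat) (x : R) : bool :=
  (c%:R / N%:R <= x < c.+1%:R / N%:R) || ((c.+1%:R / N%:R == 1 :> R) && (x == 1)).

Lemma bernS p l u :
  bern p.+1 l.+1 u = u * bern p l u + (1 - u) * bern p l.+1 u.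
Proof.
rewrite /bern binS natrD; have [lp|pl] := ltnP l p.
  rewrite subSS (_ : (p - l = (p - l.+1).+1)%N); last by lia.
  rewrite !exprS; ring.
rewrite (bin_small (_ : p < l.+1)%N)// subSS add0r !mul0r mulr0 addr0 exprS; ring.
Qed.

Lemma bernS0 p u : bern p.+1 0 u = (1 - u) * bern p 0 u.
Proof. by rewrite /bern !bin0 !subn0 exprS; ring. Qed.

Lemma bern_small p l u : (p < l)%N -> bern p l u = 0.
Proof. by move=> pl; rewrite /bern bin_small// !mul0r. Qed.

(** On knots of multiplicity [k] the difference of two knots in the recurrence is 0 or 1/N, and the
    recurrence becomes that of the Bernstein polynomials on a single cell. In degree [p] the support
    of the spline reaches the next grid point only if [k <= r + p.+1]; otherwise all its knots
    coincide and it vanishes. *)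
Lemma bspline_unif_knot N (N_gt0 : (0 < N)%N) p c r x : (r < k)%N -> (p < k)%N ->
  bspline (unif_knot N) p (c * k + r) x =
  if (k <= r + p.+1)%N then bern p (r + p.+1 - k) (N%:R * x - c%:R) * (in_cell N c x)%:R
  else 0.
Proof.
have N0 : N%:R != 0 :> R by rewrite pnatr_eq0 -lt0n.
have uE b s : (s < k)%N -> unif_knot N (b * k + s) = b%:R / N%:R.
  by move=> sk; rewrite /unif_knot divnMDl// divn_small// addn0.
elim: p c r => [|p IH] c r rk pk.
  rewrite /= uE//; have [kr|rk1] := leqP k (r + 1).
    have -> : (c * k + r).+1 = (c.+1 * k + 0)%N by lia.
    rewrite uE// /in_cell (_ : r + 1 - k = 0)%N; last by lia.
    rewrite /bern bin0 expr0 subnn expr0 !mul1r.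
    by rewrite ltr_pM2r ?invr_gt0 ?ltr0n// ltr_nat ltnSn.
  rewrite -addnS uE; last by lia.
  by rewrite ltxx orbF; case: leP => // /le_gtF ->.
rewrite [LHS]/=.
have [kr|rk1] := leqP k (r + p.+2); last first.
  rewrite IH ?(ltnW pk)// leqNgt (_ : (r + p.+1 < k)%N) ?mulr0 ?add0r; last by lia.
  rewrite -[(c * k + r).+1]addnS IH ?(ltnW pk)//; last by lia.
  by rewrite leqNgt (_ : (r.+1 + p.+1 < k)%N) ?mulr0//; lia.
have t2 : unif_knot N (c * k + r + p.+1).+1 = c.+1%:R / N%:R.
  have -> : (c * k + r + p.+1).+1 = (c.+1 * k + (r + p.+2 - k))%N by lia.
  by rewrite uE//; lia.
rewrite t2 uE//.
have cE : c.+1%:R / N%:R - c%:R / N%:R = N%:R^-1 :> R.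
  by rewrite -mulrBl -natr1 addrC addKr mul1r.
set u := N%:R * x - c%:R.
have u1 : (x - c%:R / N%:R) / N%:R^-1 = u by rewrite invrK /u; field.
have u2 : (c.+1%:R / N%:R - x) / N%:R^-1 = 1 - u.
  by rewrite invrK /u -natr1; field.
have term1 : (x - c%:R / N%:R) / (unif_knot N (c * k + r + p.+1) - c%:R / N%:R) *
    bspline (unif_knot N) p (c * k + r) x =
    (if (k <= r + p.+1)%N then u * bern p (r + p.+1 - k) u else 0) * (in_cell N c x)%:R.
  rewrite IH ?(ltnW pk)//; case: ifPn => [kr1|_]; last by rewrite mulr0 mul0r.
  have -> : (c * k + r + p.+1)%N = (c.+1 * k + (r + p.+1 - k))%N by lia.
  by rewrite uE ?cE ?u1 ?mulrA//; lia.
have term2 : (c.+1%:R / N%:R - x) / (c.+1%:R / N%:R - unif_knot N (c * k + r).+1) *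
    bspline (unif_knot N) p (c * k + r).+1 x =
    (if (r.+1 < k)%N then (1 - u) * bern p (r.+1 + p.+1 - k) u else 0) * (in_cell N c x)%:R.
  case: ifPn => rk1.
    rewrite -[(c * k + r).+1]addnS uE// cE u2 IH ?(ltnW pk)//.
    by rewrite (_ : (k <= r.+1 + p.+1)%N) ?mulrA//; lia.
  rewrite (_ : (c * k + r).+1 = (c.+1 * k + 0)%N); last by lia.
  by rewrite IH ?(ltnW pk)// leqNgt (_ : (0 + p.+1 < k)%N) ?mulr0 ?mul0r//; lia.
rewrite term1 term2 -mulrDl; congr (_ * _).
have -> : (r + p.+2 - k = r.+1 + p.+1 - k)%N by lia.
have [kr1|kr1] := leqP k (r + p.+1).
  rewrite (_ : r.+1 + p.+1 - k = (r + p.+1 - k).+1)%N; last by lia.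
  rewrite bernS; case: ifPn => // rk1.
  by rewrite [X in _ = _ + (1 - u) * X]bern_small ?mulr0//; lia.
rewrite (_ : r.+1 < k)%N; last by lia.
rewrite (_ : r.+1 + p.+1 - k = 0)%N; last by lia.
by rewrite bernS0 add0r.
Qed.

Lemma eq_bspline (t t' : nat -> R) p i x :
  (forall j, (i <= j <= i + p.+1)%N -> t j = t' j) ->
  bspline t p i x = bspline t' p i x.
Proof.
elim: p i => [|p IH] i tt'; first by rewrite /= !tt'//; lia.
by rewrite /= !tt' 1?(IH i) 1?(IH i.+1)//; first [move=> j ij; apply: tt' | idtac]; lia.
Qed.

Lemma bspline_uniform N (N_gt0 : (0 < N)%N) c r x : (c < N)%N -> (r < k)%N ->
  bspline (knot (uniform_partition N_gt0)) k.-1 (c * k + r) x =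
  bern k.-1 r (N%:R * x - c%:R) * (in_cell N c x)%:R.
Proof.
move=> cN rk; rewrite (@eq_bspline _ (unif_knot N)); last first.
  by move=> j jk; rewrite knot_uniform//; nia.
rewrite bspline_unif_knot// prednK// ?leq_addl ?addnK//.
Qed.

End uniform_partition.

(** * Integrals of polynomials over intervals *)

Section polynomial_integrals.
Context (R : realType).
Implicit Types p q : {poly R}.

Lemma poly_eq0_01 p : (forall x : R, 0 < x < 1 -> p.[x] = 0) -> p = 0.
Proof.
move=> p0; apply/eqP/negPn/negP => pn0; set n := size p.
pose rs := [seq i.+1%:R / n.+1%:R : R | i <- iota 0 n].
suff /andP[rp urs] : all (root p) rs && uniq rs.
  by have := max_poly_roots pn0 rp urs; rewrite size_map size_iota ltnn.
apply/andP; split.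
  apply/allP => _ /mapP[i + ->]; rewrite mem_iota add0n => /andP[_ i_n].
  by apply/rootP/p0; rewrite divr_gt0//= ltr_pdivrMr// mul1r ltr_nat ltnS.
rewrite map_inj_uniq ?iota_uniq// => i j /mulIf ij.
by apply/eqP; rewrite -eqSS -(eqr_nat R) ij// invr_eq0 pnatr_eq0.
Qed.

(** At [i = 0] the division by 0 gives the constant term 0. *)
Definition prim p : {poly R} := \poly_(i < (size p).+1) (p`_i.-1 / i%:R).

Lemma deriv_prim p : (prim p)^`() = p.
Proof.
apply/polyP => i; rewrite coef_deriv coef_poly ltnS.
case: ltnP => [ip|pi]; last by rewrite mul0rn nth_default.
by rewrite -[LHS]mulr_natr divfK ?pnatr_eq0.
Qed.

Lemma integrable_poly p (a b : R) :
  (@lebesgue_measure R).-integrable `[a, b] (EFin \o (fun x => p.[x])).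
Proof.
apply: continuous_compact_integrable; first exact: segment_compact.
by apply: continuous_subspaceT => x; exact: continuous_horner.
Qed.

Lemma Rintegral_poly p (a b : R) : a < b ->
  \int[lebesgue_measure]_(x in `[a, b]) p.[x] = (prim p).[b] - (prim p).[a].
Proof.
move=> ab; rewrite /Rintegral (@continuous_FTC2 _ _ (horner (prim p)))//.
- by apply: continuous_subspaceT => x; exact: continuous_horner.
- split=> [x _||]; first exact: derivable_horner.
    by apply: cvg_at_right_filter; exact: continuous_horner.
  by apply: cvg_at_left_filter; exact: continuous_horner.
- move=> x _; rewrite derive1E (@derive_val _ _ _ _ _ _ _ (is_derive_poly _ _)).
  by rewrite deriv_prim.
Qed.

Lemma Rintegral_poly_affine p (n c : R) : 0 < n ->
  \int[lebesgue_measure]_(x in `[c / n, (c + 1) / n]) p.[n * x - c] =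
  n^-1 * \int[lebesgue_measure]_(x in `[0, 1]) p.[x].
Proof.
move=> n0; have nn0 : n != 0 by rewrite gt_eqF.
pose q := p \Po (n *: 'X - c%:P).
have qE x : p.[n * x - c] = q.[x] by rewrite horner_comp !hornerE.
transitivity (\int[lebesgue_measure]_(x in `[c / n, (c + 1) / n]) q.[x]).
  by apply: eq_Rintegral => x _; exact: qE.
rewrite !Rintegral_poly//; last by rewrite ltr_pM2r ?invr_gt0// ltrDl.
(* The change of variables is algebraic: two primitives of [q] differ by a polynomial with zero
   derivative, hence by a constant. *)
pose r := prim q - n^-1 *: (prim p \Po (n *: 'X - c%:P)).
have r'0 : r^`() = 0.
  rewrite derivB derivZ deriv_comp !deriv_prim derivB derivZ derivX derivC subr0.
  by rewrite -/q -scalerAr mulr1 scalerA mulVf// scale1r subrr.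
have rE : r = (r`_0)%:P.
  apply/polyP => -[|i]; rewrite coefC//=.
  have := congr1 (fun s : {poly R} => s`_i) r'0; rewrite coef_deriv coef0 => /eqP.
  by rewrite -mulr_natr mulf_eq0 pnatr_eq0 orbF => /eqP.
have qr x : (prim q).[x] = n^-1 * (prim p).[n * x - c] + r`_0.
  have := congr1 (fun s => s.[x]) rE.
  rewrite /r hornerD hornerN hornerZ horner_comp hornerC !hornerE => <-; ring.
have nK z : n * (z / n) = z by rewrite mulrC divfK.
rewrite !qr !nK subrr [c + 1]addrC addrK; ring.
Qed.

(** The primitive of [p ^+ 2] is nondecreasing and takes the same value at 0 and 1, so it is
    constant on the interval, hence constant as a polynomial. *)
Lemma poly_sqr_integral_eq0 p :
  \int[lebesgue_measure]_(x in `[0, 1]) (p ^+ 2).[x] = 0 -> p = 0.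
Proof.
rewrite Rintegral_poly// => /eqP; rewrite subr_eq0 => /eqP P01.
have ge0 (a b : R) : 0 <= \int[lebesgue_measure]_(x in `[a, b]) (p ^+ 2).[x].
  by apply: Rintegral_ge0 => x _; rewrite horner_exp sqr_ge0.
have : prim (p ^+ 2) - (prim (p ^+ 2)).[0]%:P = 0.
  apply: poly_eq0_01 => x /andP[x0 x1]; rewrite hornerD hornerN hornerC.
  apply/eqP; rewrite eq_le -Rintegral_poly// ge0 andbT.
  by rewrite Rintegral_poly// -P01 -oppr_ge0 opprB -Rintegral_poly.
move=> /(congr1 (fun s => s^`())).
rewrite derivB derivC subr0 deriv_prim deriv0 => /eqP.
by rewrite expf_eq0 => /eqP.
Qed.

Lemma poly_lipschitz01 p : exists2 L : R, 0 <= L &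
  forall u v : R, 0 <= u <= 1 -> 0 <= v <= 1 -> `|p.[u] - p.[v]| <= L * `|u - v|.
Proof.
elim/poly_ind: p => [|p c [L L0 IH]].
  by exists 0 => // u v _ _; rewrite !horner0 subrr normr0 mul0r.
exists (L + L + `|p.[0]|) => [|u v /[dup] u01 /andP[u0 u1] /[dup] v01 /andP[v0 v1]].
  by rewrite !addr_ge0.
rewrite !hornerE.
have -> : p.[u] * u + c - (p.[v] * v + c) = (p.[u] - p.[v]) * v + p.[u] * (u - v) by ring.
have pu : `|p.[u]| <= `|p.[0]| + L.
  rewrite -[p.[u]](subrK p.[0]) (le_trans (ler_normD _ _))// addrC lerD2l.
  by rewrite (le_trans (IH _ _ _ _))// ?lexx ?ler01// subr0 ger0_norm// ler_piMr.
rewrite (le_trans (ler_normD _ _))// !normrM (ger0_norm v0).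
have := IH _ _ u01 v01; have := normr_ge0 (u - v); have := normr_ge0 (p.[u] - p.[v]).
move: pu; set A := `|p.[u]|; set B := `|_ - p.[v]|; set D := `|u - v|; nra.
Qed.

End polynomial_integrals.

(** * The reproducing kernel of the polynomials on [0, 1] *)

Section bernstein_kernel.
Context (R : realType) (k : nat) (k_gt0 : (0 < k)%N).

Definition bernp (r : nat) : {poly R} := 'C(k.-1, r)%:R *: ('X^r * (1 - 'X) ^+ (k.-1 - r)).

Lemma horner_bernp r u : (bernp r).[u] = bern k.-1 r u.
Proof. by rewrite /bern !hornerE. Qed.

(** Substituting u = t / (1 + t) and multiplying by (1 + t)^(k - 1) turns a combination of Bernstein
    polynomials into the polynomial [T] in t, whose coefficients are the [c i] times nonzero
    binomials. *)
Lemma bernp_free (c : 'I_k -> R) : \sum_i c i *: bernp i = 0 -> forall i, c i = 0.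
Proof.
move=> c0.
pose T := \poly_(i < k) (oapp c 0 (insub i) * 'C(k.-1, i)%:R).
suff T0 : T = 0.
  move=> i; have := congr1 (fun p : {poly R} => p`_i) T0.
  rewrite coef_poly ltn_ord coef0 insubT//= => ik; move/eqP.
  rewrite mulf_eq0 pnatr_eq0 eqn0Ngt bin_gt0 -ltnS prednK// ltn_ord orbF.
  by move=> /eqP <-; congr c; exact: val_inj.
apply: poly_eq0_01 => t /andP[t0 t1].
have t1n0 : 1 + t != 0 by rewrite gt_eqF// addr_gt0.
have := congr1 (fun p : {poly R} => p.[t / (1 + t)] * (1 + t) ^+ k.-1) c0.
rewrite horner0 mul0r horner_sum mulr_suml => <-.
rewrite horner_poly; apply: eq_bigr => i _; rewrite insubT//= => ik.
rewrite hornerZ horner_bernp /bern (_ : Sub _ _ = i); last exact: val_inj.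
have -> : 1 - t / (1 + t) = (1 + t)^-1 by field.
have ik' : (i <= k.-1)%N by rewrite -ltnS prednK.
have -> : (1 + t) ^+ k.-1 = (1 + t) ^+ i * (1 + t) ^+ (k.-1 - i).
  by rewrite -exprD subnKC.
rewrite expr_div_n exprVn; field.
by rewrite !expf_neq0.
Qed.

Definition bern_gram : 'M[R]_k :=
  \matrix_(i, j) \int[lebesgue_measure]_(x in `[0, 1]) (bernp i * bernp j).[x].

Lemma Rintegral_polyZ (c : R) (p : {poly R}) :
  \int[lebesgue_measure]_(x in `[0, 1]) (c *: p).[x] =
  c * \int[lebesgue_measure]_(x in `[0, 1]) p.[x].
Proof.
rewrite -RintegralZl//; last exact: integrable_poly.
by apply: eq_Rintegral => x _; rewrite hornerZ.
Qed.

Lemma Rintegral_poly_sum (I : Type) (s : seq I) (F : I -> {poly R}) :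
  \int[lebesgue_measure]_(x in `[0, 1]) (\sum_(i <- s) F i).[x] =
  \sum_(i <- s) \int[lebesgue_measure]_(x in `[0, 1]) (F i).[x].
Proof.
elim: s => [|i s IH].
  by rewrite !big_nil -(scale0r (0 : {poly R})) Rintegral_polyZ mul0r.
rewrite !big_cons -IH -RintegralD//; [|exact: integrable_poly..].
by apply: eq_Rintegral => x _; rewrite hornerD.
Qed.

Lemma bern_gram_sym : bern_gram^T = bern_gram.
Proof. by apply/matrixP => i j; rewrite !mxE mulrC. Qed.

(** A vector in the kernel of the Gram matrix gives a polynomial whose square has integral 0. *)
Lemma bern_gram_unit : bern_gram \in unitmx.
Proof.
rewrite -row_free_unit -kermx_eq0; apply/rowV0P => v /sub_kermxP vG.
pose p := \sum_i v 0 i *: bernp i.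
suff p0 : p = 0 by apply/rowP => i; rewrite mxE (bernp_free p0).
apply: poly_sqr_integral_eq0.
have -> : p ^+ 2 = \sum_j v 0 j *: (\sum_i v 0 i *: (bernp i * bernp j)).
  rewrite expr2 {2}/p mulr_sumr; apply: eq_bigr => j _.
  by rewrite -scalerAr /p mulr_suml; congr (_ *: _); apply: eq_bigr => i _; rewrite scalerAl.
rewrite Rintegral_poly_sum big1// => j _; rewrite Rintegral_polyZ Rintegral_poly_sum.
have := congr1 (fun M : 'rV_k => M 0 j) vG; rewrite !mxE => vGj.
rewrite (_ : \sum_(i <- _) _ = 0) ?mulr0// -[RHS]vGj.
by apply: eq_bigr => i _; rewrite mxE Rintegral_polyZ.
Qed.

(** The reproducing kernel, in L_2[0, 1], of the polynomials of degree less than [k], in the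
    Bernstein basis. *)
Definition bern_kernel (u v : R) : R :=
  \sum_(i < k) \sum_(j < k) invmx bern_gram i j * bern k.-1 i u * bern k.-1 j v.

Lemma bern_kernelC u v : bern_kernel u v = bern_kernel v u.
Proof.
rewrite /bern_kernel exchange_big; apply: eq_bigr => i _; apply: eq_bigr => j _.
rewrite -[in RHS]bern_gram_sym -trmx_inv mxE; ring.
Qed.

Definition bern_kernelp (u : R) : {poly R} :=
  \sum_(j < k) (\sum_(i < k) invmx bern_gram i j * bern k.-1 i u) *: bernp j.

Lemma horner_bern_kernelp u v : (bern_kernelp u).[v] = bern_kernel u v.
Proof.
rewrite horner_sum /bern_kernel exchange_big; apply: eq_bigr => j _.
by rewrite hornerZ horner_bernp mulr_suml.
Qed.

Lemma bern_kernelp_reproducing l u : (l < k)%N ->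
  \int[lebesgue_measure]_(v in `[0, 1]) (bern_kernelp u * bernp l).[v] = bern k.-1 l u.
Proof.
move=> lk; rewrite mulr_suml Rintegral_poly_sum.
transitivity (\sum_(i < k) bern k.-1 i u * (invmx bern_gram *m bern_gram) i (Ordinal lk)).
  under eq_bigr do rewrite -scalerAl Rintegral_polyZ mulr_suml.
  rewrite exchange_big; apply: eq_bigr => i _; rewrite mxE mulr_sumr.
  by apply: eq_bigr => j _; rewrite [bern_gram j _]mxE; ring.
rewrite mulVmx ?bern_gram_unit// (bigD1 (Ordinal lk))//= big1 => [|i il].
  by rewrite mxE eqxx mulr1 addr0.
by rewrite mxE (negbTE il) mulr0.
Qed.

(** By reproduction the value is the integral of the square of the kernel at 0. It is not 0, since
    this kernel reproduces the value 1 of the first Bernstein polynomial at 0. *)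
Lemma bern_kernel00_gt0 : 0 < bern_kernel 0 0.
Proof.
have b0 i : (i < k)%N -> bern k.-1 i 0 = (i == 0%N)%:R :> R.
  move=> ik; rewrite /bern; case: i ik => [|i] ik.
    by rewrite bin0 expr0 subr0 expr1n !mulr1.
  by rewrite expr0n/= mulr0 mul0r.
have E : bern_kernel 0 0 =
    \int[lebesgue_measure]_(v in `[0, 1]) (bern_kernelp 0 ^+ 2).[v].
  rewrite expr2 {2}/bern_kernelp mulr_sumr Rintegral_poly_sum.
  under eq_bigr => j _ do rewrite -scalerAr Rintegral_polyZ bern_kernelp_reproducing//.
  rewrite -horner_bern_kernelp horner_sum; apply: eq_bigr => j _.
  by rewrite hornerZ horner_bernp.
rewrite lt_neqAle E Rintegral_ge0 ?andbT => [|v _]; last by rewrite horner_exp sqr_ge0.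
apply/eqP => /esym/poly_sqr_integral_eq0 p0.
have := bern_kernelp_reproducing 0 k_gt0; rewrite p0 mul0r b0//=.
rewrite -(scale0r (0 : {poly R})) Rintegral_polyZ mul0r => /esym/eqP.
by rewrite oner_eq0.
Qed.

Lemma bern_kernel_lipschitz : exists2 L : R, 0 <= L & forall u v v' : R,
  0 <= u <= 1 -> 0 <= v <= 1 -> 0 <= v' <= 1 ->
  `|bern_kernel u v - bern_kernel u v'| <= L * `|v - v'|.
Proof.
have /all_sig2[L L0 LP] (i : nat) := cid2 (poly_lipschitz01 (bernp i)).
pose B i : R := `|(bernp i).[0]| + L i.
have BP i (u : R) : 0 <= u <= 1 -> `|bern k.-1 i u| <= B i.
  move=> /[dup] u01 /andP[u0 u1]; rewrite -horner_bernp.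
  rewrite -[(bernp i).[u]](subrK (bernp i).[0]) (le_trans (ler_normD _ _))// addrC lerD2l.
  by rewrite (le_trans (LP _ _ _ _ _))// ?lexx ?ler01// subr0 ger0_norm// ler_piMr.
exists (\sum_(i < k) \sum_(j < k) `|invmx bern_gram i j| * B i * L j).
  by apply: sumr_ge0 => i _; apply: sumr_ge0 => j _; rewrite !mulr_ge0// addr_ge0.
move=> u v v' u01 v01 v'01; rewrite -sumrB (le_trans (ler_norm_sum _ _ _))//.
rewrite mulr_suml; apply: ler_sum => i _.
rewrite -sumrB (le_trans (ler_norm_sum _ _ _))// mulr_suml; apply: ler_sum => j _.
rewrite -mulrBr normrM (normrM (invmx bern_gram i j)) -[leRHS]mulrA; apply: ler_pM => //.
  by rewrite ler_wpM2l// BP.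
by rewrite -!horner_bernp LP.
Qed.

Lemma bern_kernel_bounded : exists2 C : R, 0 <= C & forall u v : R,
  0 <= u <= 1 -> 0 <= v <= 1 -> `|bern_kernel u v| <= C.
Proof.
have [L L0 LP] := bern_kernel_lipschitz.
exists (`|bern_kernel 0 0| + L + L) => [|u v /[dup] u01 /andP[u0 u1] /[dup] v01 /andP[v0 v1]].
  by rewrite !addr_ge0.
have z01 : (0 : R) <= (0 : R) <= 1 by rewrite lexx ler01.
have -> : bern_kernel u v = bern_kernel 0 0 + (bern_kernel u 0 - bern_kernel 0 0) +
  (bern_kernel u v - bern_kernel u 0) by ring.
rewrite (le_trans (ler_normD _ _))// lerD//.
  rewrite (le_trans (ler_normD _ _))// lerD2l// bern_kernelC (le_trans (LP _ _ _ _ _ _))//.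
  by rewrite subr0 ger0_norm// ler_piMr.
by rewrite (le_trans (LP _ _ _ _ _ _))// subr0 ger0_norm// ler_piMr.
Qed.

Lemma bern_kernel_corner : exists (c : R) (q : nat), [/\ 0 < c, (1 < q)%N & forall u v,
  0 <= u <= q%:R^-1 -> 0 <= v <= q%:R^-1 -> c <= bern_kernel u v].
Proof.
have [L L0 LP] := bern_kernel_lipschitz; have K0 := bern_kernel00_gt0.
set c := bern_kernel 0 0 in K0.
(* With 4 L / c < q, moving both variables by at most 1/q from the corner costs at most half of [c].
   The second successor ensures 1 < q. *)
pose q := (Num.truncn (4 * L / c)).+2.
exists (c / 2), q; split=> //; first by rewrite divr_gt0.
have q0 : 0 < q%:R^-1 :> R by rewrite invr_gt0.
have Lq : 4 * L * q%:R^-1 <= c.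
  rewrite ler_pdivrMr// -ler_pdivrMl// mulrC ltW//.
  by apply: lt_trans (truncnS_gt _) _; rewrite ltr_nat.
have q1 : q%:R^-1 <= 1 :> R by rewrite invf_le1// ler1n.
move=> u v /andP[u0 uq] /andP[v0 vq].
have z01 : (0 : R) <= (0 : R) <= 1 by rewrite lexx ler01.
have u01 : 0 <= u <= 1 by rewrite u0 (le_trans uq).
have v01 : 0 <= v <= 1 by rewrite v0 (le_trans vq).
have := LP _ _ _ u01 v01 z01; have := LP _ _ _ z01 u01 z01.
rewrite !subr0 (ger0_norm u0) (ger0_norm v0) -/c (bern_kernelC u 0) !ler_norml => /andP[A _] /andP[B _].
have : L * u <= L * q%:R^-1 by rewrite ler_wpM2l.
have : L * v <= L * q%:R^-1 by rewrite ler_wpM2l.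
move: Lq A B; set z := q%:R^-1; lra.
Qed.

Lemma sum_bern u : \sum_(r < k) bern k.-1 r u = 1 :> R.
Proof.
have := exprDn (1 - u) u k.-1; rewrite subrK expr1n prednK// => ->.
by apply: eq_bigr => i _; rewrite /bern -mulr_natl; ring.
Qed.

End bernstein_kernel.

(** * Integrals of products of functions of one coordinate *)

Section product_integrals.
Context (R : realType).
Notation lam := (@lebesgue_measure R).

Lemma bounded_integrable d (T : measurableType d) (mu : {measure set T -> \bar R})
    (D : set T) (f : T -> R) (C : R) :
  measurable D -> (mu D < +oo)%E -> measurable_fun D f ->
  (forall x, D x -> `|f x| <= C) -> mu.-integrable D (EFin \o f).
Proof.
move=> mD muD mf fC; apply: measurable_bounded_integrable => //.
by exists C; split; [exact: num_real | move=> x Cx y /fC/le_trans; apply; exact: ltW].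
Qed.

Lemma integrable_bounded_mul d (T : measurableType d) (mu : {measure set T -> \bar R})
    (D : set T) (f g : T -> R) (C : R) :
  measurable D -> mu.-integrable D (EFin \o f) -> measurable_fun D g ->
  (forall x, D x -> `|g x| <= C) -> mu.-integrable D (EFin \o (fun x => f x * g x)).
Proof.
move=> mD fi mg gC.
have gb : [bounded g x | x in D].
  by exists C; split; [exact: num_real | move=> x Cx y /gC/le_trans; apply; exact: ltW].
apply: eq_integrable (integrableMr mD mg gb fi) => // x _ /=.
by rewrite -EFinM mulrC.
Qed.

Lemma measurable_unit_cube d : measurable (unit_cube R d).
Proof.
rewrite (_ : unit_cube R d = \bigcap_(i in [set: 'I_d])
   ((fun x : Rd R d => tnth x i) @^-1` `[0, 1])).
  apply: fin_bigcap_measurable => // i _.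
  by rewrite -[X in measurable X]setTI; exact: measurable_tnth.
apply/seteqP; split => x /= x01.
  by move=> i _ /=; rewrite in_itv/=; exact: x01.
by move=> mu; have := x01 mu I; rewrite /= in_itv.
Qed.

Lemma lebesgue_unit_cube d : lebesgue_tuple R d (unit_cube R d) = 1%E.
Proof.
have := @lebesgue_tuple_box R d (fun=> `[0, 1]%classic).
rewrite (_ : [set x : Rd R d | _] = unit_cube R d); last first.
  by apply/seteqP; split => x xP i; have := xP i; rewrite /= in_itv.
move=> ->//; rewrite big1// => i _.
by rewrite lebesgue_measure_itv/= lte_fin ltr01 sube0.
Qed.

Lemma lebesgue_unit_cube_lty d : (lebesgue_tuple R d (unit_cube R d) < +oo)%E.
Proof. by rewrite lebesgue_unit_cube ltry. Qed.

(** Fubini, by induction on the dimension. Integrability is part of the conclusion because the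
    inductive step applies Fubini to a product containing the remaining coordinates. *)
Lemma integral_lebesgue_tuple_prod d (f : 'I_d -> R -> R) :
  (forall mu, lam.-integrable setT (EFin \o f mu)) ->
  (lebesgue_tuple R d).-integrable setT
    (EFin \o (fun x : Rd R d => \prod_mu f mu (tnth x mu))) /\
  (\int[lebesgue_tuple R d]_x (\prod_mu f mu (tnth x mu))%:E =
  (\prod_mu \int[lam]_x f mu x)%:E)%E.
Proof.
elim: d f => [f _|d IH f fi].
  split.
    apply: (@bounded_integrable _ _ _ _ _ 1) => //.
    - by rewrite /= diracT ltry.
    - by apply: measurable_prod => -[].
    - by move=> x _; rewrite big_ord0 normr1.
  rewrite /= integral_dirac//=; last first.
    by apply/measurable_EFinP; apply: measurable_prod => -[].
  by rewrite diracT mul1e !big_ord0.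
pose g mu := f (lift ord0 mu).
have [gi gE] := IH g (fun mu => fi _).
pose F (x : Rd R d.+1) : R := \prod_mu f mu (tnth x mu).
pose G (y : Rd R d) : R := \prod_mu g mu (tnth y mu).
have FE x y : F (tcons (x, y)) = f ord0 x * G y.
  rewrite /F big_ord_recl; congr (_ * _).
  by apply: eq_bigr => i _; rewrite tnthS.
have mf0 : measurable_fun setT (f ord0).
  by apply/measurable_EFinP; exact: measurable_int (fi ord0).
have mG : measurable_fun setT G by apply/measurable_EFinP; exact: measurable_int gi.
have mF : measurable_fun setT (EFin \o F).
  apply/measurable_EFinP; apply: measurable_prod => i _.
  apply: (@measurableT_comp _ _ _ _ _ _ (f i)); last exact: measurable_tnth.
  by apply/measurable_EFinP; exact: measurable_int (fi i).
have mFt : measurable_fun setT (EFin \o F \o @tcons R d).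
  by apply: measurableT_comp => //; exact: measurable_tcons.
have Fi : (lam \x lebesgue_tuple R d)%E.-integrable setT (EFin \o F \o @tcons R d).
  apply/(integrable12ltyP _ _ mFt).
  under eq_integral => x _.
    under eq_integral => y _ do rewrite /= FE normrM EFinM.
    rewrite ge0_integralZl//; last first.
      by apply/measurable_EFinP; exact: measurableT_comp.
    over.
  have [C CE] : exists C : R, (\int[lebesgue_tuple R d]_y (`|G y|)%:E = C%:E)%E.
    have /integrableP[_] := gi; rewrite -ge0_fin_numE; last exact: integral_ge0.
    by move=> /fineK <-; eexists.
  rewrite CE ge0_integralZr//; last 2 first.
    by apply/measurable_EFinP; exact: measurableT_comp.
    by rewrite -CE integral_ge0.
  have /integrableP[_ fi0] := fi ord0.
  by rewrite -CE CE; apply: lte_mul_pinfty => //; [exact: integral_ge0|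
    rewrite ge0_fin_numE//; exact: integral_ge0|rewrite ltry].
have Fi' : (lam \x lebesgue_tuple R d)%E.-integrable (@tcons R d @^-1` setT)
    (EFin \o F \o @tcons R d) by rewrite preimage_setT.
split.
  exact: (integrable_pushforward (@measurable_tcons R d) mF Fi').
rewrite [LHS](integral_pushforward (@measurable_tcons R d) mF Fi')//.
rewrite preimage_setT -(integral12_prod_meas1 Fi) /fubini_F big_ord_recl EFinM.
under eq_integral => x _.
  under eq_integral => y _ do rewrite /= FE EFinM.
  rewrite integralZl// gE.
  over.
rewrite [LHS](integralZr measurableT (fi ord0)) -[X in (X * _)%E]fineK//.
exact: integrable_fin_num (fi ord0).
Qed.

Lemma Rintegral_unit_cube_prod d (f : 'I_d -> R -> R) :
  (forall mu, lam.-integrable `[0, 1] (EFin \o f mu)) ->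
  \int[lebesgue_tuple R d]_(x in unit_cube R d) (\prod_mu f mu (tnth x mu)) =
  \prod_mu \int[lam]_(x in `[0, 1]) f mu x.
Proof.
move=> fi; rewrite Rintegral_mkcond.
under [RHS]eq_bigr do rewrite Rintegral_mkcond.
have fi' mu : lam.-integrable setT (EFin \o (f mu \_ `[0, 1])).
  rewrite -restrict_EFin.
  exact: (@integrable_mkcond _ _ R lam `[0, 1] (EFin \o f mu) (measurable_itv _)).1 (fi mu).
have [_ E] := integral_lebesgue_tuple_prod fi'.
rewrite -[RHS]/(fine (_%:E)) -E /Rintegral; congr fine.
apply: eq_integral => x _; congr EFin.
rewrite patchE; case: ifPn => [|/negP]; rewrite inE => xc.
  by apply: eq_bigr => mu _; rewrite patchE mem_set//= in_itv/=; exact: xc.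
have [mu xmu] : exists mu, ~~ (0 <= tnth x mu <= 1).
  apply: contrapT => h; apply: xc => mu.
  by apply/negPn/negP => h'; apply: h; exists mu.
by rewrite (bigD1 mu)//= patchE memNset/= ?in_itv/= ?mul0r//; exact/negP.
Qed.

End product_integrals.

(** The index types depend on [i]. They are embedded in a common ['I_M], with [M] the largest [n i],
    where distributivity holds for sums restricted to [j < n i]. *)
Lemma bigA_distr_dffun (R : comPzRingType) (I : finType) (n : I -> nat)
    (F : forall i : I, 'I_(n i) -> R) :
  \prod_i \sum_(j < n i) F i j =
  \sum_(f : {dffun forall i : I, 'I_(n i)}) \prod_i F i (f i).
Proof.
pose M := \max_i n i.
have nM i : (n i <= M)%N by exact: leq_bigmax.
pose G i (j : 'I_M) := oapp (F i) 0 (insub (val j)).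
have GE i (j : 'I_(n i)) : G i (widen_ord (nM i) j) = F i j.
  by rewrite /G insubT//= => jn; congr (F i _); exact: val_inj.
transitivity (\prod_i \sum_(j < M | (j < n i)%N) G i j).
  apply: eq_bigr => i _; rewrite -(big_ord_widen _ (fun j => oapp (F i) 0 (insub j)) (nM i)).
  by apply: eq_bigr => j _; rewrite valK.
rewrite bigA_distr_big_dep.
pose h (f : {dffun forall i : I, 'I_(n i)}) : {ffun I -> 'I_M} :=
  [ffun i => widen_ord (nM i) (f i)].
have hinj : injective h.
  move=> f g /ffunP fg; apply/ffunP => i; apply: val_inj.
  by have := congr1 val (fg i); rewrite !ffunE.
rewrite (eq_bigl (mem [set h f | f in [set: {dffun forall i : I, 'I_(n i)}]]%SET)); last first.
  move=> g; apply/familyP/imsetP => [gn|[f _ ->] i]; last first.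
    by rewrite ffunE unfold_in; exact: ltn_ord (f i).
  exists [ffun i => Ordinal (gn i) : 'I_(n i)]; first by rewrite finset.in_setT.
  by apply/ffunP => i; rewrite !ffunE; exact: val_inj.
rewrite big_imset; last by move=> ? ? _ _; exact: hinj.
apply: eq_big => [f|f _]; first by rewrite finset.in_setT.
by apply: eq_bigr => i _; rewrite ffunE GE.
Qed.

(** * B-splines and the kernel of the projection on their tensor products *)

Section bspline_regularity.
Context (R : realType).

Lemma measurable_bspline (t : nat -> R) p i : measurable_fun setT (bspline t p i).
Proof.
elim: p i => [|p IH] i /=.
  apply: (@measurableT_comp _ _ _ _ _ _ (fun b : bool => b%:R : R)) => //.
  apply: measurable_or.
    by apply: measurable_and; [exact: measurable_fun_ler|exact: measurable_fun_ltr].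
  apply: measurable_and => //; apply: measurable_and => //.
  exact: measurable_fun_eqr.
apply: measurable_funD; apply: measurable_funM => //.
  by apply: measurable_funM => //; exact: measurable_funB.
by apply: measurable_funM => //; exact: measurable_funB.
Qed.

Lemma bspline_bounded (t : nat -> R) p i :
  exists2 C : R, 0 <= C & forall x : R, 0 <= x <= 1 -> `|bspline t p i x| <= C.
Proof.
elim: p i => [|p IH] i /=.
  by exists 1 => // x _; case: (_ || _); rewrite ?normr1 ?normr0.
have [C C0 CP] := IH i; have [C' C'0 C'P] := IH i.+1.
exists ((1 + `|t i|) * `|(t (i + p.+1)%N - t i)^-1| * C +
        (1 + `|t (i + p.+1).+1|) * `|(t (i + p.+1).+1 - t i.+1)^-1| * C') => [|x x01].
  by rewrite addr_ge0// !mulr_ge0// addr_ge0.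
have xs s : `|x - s| <= 1 + `|s|.
  by rewrite (le_trans (ler_normB _ _))// lerD2r ger0_norm; case/andP: x01.
rewrite (le_trans (ler_normD _ _))// lerD// !normrM.
  by apply: ler_pM; rewrite ?mulr_ge0// ?CP// ler_wpM2r.
by apply: ler_pM; rewrite ?mulr_ge0// ?C'P// ler_wpM2r// distrC.
Qed.

End bspline_regularity.

Section spline_projection.
Context (R : realType) (d : nat) (k : 'I_d -> nat) (D : multipartition R k).
Notation lam := (@lebesgue_measure R).
Notation Leb := (lebesgue_tuple R d).
Notation cube := (unit_cube R d).
Notation B mu i := (bspline (knot (D mu)) (k mu).-1 i).

Definition gram mu : 'M[R]_(pdim (D mu)) :=
  \matrix_(i, j) \int[lam]_(x in `[0, 1]) (B mu i x * B mu j x).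

Lemma measurable_tensor_bspline (i : multi_index D) :
  measurable_fun setT (tensor_bspline i).
Proof.
apply: measurable_prod => mu _.
apply: (@measurableT_comp _ _ _ _ _ _ (B mu (i mu))); first exact: measurable_bspline.
exact: measurable_tnth.
Qed.

Lemma tensor_bspline_bounded (i : multi_index D) :
  exists C : R, forall x, cube x -> `|tensor_bspline i x| <= C.
Proof.
have /all_sig2[C C0 CP] mu := cid2 (bspline_bounded (knot (D mu)) (k mu).-1 (i mu)).
exists (\prod_mu C mu) => x x01; rewrite normr_prod.
by apply: ler_prod => mu _; rewrite normr_ge0/= CP//; exact: x01.
Qed.

Lemma integrable_mul_tensor_bspline (f : Rd R d -> R) (i : multi_index D) :
  Leb.-integrable cube (EFin \o f) ->
  Leb.-integrable cube (EFin \o (fun x => f x * tensor_bspline i x)).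
Proof.
have [C CP] := tensor_bspline_bounded i.
move=> fi; apply: (integrable_bounded_mul (C := C)) => //.
  exact: measurable_unit_cube.
exact: measurable_funTS (measurable_tensor_bspline i).
Qed.

Lemma integrable_tensor_bspline (i : multi_index D) :
  Leb.-integrable cube (EFin \o tensor_bspline i).
Proof.
have [C CP] := tensor_bspline_bounded i.
apply: (bounded_integrable (C := C)) => //.
- exact: measurable_unit_cube.
- exact: lebesgue_unit_cube_lty.
- exact: measurable_funTS (measurable_tensor_bspline i).
Qed.

Lemma inner_tensor_bspline (i j : multi_index D) :
  inner (tensor_bspline i) (tensor_bspline j) = \prod_mu gram mu (i mu) (j mu).
Proof.
rewrite /inner.
transitivity (\int[Leb]_(x in cube)
    \prod_mu (B mu (i mu) (tnth x mu) * B mu (j mu) (tnth x mu))).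
  by apply: eq_Rintegral => x _; rewrite big_split.
rewrite (Rintegral_unit_cube_prod (f := fun mu x => B mu (i mu) x * B mu (j mu) x)).
  by apply: eq_bigr => mu _; rewrite mxE.
move=> mu.
have [C _ CP] := bspline_bounded (knot (D mu)) (k mu).-1 (i mu).
have [C' _ C'P] := bspline_bounded (knot (D mu)) (k mu).-1 (j mu).
have mB (l : nat) : measurable_fun (`[0, 1]%classic : set (measurableTypeR R)) (B mu l).
  exact: measurable_funTS (measurable_bspline _ _ _).
have lam01 : (lam `[0%R, 1%R] < +oo)%E.
  by rewrite lebesgue_measure_itv/= lte_fin ltr01 sube0 ltry.
apply: (integrable_bounded_mul (C := C')) => //.
exact: (bounded_integrable (C := C)).
Qed.

Lemma Rintegral_sum (I : Type) (s : seq I) (F : I -> Rd R d -> R) :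
  (forall i, Leb.-integrable cube (EFin \o F i)) ->
  \int[Leb]_(x in cube) (\sum_(i <- s) F i x) =
  \sum_(i <- s) \int[Leb]_(x in cube) F i x.
Proof.
move=> Fi; have mc := @measurable_unit_cube R d; elim: s => [|i s IH].
  under eq_Rintegral do rewrite big_nil.
  by rewrite big_nil Rintegral_cst// mul0r.
under eq_Rintegral do rewrite big_cons.
rewrite RintegralD//; first by rewrite big_cons IH.
rewrite (_ : _ \o _ = fun x => (\sum_(j <- s) (F j x)%:E)%E).
  by apply: (integrable_sum mc s (P := xpredT) (h := fun i => EFin \o F i)) => i' _.
by apply/funext => x; rewrite /= sumEFin.
Qed.

Context (L : forall mu, 'M[R]_(pdim (D mu))) (gramL : forall mu, gram mu *m L mu = 1%:M).

(** The kernel of the univariate orthogonal projection in direction [mu], expressed through the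
    inverse [L mu] of the Gram matrix. *)
Definition proj_kernel mu (x y : R) : R := \sum_i \sum_j L mu i j * B mu i y * B mu j x.

Let G (i j : multi_index D) := \prod_mu gram mu (i mu) (j mu).
Let LL (i j : multi_index D) := \prod_mu L mu (i mu) (j mu).

(** A Kronecker product of inverse matrices is the inverse of the Kronecker product. *)
Let delta_prod (M N : forall mu, 'M[R]_(pdim (D mu))) (i l : multi_index D) :
  (forall mu, M mu *m N mu = 1%:M) ->
  \sum_(j : multi_index D) (\prod_mu M mu (i mu) (j mu)) * (\prod_mu N mu (j mu) (l mu)) =
  (i == l)%:R.
Proof.
move=> MN; transitivity (\prod_mu \sum_j M mu (i mu) j * N mu j (l mu)).
  rewrite bigA_distr_dffun; apply: eq_bigr => j _; exact/esym/big_split.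
have E mu : \sum_j M mu (i mu) j * N mu j (l mu) = (i mu == l mu)%:R.
  by have := congr1 (fun A : 'M[R]_(pdim (D mu)) => A (i mu) (l mu)) (MN mu); rewrite !mxE.
under eq_bigr do rewrite E.
have [->|il] := eqVneq i l; first by rewrite big1// => mu _; rewrite eqxx.
have [mu imu] : exists mu, i mu != l mu.
  apply: contrapT => h; move/eqP: il; apply; apply/ffunP => mu.
  by apply/eqP/negPn/negP => h'; apply: h; exists mu.
by rewrite (bigD1 mu)//= (negbTE imu) mul0r.
Qed.

Let sum_delta (M N : forall mu, 'M[R]_(pdim (D mu))) (a : multi_index D -> R)
    (j : multi_index D) : (forall mu, M mu *m N mu = 1%:M) ->
  \sum_(m : multi_index D) (\sum_(l : multi_index D) a l * (\prod_mu M mu (l mu) (m mu))) *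
    (\prod_mu N mu (m mu) (j mu)) = a j.
Proof.
move=> MN; under eq_bigr do rewrite mulr_suml.
rewrite exchange_big; transitivity (\sum_(l : multi_index D) a l * (l == j)%:R).
  apply: eq_bigr => l _; rewrite -(delta_prod _ _ MN) mulr_sumr.
  by apply: eq_bigr => m _; rewrite mulrA.
rewrite (bigD1 j)//= big1 => [|l /negbTE ->]; last by rewrite mulr0.
by rewrite eqxx mulr1 addr0.
Qed.

(** The Gram matrix of the tensor B-splines is the Kronecker product of the univariate ones, so [LL]
    is its inverse. One side of the inversion shows that the spline with coefficients [c] has the
    required pairings, the other that it is the only one; [xget] therefore returns it. *)
Lemma spline_projE (f : Rd R d -> R) (x : Rd R d) :
  Leb.-integrable cube (EFin \o f) ->
  spline_proj D f x =
  \int[Leb]_(y in cube) (f y * \prod_mu proj_kernel mu (tnth x mu) (tnth y mu)).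
Proof.
move=> fi; have mc := @measurable_unit_cube R d.
have Lgram mu : L mu *m gram mu = 1%:M by apply: mulmx1C.
have innerE c l : inner (fun x => \sum_(i : multi_index D) c i * tensor_bspline i x)
    (tensor_bspline l) = \sum_i c i * G i l.
  rewrite /inner.
  under eq_Rintegral do rewrite mulr_suml.
  have Ti i := integrable_mul_tensor_bspline l (integrable_tensor_bspline i).
  rewrite Rintegral_sum => [|i].
    apply: eq_bigr => i _; rewrite -[G i l]inner_tensor_bspline /inner -RintegralZl//.
    by apply: eq_Rintegral => y _; rewrite mulrA.
  apply: eq_integrable (integrableZl mc (c i) (Ti i)) => // y _ /=.
  by rewrite -EFinM mulrA.
pose c m := \sum_l inner f (tensor_bspline l) * LL l m.
pose g := fun x => \sum_(m : multi_index D) c m * tensor_bspline m x.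
have -> : spline_proj D f = g.
  apply: xget_unique.
    split; first by exists c.
    by move=> j; rewrite innerE; exact: (sum_delta (fun l => inner f (tensor_bspline l))).
  move=> _ [[c' ->]] c'P; apply/funext => y; apply: eq_bigr => m _; congr (_ * _).
  rewrite /c; under eq_bigr do rewrite -c'P innerE.
  by rewrite (sum_delta c').
have kE y : \prod_mu proj_kernel mu (tnth x mu) (tnth y mu) =
    \sum_(l : multi_index D) \sum_(m : multi_index D)
      LL l m * tensor_bspline l y * tensor_bspline m x.
  rewrite bigA_distr_dffun; apply: eq_bigr => l _.
  rewrite bigA_distr_dffun; apply: eq_bigr => m _.
  by rewrite !big_split.
under [RHS]eq_Rintegral => y _.
  rewrite kE mulr_sumr.
  under eq_bigr do rewrite mulr_sumr.
  over.
have Ti l := integrable_mul_tensor_bspline l fi.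
rewrite Rintegral_sum => [|l].
  rewrite /g /c; under eq_bigr do rewrite mulr_suml.
  rewrite exchange_big; apply: eq_bigr => l _.
  transitivity (\int[Leb]_(y in cube) ((\sum_m LL l m * tensor_bspline m x) *
      (f y * tensor_bspline l y))).
    rewrite RintegralZl// mulrC mulr_sumr; apply: eq_bigr => m _.
    by rewrite /inner mulrA.
  apply: eq_Rintegral => y _; rewrite mulr_suml; apply: eq_bigr => m _; ring.
apply: eq_integrable (integrableZl mc (\sum_m LL l m * tensor_bspline m x) (Ti l)) => // y _ /=.
rewrite -EFinM; congr EFin; rewrite mulr_suml; apply: eq_bigr => m _; ring.
Qed.

End spline_projection.

Lemma sum_ord_mul (V : nmodType) (m n : nat) (F : nat -> V) :
  \sum_(i < m * n) F i = \sum_(i < m) \sum_(j < n) F (i * n + j)%N.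
Proof.
elim: m => [|m IH]; first by rewrite mul0n !big_ord0.
rewrite big_ord_recr -IH -!(big_mkord xpredT F) mulSn addnC /=.
rewrite (big_cat_nat (n := m * n)%N) ?leq_addr//=; congr (_ + _).
rewrite -{1}[(m * n)%N]add0n big_addn addKn big_mkord.
by apply: eq_bigr => j _; rewrite addnC.
Qed.

(** * The kernel of the projection on a uniform grid *)

Section uniform_kernel.
Context (R : realType).
Notation lam := (@lebesgue_measure R).

Lemma in_cellP N c (x : R) : (c < N)%N -> in_cell N c x ->
  0 <= N%:R * x - c%:R <= 1 /\ 0 <= x <= 1.
Proof.
move=> cN; have N0 : 0 < N%:R :> R by rewrite ltr0n (leq_ltn_trans _ cN).
have cN' : c.+1%:R / N%:R <= 1 :> R by rewrite ler_pdivrMr// mul1r ler_nat.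
rewrite /in_cell => /orP[/andP[cx xc]|/andP[/eqP cN1 /eqP ->]].
  split; last first.
    by rewrite (le_trans _ cx) ?divr_ge0 ?ler0n//= ltW// (lt_le_trans xc).
  move: cx xc; rewrite ler_pdivrMr// ltr_pdivlMr// mulrC -natr1 => cx xc.
  by rewrite subr_ge0 cx/= lerBlDl ltW// addrC mulrC.
rewrite mulr1 ler01 lexx; split => //.
move: cN1 => /eqP; rewrite eq_le => /andP[_]; rewrite ler_pdivlMr// mul1r ler_nat => Nc.
have -> : N = c.+1 by apply/eqP; rewrite eqn_leq Nc cN.
by rewrite -natr1 addrAC subrr add0r ler01 lexx.
Qed.

Lemma in_cell_inj N c c' (x : R) : (c < N)%N -> (c' < N)%N ->
  in_cell N c x -> in_cell N c' x -> c = c'.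
Proof.
wlog cc' : c c' / (c < c')%N.
  move=> H cN c'N xc xc'; have [cc'|c'c|//] := ltngtP c c'; first exact: H xc xc'.
  by apply/esym; exact: H xc' xc.
move=> cN c'N; have N0 : 0 < N%:R :> R by rewrite ltr0n (leq_ltn_trans _ cN).
have c'N' : c'%:R / N%:R < 1 :> R by rewrite ltr_pdivrMr// mul1r ltr_nat.
have cc'N : c.+1%:R / N%:R <= c'%:R / N%:R :> R.
  by rewrite ler_pM2r ?invr_gt0// ler_nat.
rewrite /in_cell => /orP[/andP[_ xc]|/andP[/eqP cN1 _]]; last first.
  by move: (le_lt_trans cc'N c'N'); rewrite cN1 ltxx.
move=> /orP[/andP[xc' _]|/andP[_ /eqP x1]].
  by move: (lt_le_trans xc (le_trans cc'N xc')); rewrite ltxx.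
by move: (lt_le_trans xc cc'N); rewrite x1 ltNge ltW.
Qed.

Lemma Rintegral_in_cell N c (p : {poly R}) : (c < N)%N ->
  \int[lam]_(x in `[0, 1]) (p.[N%:R * x - c%:R] * (in_cell N c x)%:R) =
  N%:R^-1 * \int[lam]_(x in `[0, 1]) p.[x].
Proof.
move=> cN; have N0 : 0 < N%:R :> R by rewrite ltr0n (leq_ltn_trans _ cN).
rewrite -(Rintegral_poly_affine p c%:R N0).
have cE : c%:R + 1 = c.+1%:R :> R by rewrite natr1.
have cN' : c.+1%:R / N%:R <= 1 :> R by rewrite ler_pdivrMr// mul1r ler_nat.
have c0 : 0 <= c%:R / N%:R :> R by rewrite divr_ge0 ?ler0n.
have cc1 : c%:R / N%:R <= c.+1%:R / N%:R :> R by rewrite ler_pM2r ?invr_gt0// ler_nat.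
transitivity (\int[lam]_(x in `[0, 1] `&` [set x | in_cell N c x]) p.[N%:R * x - c%:R]).
  rewrite Rintegral_mkcondr; apply: eq_Rintegral => x _; rewrite patchE.
  case: (boolP (in_cell N c x)) => xc; first by rewrite mem_set// mulr1.
  by rewrite memNset/= ?mulr0//; exact/negP.
rewrite cE; have [c1|c1] := eqVneq (c.+1%:R / N%:R : R) 1.
  congr (\int[lam]_(x in _) _); apply/seteqP; split => x /=; rewrite !in_itv/= /in_cell c1 eqxx.
    move=> [/andP[x0 x1]] /orP[/andP[-> _]//|/= /eqP ->].
    by rewrite lexx andbT (le_trans cc1)// c1.
  move=> /andP[cx x1]; rewrite (le_trans c0 cx) x1 cx/=; split => //.
  by move: x1; rewrite le_eqVlt orbC.
transitivity (\int[lam]_(x in `[c%:R / N%:R, c.+1%:R / N%:R[) p.[N%:R * x - c%:R]).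
  congr (\int[lam]_(x in _) _); apply/seteqP.
  split => x /=; rewrite !in_itv/= /in_cell (negbTE c1) orbF; first by case.
  move=> /[dup] /andP[cx xc] ->; split => //.
  by rewrite (le_trans c0 cx) (le_trans (ltW xc) cN').
apply: Rintegral_itv_bndo_bndc.
have -> : EFin \o (fun x : R => p.[N%:R * x - c%:R]) =
    EFin \o (fun x => (p \Po (N%:R *: 'X - c%:R%:P)).[x]).
  by apply/funext => x /=; rewrite horner_comp !hornerE.
apply: integrableS (integrable_poly _ (c%:R / N%:R) (c.+1%:R / N%:R)) => //.
exact: subset_itv_co_cc.
Qed.

Context (k : nat) (k_gt0 : (0 < k)%N) (N : nat) (N_gt0 : (0 < N)%N).
Let H := invmx (bern_gram R k).

(** [H] with natural numbers as indices, so that it applies to remainders modulo [k]. *)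
Let Hn (r s : nat) : R := oapp (fun r' => oapp (H r') 0 (insub s)) 0 (insub r).

Let HnE (r s : 'I_k) : Hn r s = H r s. Proof. by rewrite /Hn !valK. Qed.

(** The Gram matrix of the uniform grid is block diagonal, with the block [bern_gram] divided by [N]
    for each cell. This is its inverse, the cell of an index being its quotient by [k]. *)
Definition uniform_dual : 'M[R]_(N * k) :=
  \matrix_(i, j) if (i %/ k == j %/ k)%N then N%:R * Hn (i %% k) (j %% k) else 0.

Notation B i := (bspline (knot (uniform_partition R k_gt0 N_gt0)) k.-1 i).

Let divK c (r : 'I_k) : ((c * k + r) %/ k = c)%N.
Proof. by rewrite divnMDl// divn_small// addn0. Qed.

Let modK c (r : 'I_k) : ((c * k + r) %% k = r)%N.
Proof. by rewrite modnMDl modn_small. Qed.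

Let gram_uniform c c' (r s : 'I_k) : (c < N)%N -> (c' < N)%N ->
  \int[lam]_(x in `[0, 1]) (B (c * k + r)%N x * B (c' * k + s)%N x) =
  (c == c')%:R * (N%:R^-1 * bern_gram R k r s).
Proof.
move=> cN c'N; under eq_Rintegral do rewrite !bspline_uniform//.
have [<-|cc'] := eqVneq c c'; last first.
  under eq_Rintegral => x _.
    rewrite (_ : _ * _ = 0); last first.
      rewrite mulrACA -natrM mulnb; case: (boolP (in_cell N c x && in_cell N c' x)).
        by move=> /andP[xc xc']; case/eqP: cc'; exact: in_cell_inj xc xc'.
      by rewrite mulr0.
    over.
  by rewrite Rintegral_cst// !mul0r.
rewrite mul1r mxE -(Rintegral_in_cell _ cN)//; apply: eq_Rintegral => x _.
by rewrite mulrACA -natrM mulnb andbb hornerM !horner_bernp.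
Qed.

Lemma uniform_dualP :
  (\matrix_(i < N * k, j < N * k) \int[lam]_(x in `[0, 1]) (B (val i) x * B (val j) x)) *m uniform_dual = 1%:M
  :> 'M[R]_(N * k).
Proof.
have N0 : N%:R != 0 :> R by rewrite pnatr_eq0 -lt0n.
apply/matrixP => i l; rewrite !mxE.
pose F (j : nat) := \int[lam]_(x in `[0, 1]) (B (val i) x * B j x) *
  (if (j %/ k == l %/ k)%N then N%:R * Hn (j %% k) (l %% k) else 0).
transitivity (\sum_(j < N * k) F j); first by apply: eq_bigr => j _; rewrite !mxE.
have iN : (i %/ k < N)%N by rewrite ltn_divLR.
have lN : (l %/ k < N)%N by rewrite ltn_divLR.
rewrite sum_ord_mul (bigD1 (Ordinal lN))//= [X in _ + X]big1 ?addr0 => [|c /eqP cl]; last first.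
  rewrite big1// => s _; rewrite /F divK ifF ?mulr0//.
  by apply/negbTE/eqP => cl'; apply: cl; exact: val_inj.
pose r := Ordinal (ltn_pmod i k_gt0); pose t := Ordinal (ltn_pmod l k_gt0).
have FE (s : 'I_k) : F (l %/ k * k + s)%N =
    (i %/ k == l %/ k)%N%:R * (bern_gram R k r s * H s t).
  have /= E := gram_uniform r s iN lN; rewrite -divn_eq in E.
  rewrite /F divK modK eqxx [X in X * _ = _]E (HnE s t).
  by field.
under eq_bigr do rewrite FE.
rewrite -mulr_sumr (_ : \sum_(s < k) _ = (bern_gram R k *m H) r t); last by rewrite mxE.
rewrite mulmxV ?bern_gram_unit// mxE -natrM mulnb; congr (_%:R); congr nat_of_bool.
apply/idP/eqP => [/andP[/eqP a /eqP/(congr1 val) b]|il]; last first.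
  by rewrite (_ : r = t) ?il ?eqxx//; apply: val_inj; rewrite /= il.
by apply: val_inj; rewrite [LHS](divn_eq i k) [RHS](divn_eq l k) a; congr (_ + _)%N.
Qed.

Definition uniform_kernel (x y : R) : R :=
  \sum_(c < N) N%:R * bern_kernel k (N%:R * x - c%:R) (N%:R * y - c%:R) *
    (in_cell N c x && in_cell N c y)%:R.

Lemma uniform_kernelE x y :
  \sum_i \sum_j uniform_dual i j * B (val i) y * B (val j) x = uniform_kernel x y.
Proof.
pose F (i j : nat) := (if (i %/ k == j %/ k)%N then N%:R * Hn (i %% k) (j %% k) else 0) *
  B i y * B j x.
transitivity (\sum_(i < N * k) \sum_(j < N * k) F i j).
  by apply: eq_bigr => i _; apply: eq_bigr => j _; rewrite mxE.
rewrite (sum_ord_mul _ _ (fun i => \sum_(j < N * k) F i j)); apply: eq_bigr => c _.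
rewrite bern_kernelC// mulr_sumr mulr_suml; apply: eq_bigr => r _.
rewrite sum_ord_mul (bigD1 c)//= [X in _ + X]big1 ?addr0 => [|c' c'c]; last first.
  rewrite big1// => s _; rewrite /F !divK ifF ?mul0r//.
  by apply/negbTE; rewrite eq_sym.
rewrite mulr_sumr mulr_suml; apply: eq_bigr => s _.
rewrite /F !divK !modK eqxx HnE !bspline_uniform// -mulnb natrM.
ring.
Qed.

Lemma uniform_kernel_cell c x y : (c < N)%N -> in_cell N c x ->
  uniform_kernel x y =
  N%:R * bern_kernel k (N%:R * x - c%:R) (N%:R * y - c%:R) * (in_cell N c y)%:R.
Proof.
move=> cN xc; rewrite /uniform_kernel (bigD1 (Ordinal cN))//= xc big1 ?addr0// => c' cc'.
case: (boolP (in_cell N c' x)) => xc'/=; last by rewrite mulr0.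
by case/eqP: cc'; apply: val_inj; exact: in_cell_inj xc' xc.
Qed.

Lemma uniform_kernel_bounded : exists2 C : R, 0 <= C & forall c x y, (c < N)%N ->
  in_cell N c x -> `|uniform_kernel x y| <= N%:R * C.
Proof.
have [C C0 CP] := bern_kernel_bounded R k; exists C => // c x y cN xc.
rewrite (uniform_kernel_cell _ cN xc); case: (boolP (in_cell N c y)) => yc.
  rewrite mulr1 normrM ger0_norm// ler_wpM2l//.
  by apply: CP; [have [] := in_cellP cN xc|have [] := in_cellP cN yc].
by rewrite mulr0 normr0 mulr_ge0.
Qed.

(** The projection reproduces constants: the Bernstein polynomials sum to 1, so the integral of the
    kernel is the sum of their reproduced values at [x]. *)
Lemma Rintegral_uniform_kernel c x : (c < N)%N -> in_cell N c x ->
  \int[lam]_(y in `[0, 1]) uniform_kernel x y = 1.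
Proof.
move=> cN xc; have N0 : N%:R != 0 :> R by rewrite pnatr_eq0 -lt0n.
under eq_Rintegral do rewrite (uniform_kernel_cell _ cN xc) -horner_bern_kernelp -hornerZ.
rewrite Rintegral_in_cell// Rintegral_polyZ mulKf//.
transitivity (\sum_(r < k) bern k.-1 r (N%:R * x - c%:R)); last exact: sum_bern.
under [RHS]eq_bigr do rewrite -(bern_kernelp_reproducing k_gt0)//.
rewrite -Rintegral_poly_sum; apply: eq_Rintegral => v _.
rewrite -mulr_sumr hornerM (_ : (\sum_(i < k) bernp R k i).[v] = 1) ?mulr1//.
by rewrite horner_sum -(sum_bern k_gt0 v); apply: eq_bigr => i _; rewrite horner_bernp.
Qed.

End uniform_kernel.

Lemma measurable_uniform_kernel (R : realType) (k : nat) (k_gt0 : (0 < k)%N) (N : nat)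
    (N_gt0 : (0 < N)%N) (x : R) :
  measurable_fun setT (uniform_kernel k N x : measurableTypeR R -> R).
Proof.
rewrite (_ : uniform_kernel _ _ _ = fun y => \sum_i \sum_j uniform_dual R k N i j *
  bspline (knot (uniform_partition R k_gt0 N_gt0)) k.-1 (val i) y *
  bspline (knot (uniform_partition R k_gt0 N_gt0)) k.-1 (val j) x).
  apply: measurable_sum => i; apply: measurable_sum => j.
  apply: measurable_funM => //; apply: measurable_funM => //.
  exact: measurable_bspline.
by apply/funext => y; rewrite uniform_kernelE.
Qed.

(** * Grids of q-adic cubes *)

Lemma measure_fin_union d (R : realFieldType) (T : ringOfSetsType d)
    (mu : {content set T -> \bar R}) (I : finType) (F : I -> set T) :
  (forall i, measurable (F i)) -> trivIset setT F ->
  mu (\bigcup_i F i) = (\sum_i mu (F i))%E.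
Proof.
move=> mF tF; rewrite measure_fin_bigcup//; last exact: finite_finset.
rewrite (_ : [set: I] = [set` index_enum I]); last first.
  by apply/seteqP; split => // i _ /=; exact: mem_index_enum.
by rewrite -fsbig_seq ?index_enum_uniq.
Qed.

Section grid.
Context (R : realType) (q : nat) (q_gt1 : (1 < q)%N).

(** For [t] in [0, 1), the integer written by the first [n] digits of [t] in base [q]. *)
Definition digits (n : nat) (t : R) : nat := Num.truncn (t * q%:R ^+ n).

Implicit Types (t : R).

Let qn_gt0 n : 0 < q%:R ^+ n :> R.
Proof. by rewrite exprn_gt0// ltr0n ltnW. Qed.

Lemma digits_eq n t c : 0 <= t ->
  (digits n t == c) = (c%:R / q%:R ^+ n <= t < c.+1%:R / q%:R ^+ n).
Proof.
move=> t0; rewrite truncn_eq; last by rewrite mulr_ge0// ltW.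
by rewrite ler_pdivrMr// ltr_pdivlMr.
Qed.

Lemma digits_itv n t : 0 <= t ->
  (digits n t)%:R / q%:R ^+ n <= t < (digits n t).+1%:R / q%:R ^+ n.
Proof. by move=> t0; rewrite -digits_eq. Qed.

Lemma digits_lt n t : 0 <= t < 1 -> (digits n t < q ^ n)%N.
Proof.
move=> /andP[t0 t1]; have /andP[tn _] := digits_itv n t0.
rewrite -(ltr_nat R) natrX -[ltRHS]mul1r -ltr_pdivrMr//.
exact: le_lt_trans t1.
Qed.

Lemma digits_div n m t : 0 <= t -> digits n t = (digits (n + m) t %/ q ^ m)%N.
Proof.
move=> t0; apply/eqP; rewrite digits_eq//.
have /andP[cl cu] := digits_itv (n + m) t0.
set c := digits _ _ in cl cu *.
have qm : (0 < q ^ m)%N by rewrite expn_gt0 ltnW.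
have E (a : nat) : a%:R / q%:R ^+ n = (a * q ^ m)%N%:R / q%:R ^+ (n + m) :> R.
  by rewrite natrM natrX exprD; field; rewrite !gt_eqF.
rewrite !E (le_trans _ cl) ?(lt_le_trans cu)//=.
  by rewrite ler_pM2r ?invr_gt0// ler_nat -ltn_divLR// ltnS.
by rewrite ler_pM2r ?invr_gt0// ler_nat leq_divM.
Qed.

Lemma in_cell_digits n c t : (0 <= t < 1) -> (c < q ^ n)%N ->
  in_cell (q ^ n) c t = (digits n t == c).
Proof.
move=> /andP[t0 t1] cq; rewrite digits_eq// /in_cell natrX.
by rewrite (lt_eqF t1) andbF orbF.
Qed.

Context (d : nat).
Notation Leb := (lebesgue_tuple R d).
Implicit Types (x y : Rd R d) (V A : set (Rd R d)).

(** Half-open, so that the integers [digits n] of the coordinates stay below [q ^ n] and the grid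
    cubes form a partition. *)
Definition icube : set (Rd R d) := [set x | forall mu : 'I_d, 0 <= tnth x mu < 1].

Lemma icube_sub : icube `<=` unit_cube R d.
Proof. by move=> x xc mu; have /andP[-> /ltW ->] := xc mu. Qed.

(* Being a union of grid cubes of side [q^-n]. *)
Definition grid_union (n : nat) (V : set (Rd R d)) : Prop :=
  V `<=` icube /\ forall x y, icube x -> icube y ->
    (forall mu, digits n (tnth x mu) = digits n (tnth y mu)) -> V x -> V y.

Lemma grid_unionW m n V : (m <= n)%N -> grid_union m V -> grid_union n V.
Proof.
move=> mn [Vc HV]; split => // x y xc yc xy; apply: HV => // mu.
have /andP[x0 _] := xc mu; have /andP[y0 _] := yc mu.
by rewrite (digits_div m (n - m) x0) (digits_div m (n - m) y0) subnKC// xy.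
Qed.

Lemma grid_union_icube n : grid_union n icube.
Proof. by split. Qed.

Lemma grid_unionI n V A : grid_union n V -> grid_union n A -> grid_union n (V `&` A).
Proof.
move=> [Vc HV] [Ac HA]; split => [x [/Vc]//|x y xc yc xy [Vx Ax]].
by split; [exact: HV Vx|exact: HA Ax].
Qed.

Lemma grid_unionD n V A : grid_union n V -> grid_union n A -> grid_union n (V `\` A).
Proof.
move=> [Vc HV] [Ac HA]; split => [x [/Vc]//|x y xc yc xy [Vx Ax]].
split; first exact: HV Vx.
by move=> Ay; apply: Ax; apply: HA Ay => // mu; rewrite xy.
Qed.

Lemma grid_union_bigcup n (I : Type) (P : set I) (F : I -> set (Rd R d)) :
  (forall i, P i -> grid_union n (F i)) -> grid_union n (\bigcup_(i in P) F i).
Proof.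
move=> HF; split => [x [i Pi /(proj1 (HF i Pi))]//|x y xc yc xy [i Pi Fx]].
by exists i => //; have [_ H] := HF i Pi; exact: H Fx.
Qed.

Definition grid_cube (n : nat) (z : 'I_d -> nat) : set (Rd R d) :=
  [set x | forall mu, (z mu)%:R / q%:R ^+ n <= tnth x mu < (z mu).+1%:R / q%:R ^+ n].

Lemma grid_cubeE n z : (forall mu, z mu < q ^ n)%N ->
  grid_cube n z = [set x | icube x /\ forall mu, digits n (tnth x mu) = z mu].
Proof.
move=> zn; apply/seteqP; split => x /=.
  move=> xz; have xc : icube x.
    move=> mu; have /andP[zx xz'] := xz mu.
    rewrite (le_trans _ zx) ?divr_ge0 ?ler0n ?ltW//=.
    by rewrite (lt_le_trans xz')// ler_pdivrMr// mul1r -natrX ler_nat zn.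
  split => // mu; apply/eqP; rewrite digits_eq; first exact: xz.
  by have /andP[] := xc mu.
move=> [xc xz] mu; rewrite -digits_eq ?xz//.
by have /andP[] := xc mu.
Qed.

(* The part of the half-open cube whose digits [n.+1 .. n + b] satisfy interval
   constraints; it is periodic with period [q^-n] in each direction. *)
Definition periodic_box (n : nat) (b lo hi : 'I_d -> nat) : set (Rd R d) :=
  [set x | icube x /\ forall mu,
    (lo mu <= digits (n + b mu) (tnth x mu) %% q ^ b mu < hi mu)%N].

Lemma grid_union_periodic_box n e b lo hi : (forall mu, b mu <= e)%N ->
  grid_union (n + e) (periodic_box n b lo hi).
Proof.
move=> be; split => [x []//|x y xc yc xy [_ xb]]; split => // mu; have := xb mu.
have /andP[x0 _] := xc mu; have /andP[y0 _] := yc mu.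
have E : (n + b mu + (e - b mu) = n + e)%N by rewrite -addnA subnKC.
by rewrite (digits_div _ (e - b mu) x0) (digits_div _ (e - b mu) y0) E xy.
Qed.

Let itv_measure (a b : R) : a <= b -> lebesgue_measure `[a, b[ = (b - a)%:E.
Proof.
rewrite lebesgue_measure_itv/= lte_fin le_eqVlt => /predU1P[->|->]//.
by rewrite ltxx subrr.
Qed.

Let measure_box (a b : 'I_d -> R) : (forall mu, a mu <= b mu) ->
  measurable [set x : Rd R d | forall mu, a mu <= tnth x mu < b mu] /\
  Leb [set x : Rd R d | forall mu, a mu <= tnth x mu < b mu] = (\prod_mu (b mu - a mu))%:E.
Proof.
move=> ab; split.
  rewrite (_ : [set _ | _] = \bigcap_(i in [set: 'I_d])
     ((fun x : Rd R d => tnth x i) @^-1` `[a i, b i[)).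
    apply: fin_bigcap_measurable => // i _.
    by rewrite -[X in measurable X]setTI; exact: measurable_tnth.
  by apply/seteqP; split => x /= xab mu; have := xab mu; rewrite /= in_itv//=; exact.
have := @lebesgue_tuple_box R d (fun mu => `[a mu, b mu[%classic).
rewrite (_ : [set x : Rd R d | _] = [set x : Rd R d | forall mu, a mu <= tnth x mu < b mu]).
  by move=> -> //; rewrite -prodEFin; apply: eq_bigr => mu _; rewrite itv_measure.
by apply/seteqP; split => x xP i; have := xP i; rewrite /= in_itv.
Qed.

Lemma measurable_grid_cube n z : measurable (grid_cube n z).
Proof.
apply: (measure_box _).1 => mu.
by rewrite ler_pM2r ?invr_gt0// ler_nat.
Qed.

Lemma lebesgue_grid_cube n z : Leb (grid_cube n z) = (\prod_(mu < d) (q%:R ^+ n)^-1)%:E.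
Proof.
rewrite (measure_box _).2 => [|mu]; last by rewrite ler_pM2r ?invr_gt0// ler_nat.
by congr EFin; apply: eq_bigr => mu _; rewrite -mulrBl -natr1 addrAC subrr add0r mul1r.
Qed.

Definition periodic_density (b lo hi : 'I_d -> nat) : R :=
  \prod_(mu < d) ((hi mu - lo mu)%N%:R / q%:R ^+ b mu).

Lemma grid_cube_periodic_box n b lo hi z :
  (forall mu, lo mu <= hi mu <= q ^ b mu)%N -> (forall mu, z mu < q ^ n)%N ->
  measurable (grid_cube n z `&` periodic_box n b lo hi) /\
  Leb (grid_cube n z `&` periodic_box n b lo hi) =
    (Leb (grid_cube n z) * (periodic_density b lo hi)%:E)%E.
Proof.
move=> lohi zn.
pose l mu := (z mu * q ^ b mu + lo mu)%N; pose h mu := (z mu * q ^ b mu + hi mu)%N.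
have -> : grid_cube n z `&` periodic_box n b lo hi = [set x : Rd R d | forall mu,
    (l mu)%:R / q%:R ^+ (n + b mu) <= tnth x mu < (h mu)%:R / q%:R ^+ (n + b mu)].
  apply/seteqP; split => x.
    rewrite grid_cubeE// => -[[xc xz] [_ xlh]] mu.
    have /andP[x0 x1] := xc mu; have /andP[xl xh] := xlh mu.
    have /andP[dl dh] := digits_itv (n + b mu) x0.
    have E := divn_eq (digits (n + b mu) (tnth x mu)) (q ^ b mu).
    rewrite -digits_div// xz in E.
    rewrite (le_trans _ dl) ?(lt_le_trans dh)//.
      by rewrite ler_pM2r ?invr_gt0// ler_nat E ltn_add2l.
    by rewrite ler_pM2r ?invr_gt0// ler_nat E leq_add2l.
  move=> /= xlh.
  have qE mu : q%:R ^+ (n + b mu) = q%:R ^+ n * q%:R ^+ b mu :> R by rewrite exprD.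
  have xz : grid_cube n z x.
    move=> mu; have /andP[xl xh] := xlh mu; have /andP[lh hq] := lohi mu.
    have E (a : nat) : a%:R / q%:R ^+ n = (a * q ^ b mu)%N%:R / q%:R ^+ (n + b mu) :> R.
      by rewrite natrM natrX exprD; field; rewrite !gt_eqF.
    rewrite !E (le_trans _ xl) ?(lt_le_trans xh)//.
      by rewrite ler_pM2r ?invr_gt0// ler_nat mulSn [(_ + z mu * _)%N]addnC leq_add2l.
    by rewrite ler_pM2r ?invr_gt0// ler_nat leq_addr.
  split => //; move: xz; rewrite grid_cubeE// => -[xc xz]; split => // mu.
  have /andP[x0 x1] := xc mu; have /andP[xl xh] := xlh mu.
  have /andP[dl dh] := digits_itv (n + b mu) x0.
  have E := divn_eq (digits (n + b mu) (tnth x mu)) (q ^ b mu).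
  rewrite -digits_div// xz in E.
  have := lt_le_trans (le_lt_trans xl dh) (lexx _).
  rewrite ltr_pM2r ?invr_gt0// ltr_nat {1}E ltnS leq_add2l => ->/=.
  have := le_lt_trans dl xh.
  by rewrite ltr_pM2r ?invr_gt0// ltr_nat {1}E ltn_add2l.
have lh mu : (l mu)%:R / q%:R ^+ (n + b mu) <= (h mu)%:R / q%:R ^+ (n + b mu) :> R.
  by rewrite ler_pM2r ?invr_gt0// ler_nat leq_add2l; case/andP: (lohi mu).
split; first exact: (measure_box lh).1.
rewrite (measure_box lh).2 lebesgue_grid_cube -EFinM -big_split; congr EFin.
apply: eq_bigr => mu _; rewrite -mulrBl /= /l /h !natrD natrB; last by case/andP: (lohi mu).
by rewrite exprD; field; rewrite !gt_eqF.
Qed.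

Definition grid_index n := {ffun 'I_d -> 'I_(q ^ n)}.

Lemma grid_cubes_trivIset n :
  trivIset setT (fun z : grid_index n => grid_cube n (fun mu => z mu)).
Proof.
apply/trivIsetP => /= z w _ _ /eqP zw; apply/eqP/negPn/negP => /set0P[x []].
rewrite !grid_cubeE// => -[_ xz] [_ xw]; apply: zw; apply/ffunP => mu.
by apply: val_inj; rewrite /= -xz -xw.
Qed.

Lemma bigcup_grid_cubes n V : V `<=` icube ->
  V = \bigcup_(z : grid_index n) (V `&` grid_cube n (fun mu => z mu)).
Proof.
move=> Vc; apply/seteqP; split => [x Vx|x [z _ []]//].
have xc := Vc _ Vx.
exists [ffun mu => Ordinal (digits_lt n (xc mu))] => //; split => //.
by rewrite grid_cubeE//; split => // mu; rewrite ffunE.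
Qed.

Lemma grid_union_cube n V (z : grid_index n) : grid_union n V ->
  V `&` grid_cube n (fun mu => z mu) = grid_cube n (fun mu => z mu) \/
  V `&` grid_cube n (fun mu => z mu) = set0.
Proof.
move=> [Vc HV].
have [[x [Vx xz]]|V0] := pselect (exists x, (V `&` grid_cube n (fun mu => z mu)) x).
  left; rewrite setIidr// => y; move: xz; rewrite !grid_cubeE// => -[xc xz] [yc yz].
  by apply: HV Vx => // mu; rewrite xz yz.
by right; apply/seteqP; split => // x Vx; case: V0; exists x.
Qed.

Lemma measurable_grid_union n V : grid_union n V -> measurable V.
Proof.
move=> VL; rewrite (bigcup_grid_cubes n VL.1).
apply: fin_bigcup_measurable => [|z _]; first exact: finite_finset.
by have [->|->] := grid_union_cube z VL; [exact: measurable_grid_cube|exact: measurable0].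
Qed.

(** In probabilistic terms, [A] has probability [p] and is independent of the first [n] digits of
    the coordinates. *)
Definition equidistributed (n : nat) A (p : R) : Prop :=
  [/\ measurable A, A `<=` icube &
      forall V, grid_union n V -> Leb (V `&` A) = (Leb V * p%:E)%E].

Lemma periodic_box_equidistributed n b lo hi : (forall mu, lo mu <= hi mu <= q ^ b mu)%N ->
  equidistributed n (periodic_box n b lo hi) (periodic_density b lo hi).
Proof.
move=> lohi; set A := periodic_box n b lo hi.
have Ac : A `<=` icube by move=> x [].
have mA : measurable A.
  apply: (@measurable_grid_union (n + \max_mu b mu)%N).
  by apply: grid_union_periodic_box => mu; exact: leq_bigmax.
split => // V VL.
have mV := measurable_grid_union VL.
pose g (z : grid_index n) := grid_cube n (fun mu => z mu).
have mg z : measurable (g z) by exact: measurable_grid_cube.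
have tg X : trivIset setT (fun z => X `&` g z).
  exact/trivIset_setIl/grid_cubes_trivIset.
rewrite [in RHS](bigcup_grid_cubes n VL.1) measure_fin_union//; last first.
  by move=> z; apply: measurableI => //; exact: mg.
rewrite (bigcup_grid_cubes n (_ : V `&` A `<=` icube)); last by move=> x [_ /Ac].
rewrite measure_fin_union//; last first.
  by move=> z; apply: measurableI => //; [exact: measurableI|exact: mg].
rewrite ge0_sume_distrl//; apply: eq_bigr => z _.
rewrite setIAC -/(g z); have [->|->] := grid_union_cube z VL; last first.
  by rewrite set0I measure0 mul0e.
exact: (grid_cube_periodic_box lohi (fun mu => ltn_ord (z mu))).2.
Qed.

Lemma equidistributed_bigcup n (I : finType) (F : I -> set (Rd R d)) (p : I -> R) :
  trivIset setT F -> (forall i, 0 <= p i) -> (forall i, equidistributed n (F i) (p i)) ->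
  equidistributed n (\bigcup_i F i) (\sum_i p i).
Proof.
move=> tF p0 HF; split.
- by apply: fin_bigcup_measurable => [|i _]; [exact: finite_finset|have [] := HF i].
- by move=> x [i _]; have [_ + _] := HF i; exact.
move=> V VL; rewrite setI_bigcupr.
rewrite measure_fin_union//.
- rewrite -sumEFin. rewrite ge0_sume_distrr => [|i _]; last by rewrite lee_fin p0.
  by apply: eq_bigr => i _; have [_ _ HV] := HF i; exact: HV.
- by move=> i; apply: measurableI; [exact: measurable_grid_union VL|have [] := HF i].
- exact: trivIset_setIl.
Qed.

End grid.

(** * Functions made of equidistributed spikes *)

Section step_functions.
Context dT (T : measurableType dT) (R : realType).
Implicit Types (E : nat -> set T) (c : nat -> R).

(** The index is chosen among those with [E i x], so the value is [c i] on [E i] only when the sets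
    are disjoint. *)
Definition stepf E c (x : T) : R :=
  if pselect (exists i, E i x) is left h then c (projT1 (cid h)) else 0.

Lemma stepf_in E c i x : trivIset setT E -> E i x -> stepf E c x = c i.
Proof.
move=> tE Ex; rewrite /stepf; case: pselect => [h|[]]; last by exists i.
case: cid => j /= Ej; congr c.
by apply: tE => //; exists x.
Qed.

Lemma stepf_out E c x : (forall i, ~ E i x) -> stepf E c x = 0.
Proof. by move=> xE; rewrite /stepf; case: pselect => // h; have [i /xE] := h. Qed.

(** This makes the truncations of [phi] and the integrand of condition (i) step functions on the
    same sets as [phi]. *)
Lemma stepf_comp E c (g : R -> R) x : g 0 = 0 ->
  g (stepf E c x) = stepf E (g \o c) x.
Proof. by move=> g0; rewrite /stepf; case: pselect. Qed.

Lemma stepf_ge0 E c x : (forall i, 0 <= c i) -> 0 <= stepf E c x.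
Proof. by move=> c0; rewrite /stepf; case: pselect. Qed.

Lemma measurable_stepf E c : trivIset setT E -> (forall i, measurable (E i)) ->
  measurable_fun setT (stepf E c).
Proof.
move=> tE mE _ Y mY; rewrite setTI.
have mU : measurable (\bigcup_i E i) by exact: bigcupT_measurable.
pose A := \bigcup_(i in [set i | Y (c i)]) E i.
have mA : measurable A by exact: bigcup_measurable.
have inA x : A x <-> (exists i, E i x) /\ Y (stepf E c x).
  split=> [[i /= Yi Ei]|[[i Ei]]]; first by rewrite (stepf_in c tE Ei); split => //; exists i.
  by rewrite (stepf_in c tE Ei) => Yi; exists i.
have [Y0|nY0] := pselect (Y 0).
  rewrite (_ : _ @^-1` _ = A `|` ~` \bigcup_i E i).
    by apply: measurableU => //; exact: measurableC.
  apply/seteqP; split => x /=.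
    have [h Yx|h _] := pselect (exists i, E i x); first by left; apply/inA.
    by right => -[i _ Ei]; apply: h; exists i.
  move=> [/inA[]//|h]; rewrite stepf_out// => i Ei.
  by apply: h; exists i.
rewrite (_ : _ @^-1` _ = A) //; apply/seteqP; split => x /=; last by move=> /inA[].
move=> Yx; apply/inA; split => //; apply: contrapT => h; apply: nY0.
by rewrite -(@stepf_out E c x)// => i Ei; apply: h; exists i.
Qed.

Lemma integral_stepf (mu : {measure set T -> \bar R}) E c (V : set T) :
  trivIset setT E -> (forall i, measurable (E i)) -> measurable V -> (forall i, 0 <= c i) ->
  (\int[mu]_(x in V) (stepf E c x)%:E = \sum_(i <oo) (c i)%:E * mu (E i `&` V))%E.
Proof.
move=> tE mE mV c0; pose F i := E i `&` V.
have mF i : measurable (F i) by exact: measurableI.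
have tF : trivIset setT F by exact: trivIset_setIr.
transitivity (\int[mu]_(x in \bigcup_i F i) (stepf E c x)%:E)%E.
  rewrite integral_mkcond [RHS]integral_mkcond; apply: eq_integral => x _.
  rewrite !patchE; have [[i Fi]|h] := pselect (exists i, F i x).
    by rewrite !mem_set//; [exists i|case: Fi].
  rewrite [in RHS]memNset; last by move=> -[i _ Fi]; apply: h; exists i.
  case: ifPn => //; rewrite inE => Vx; rewrite stepf_out// => i Ei.
  by apply: h; exists i.
rewrite ge0_integral_bigcup//.
- apply: eq_eseriesr => i _.
  rewrite (eq_integral (cst (c i)%:E)); first by rewrite integral_cst.
  by move=> x; rewrite inE => -[Ei _]; rewrite (stepf_in c tE Ei).
- exact/measurable_EFinP/measurable_funTS/measurable_stepf.
- by move=> x _; rewrite lee_fin stepf_ge0.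
Qed.

End step_functions.

(** * Spikes and the mass that they carry *)

Section spikes.
Context (R : realType) (q : nat) (q_gt1 : (1 < q)%N) (d : nat) (e : nat -> nat).
Notation Leb := (lebesgue_tuple R d).
Notation cube := (unit_cube R d).
Notation half_cube := (@icube R d).

(** Spike [i] constrains only the [e i] digits that follow the first [scale i], so different spikes
    constrain disjoint sets of digits. *)
Definition scale (i : nat) : nat := \sum_(l < i) e l.

Lemma scaleS i : scale i.+1 = (scale i + e i)%N.
Proof. by rewrite /scale big_ord_recr. Qed.

Lemma leq_scale i j : (i <= j)%N -> (scale i <= scale j)%N.
Proof.
move=> /subnKC <-; elim: (j - i)%N => [|n IH]; first by rewrite addn0.
by rewrite addnS scaleS (leq_trans IH)// leq_addr.
Qed.

Definition spike (i : nat) : set (Rd R d) :=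
  periodic_box q (scale i) (fun=> e i) (fun=> 0%N) (fun=> 1%N).

Definition spike_density (i : nat) : R := (q%:R ^+ (e i * d))^-1.

Lemma spike_density_gt0 i : 0 < spike_density i.
Proof. by rewrite invr_gt0 exprn_gt0// ltr0n ltnW. Qed.

Lemma spike_equidistributed i :
  equidistributed q (scale i) (spike i) (spike_density i).
Proof.
have -> : spike_density i = periodic_density R q (d := d) (fun=> e i) (fun=> 0%N) (fun=> 1%N).
  by rewrite /periodic_density prodr_const card_ord div1r /spike_density exprM exprVn.
by apply: periodic_box_equidistributed => // mu; rewrite /= expn_gt0 (ltnW q_gt1).
Qed.

Lemma measurable_spike i : measurable (spike i).
Proof. by have [] := spike_equidistributed i. Qed.

Lemma grid_union_spike i j : (i < j)%N -> grid_union q (scale j) (spike i).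
Proof.
move=> ij; apply: (grid_unionW q_gt1 (leq_scale ij)).
by rewrite scaleS; exact: grid_union_periodic_box.
Qed.

Lemma lebesgue_icube : Leb half_cube = 1%E.
Proof.
rewrite (_ : half_cube = [set x | forall mu, `[0%R, 1%R[%classic (tnth x mu)]); last first.
  by apply/seteqP; split => x xP i; have := xP i; rewrite /= in_itv.
rewrite (@lebesgue_tuple_box R d (fun=> `[0%R, 1%R[%classic)) => [|//].
by rewrite big1// => i _; rewrite lebesgue_measure_itv/= lte_fin ltr01 sube0.
Qed.

Lemma lebesgue_spike i : Leb (spike i) = (spike_density i)%:E.
Proof.
have [_ si H] := spike_equidistributed i.
by have := H _ (@grid_union_icube R q d _); rewrite setIidr// lebesgue_icube mul1e.
Qed.

(** A point of several spikes is assigned to the earliest one, which gives the disjoint sets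
    required by [stepf]. *)
Definition dspike : nat -> set (Rd R d) := seqDU spike.

Lemma dspike_trivIset : trivIset setT dspike.
Proof. exact: trivIset_seqDU. Qed.

Lemma dspike_sub i : dspike i `<=` spike i.
Proof. by move=> x []. Qed.

Lemma spike_sub_icube i : spike i `<=` half_cube.
Proof. by move=> x []. Qed.

Lemma dspikeE i x : dspike i x <-> spike i x /\ forall l, (l < i)%N -> ~ spike l x.
Proof.
rewrite /dspike /seqDU -bigcup_mkord; split=> -[si H]; split => //.
  by move=> l li sl; apply: H; exists l.
by move=> [l /= li]; exact: H.
Qed.

Lemma measurable_dspike i : measurable (dspike i).
Proof.
apply: measurableD; first exact: measurable_spike.
by apply: bigsetU_measurable => l _; exact: measurable_spike.
Qed.

Lemma stepf_dspike_out c x : ~ half_cube x -> stepf dspike c x = 0 :> R.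
Proof. by move=> nx; rewrite stepf_out// => i /dspike_sub/spike_sub_icube. Qed.

(** Only spikes of index at least [n] count, and they are equidistributed with respect to [V];
    replacing [dspike] by [spike] can only increase the mass. *)
Lemma integral_dspike_le (c : nat -> R) n V : (forall i, 0 <= c i) ->
  (forall i, (i < n)%N -> c i = 0) -> grid_union q (scale n) V ->
  (\int[Leb]_(x in V) (stepf dspike c x)%:E <=
   Leb V * \sum_(i <oo) (c i * spike_density i)%:E)%E.
Proof.
move=> c0 cn VL; have mV := measurable_grid_union q_gt1 VL.
rewrite integral_stepf//; [|exact: dspike_trivIset|exact: measurable_dspike].
have V1 : (Leb V <= 1)%E.
  rewrite -lebesgue_icube; apply: le_measure; rewrite ?inE//; last exact: VL.1.
  exact: (measurable_grid_union q_gt1 (@grid_union_icube R q d 0)).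
have [v vE] : exists v, Leb V = v%:E.
  by exists (fine (Leb V)); rewrite fineK// ge0_fin_numE// (le_lt_trans V1)// ltry.
have v0 : 0 <= v by rewrite -lee_fin -vE.
rewrite vE -nneseriesZl//; last first.
  by move=> i _; rewrite lee_fin mulr_ge0// ltW// spike_density_gt0.
apply: lee_nneseries => i _.
  by rewrite mule_ge0// lee_fin.
rewrite -vE.
have [/cn ->|ni] := ltnP i n; first by rewrite mul0e mul0r mule0.
rewrite EFinM muleCA lee_wpmul2l ?lee_fin//.
have [_ _ H] := spike_equidistributed i.
rewrite -H; last exact: (grid_unionW q_gt1 (leq_scale ni)).
rewrite le_measure ?inE//; first by apply: measurableI => //; exact: measurable_dspike.
  by apply: measurableI => //; exact: measurable_spike.
by move=> x [/dspike_sub].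
Qed.

Lemma integral_cube_dspike (c : nat -> R) : (forall i, 0 <= c i) ->
  (\int[Leb]_(x in cube) (stepf dspike c x)%:E =
   \int[Leb]_(x in half_cube) (stepf dspike c x)%:E)%E.
Proof.
move=> c0; rewrite !integral_stepf//;
  try by [exact: dspike_trivIset|exact: measurable_dspike].
- apply: eq_eseriesr => i _; congr (_ * Leb _)%E.
  have si : dspike i `<=` half_cube by move=> x /dspike_sub/spike_sub_icube.
  by rewrite !setIidl//; apply: subset_trans si _; exact: icube_sub.
- exact: measurable_grid_union (@grid_union_icube R q d 0).
- exact: measurable_unit_cube.
Qed.

Lemma integrable_dspike (c : nat -> R) : (forall i, 0 <= c i) ->
  (\sum_(i <oo) (c i * spike_density i)%:E < +oo)%E ->
  Leb.-integrable cube (EFin \o stepf dspike c).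
Proof.
move=> c0 coo; apply/integrableP; split.
  apply/measurable_EFinP/measurable_funTS/measurable_stepf; first exact: dspike_trivIset.
  exact: measurable_dspike.
rewrite (eq_integral (fun x => (stepf dspike c x)%:E)); last first.
  by move=> x _; rewrite /= ger0_norm// stepf_ge0.
rewrite integral_cube_dspike//; apply: le_lt_trans coo.
rewrite -[leRHS]mul1e -lebesgue_icube.
by apply: (integral_dspike_le (n := 0)) => //; exact: grid_union_icube.
Qed.

End spikes.

(** * Points whose digits vanish after a given scale *)

Section digits_corner.
Context (R : realType) (q : nat) (q_gt1 : (1 < q)%N).

Let digits_split s b (t : R) : 0 <= t ->
  digits q (s + b) t = (digits q s t * q ^ b + digits q (s + b) t %% q ^ b)%N.
Proof. by move=> t0; rewrite (digits_div q_gt1 s b t0) -divn_eq. Qed.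

(** The hypothesis on the remainder says that, among the [b] digits after the first [s], the leading
    [b - j] vanish. In particular the first [a] do. *)
Lemma digits_corner s a b j (t : R) : 0 <= t -> (j + a <= b)%N ->
  (digits q (s + b) t %% q ^ b < q ^ j)%N ->
  digits q (s + a) t = (digits q s t * q ^ a)%N.
Proof.
move=> t0 jab Dj; rewrite (digits_div q_gt1 (s + a) (b - a) t0).
rewrite -addnA subnKC; last by lia.
rewrite digits_split// -{1}(subnKC (_ : a <= b)%N); last by lia.
rewrite expnD mulnA divnMDl ?expn_gt0 ?(ltnW q_gt1)// divn_small ?addn0//.
by rewrite (leq_trans Dj)// leq_exp2l//; lia.
Qed.

Lemma digits_corner_itv s a b j (t : R) : 0 <= t -> (j + a < b)%N ->
  (digits q (s + b) t %% q ^ b < q ^ j)%N ->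
  0 <= q%:R ^+ (s + a) * t - (digits q (s + a) t)%:R <= q%:R^-1.
Proof.
move=> t0 jab; set D := digits _ _ _ => Dj.
have q0 : 0 < q%:R :> R by rewrite ltr0n ltnW.
have qn n : 0 < q%:R ^+ n :> R by rewrite exprn_gt0.
have DE : D = (digits q s t * q ^ a * q ^ (b - a) + D %% q ^ b)%N.
  rewrite -mulnA -expnD subnKC; last by lia.
  exact: digits_split.
have jb : (q ^ j <= q ^ (b - a).-1)%N by rewrite leq_exp2l//; lia.
have aE := digits_corner t0 (ltnW jab) Dj.
have /andP[tl tu] := digits_itv q_gt1 (s + a) t0.
rewrite subr_ge0 [_ * t]mulrC -ler_pdivrMr// tl/=.
have /andP[_ {tl}tu'] := digits_itv q_gt1 (s + b) t0; rewrite -/D in tu'.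
rewrite ltr_pdivlMr// in tu'.
have DE' : D.+1%:R <= (digits q (s + a) t)%:R * q%:R ^+ (b - a) + q%:R ^+ (b - a).-1 :> R.
  rewrite -!natrX -natrM -natrD ler_nat aE {1}DE -addnS leq_add2l.
  exact: leq_trans Dj jb.
have qba : q%:R ^+ (b - a) = q%:R ^+ (b - a).-1 * q%:R :> R.
  by rewrite -exprSr prednK//; lia.
have sE : q%:R ^+ (s + b) = q%:R ^+ (s + a) * q%:R ^+ (b - a) :> R.
  by rewrite -exprD; congr (_ ^+ _); lia.
rewrite lerBlDl -(ler_pM2r (qn (b - a)%N)) -mulrA -sE mulrDl {2}qba.
rewrite [q%:R^-1 * _]mulrC mulfK ?gt_eqF//.
exact: le_trans (ltW tu') DE'.
Qed.

End digits_corner.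

(** * Projections on anisotropic grids *)

Section grid_partitions.
Context (R : realType) (q : nat) (q_gt1 : (1 < q)%N) (d : nat) (k : 'I_d -> nat).
Context (k_gt0 : forall mu, (0 < k mu)%N).
Notation Leb := (lebesgue_tuple R d).
Notation cube := (unit_cube R d).
Notation half_cube := (@icube R d).

Let q_gt0 n : (0 < q ^ n)%N. Proof. by rewrite expn_gt0 (ltnW q_gt1). Qed.

Definition grid_partition (m : 'I_d -> nat) : multipartition R k :=
  fun mu => uniform_partition R (k_gt0 mu) (q_gt0 (m mu)).

Lemma mesh_grid_partition m n : (forall mu, n <= m mu)%N ->
  0 <= mesh (grid_partition m) <= (q%:R ^+ n)^-1.
Proof.
move=> nm; have q0 : 0 < q%:R :> R by rewrite ltr0n ltnW.
rewrite /mesh; apply/andP; split.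
  by elim/big_ind : _ => [|x y x0 y0|mu _]; rewrite ?lexx ?le_max ?x0//
     /mesh1; elim/big_ind : _ => [|x y x0 y0|j _]; rewrite ?lexx ?le_max ?x0.
elim/big_ind : _ => [|x y xn yn|mu _].
- by rewrite invr_ge0 exprn_ge0 ?ler0n.
- by rewrite ge_max xn.
rewrite (le_trans (mesh1_uniform _ _ _))// natrX lef_pV2 ?posrE ?exprn_gt0//.
by rewrite ler_weXn2l// ler1n ltnW.
Qed.

Definition grid_kernel m (x y : Rd R d) : R :=
  \prod_mu uniform_kernel (k mu) (q ^ m mu) (tnth x mu) (tnth y mu).

Lemma spline_proj_grid m (f : Rd R d -> R) x : Leb.-integrable cube (EFin \o f) ->
  spline_proj (grid_partition m) f x = \int[Leb]_(y in cube) (f y * grid_kernel m x y).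
Proof.
move=> fi; pose L mu := uniform_dual R (k mu) (q ^ m mu).
have gL mu : gram (grid_partition m) mu *m L mu = 1%:M by exact: uniform_dualP.
rewrite (spline_projE gL)//; apply: eq_Rintegral => y _; congr (_ * _).
by apply: eq_bigr => mu _; rewrite -(uniform_kernelE (k_gt0 mu) (q_gt0 (m mu))).
Qed.

Lemma measurable_grid_kernel m x : measurable_fun setT (grid_kernel m x).
Proof.
apply: measurable_prod => mu _.
apply: (@measurableT_comp _ _ _ _ _ _ (uniform_kernel (k mu) (q ^ m mu) (tnth x mu))).
  exact: (measurable_uniform_kernel (k_gt0 mu) (q_gt0 _)).
exact: measurable_tnth.
Qed.

Context (C : 'I_d -> R) (C_ge0 : forall mu, 0 <= C mu).
Hypothesis kernel_le : forall mu u v, 0 <= u <= 1 -> 0 <= v <= 1 ->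
  `|bern_kernel (k mu) u v : R| <= C mu.

Lemma grid_kernel_bounded m x y : half_cube x ->
  `|grid_kernel m x y| <= \prod_mu (q%:R ^+ m mu * C mu).
Proof.
move=> xc; rewrite normr_prod; apply: ler_prod => mu _; rewrite normr_ge0/=.
have dq := digits_lt q_gt1 (m mu) (xc mu).
have xd : in_cell (q ^ m mu) (digits q (m mu) (tnth x mu)) (tnth x mu).
  by rewrite in_cell_digits.
rewrite (uniform_kernel_cell _ _ dq xd) -natrX.
case: (boolP (in_cell _ _ (tnth y mu))) => yd; last by rewrite mulr0 normr0 mulr_ge0.
rewrite mulr1 normrM ger0_norm// ler_wpM2l// kernel_le//.
  by have [] := in_cellP dq xd.
by have [] := in_cellP dq yd.
Qed.

Lemma integrable_mul_grid_kernel m (f : Rd R d -> R) x : half_cube x ->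
  Leb.-integrable cube (EFin \o f) ->
  Leb.-integrable cube (EFin \o (fun y => f y * grid_kernel m x y)).
Proof.
move=> xc fi; apply: (integrable_bounded_mul (C := \prod_mu (q%:R ^+ m mu * C mu))) => //.
- exact: measurable_unit_cube.
- exact: measurable_funTS (measurable_grid_kernel m x).
- by move=> y _; exact: grid_kernel_bounded.
Qed.

Definition grid_cell m (x : Rd R d) : set (Rd R d) :=
  [set y | half_cube y /\ forall mu, digits q (m mu) (tnth y mu) = digits q (m mu) (tnth x mu)].

Lemma grid_kernel_out m x y : half_cube x -> half_cube y -> ~ grid_cell m x y ->
  grid_kernel m x y = 0.
Proof.
move=> xc yc nxy.
have [mu xymu] : exists mu, digits q (m mu) (tnth y mu) != digits q (m mu) (tnth x mu).
  apply: contrapT => h; apply: nxy; split => // mu.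
  by apply/eqP/negPn/negP => h'; apply: h; exists mu.
have dq := digits_lt q_gt1 (m mu) (xc mu).
rewrite /grid_kernel (bigD1 mu)//= (uniform_kernel_cell _ _ dq) ?in_cell_digits//.
by rewrite (negbTE xymu) mulr0 mul0r.
Qed.

Lemma grid_kernel_in m x y : half_cube x -> grid_cell m x y ->
  grid_kernel m x y = \prod_mu (q%:R ^+ m mu * bern_kernel (k mu)
    (q%:R ^+ m mu * tnth x mu - (digits q (m mu) (tnth x mu))%:R)
    (q%:R ^+ m mu * tnth y mu - (digits q (m mu) (tnth y mu))%:R)).
Proof.
move=> xc [yc xy]; apply: eq_bigr => mu _.
have dq := digits_lt q_gt1 (m mu) (xc mu).
rewrite (uniform_kernel_cell _ _ dq) ?in_cell_digits// xy eqxx mulr1 natrX.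
by rewrite -xy.
Qed.

Lemma grid_union_grid_cell m n x : (forall mu, m mu <= n)%N ->
  grid_union q n (grid_cell m x).
Proof.
move=> mn; split => [y []//|y y' yc y'c yy' [_ xy]]; split => // mu.
have /andP[y0 _] := yc mu; have /andP[y'0 _] := y'c mu.
by rewrite -xy !(digits_div q_gt1 (m mu) (n - m mu)) ?subnKC// yy'.
Qed.

Lemma lebesgue_grid_cell m x : half_cube x ->
  Leb (grid_cell m x) = (\prod_mu (q%:R ^+ m mu)^-1)%:E.
Proof.
move=> xc; pose z mu := digits q (m mu) (tnth x mu).
have zq mu : (z mu < q ^ m mu)%N by exact: digits_lt.
have -> : grid_cell m x = half_cube `&` periodic_box q 0 m z (fun mu => (z mu).+1).
  apply/seteqP; split => y /=.
    move=> [yc yx]; split => //; split => // mu.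
    by rewrite add0n yx -/(z mu) modn_small// leqnn ltnSn.
  move=> [yc [_ yx]]; split => // mu; apply/eqP.
  by have := yx mu; rewrite add0n ltnS modn_small ?digits_lt// -eqn_leq eq_sym.
have zlh mu : (z mu <= (z mu).+1 <= q ^ m mu)%N by rewrite leqnSn zq.
have [_ _ H] := periodic_box_equidistributed R q_gt1 0 zlh.
rewrite H; last exact: grid_union_icube.
rewrite lebesgue_icube mul1e; congr EFin; apply: eq_bigr => mu _.
by rewrite subSnn div1r.
Qed.

Section lower_bound.
Context (c : 'I_d -> R) (c_ge0 : forall mu, 0 <= c mu).
Hypothesis kernel_ge : forall mu u v, 0 <= u <= q%:R^-1 -> 0 <= v <= q%:R^-1 ->
  c mu <= bern_kernel (k mu) u v :> R.
Context (e : nat -> nat) (h : nat -> R) (h_ge0 : forall i, 0 <= h i) (S : R).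
Hypothesis hS : (\sum_(i <oo) (h i * spike_density R q d e i)%:E <= S%:E)%E.
Notation phi := (stepf (@dspike R q d e) h).

(* Spike [i] fills a corner of the cell of [x], and there the kernel is bounded
   below; the earlier spikes miss this cell, and the later ones together have
   mass at most [S] times the volume of the cell. *)
Lemma spline_proj_spikes_ge i (a : 'I_d -> nat) x : half_cube x ->
  (forall mu, a mu < e i)%N ->
  (forall mu, digits q (scale e i + (a mu).+2) (tnth x mu) %% q ^ (a mu).+2 < q)%N ->
  (forall l, (l < i)%N -> ~ spike q e l x) ->
  h i * spike_density R q d e i * \prod_mu (q%:R ^+ a mu * c mu) - S * \prod_mu C mu <=
  spline_proj (grid_partition (fun mu => scale e i + a mu)%N) phi x.
Proof.
move=> xc ae xa xs; set m := (fun mu => (scale e i + a mu)%N).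
have soo : (\sum_(i <oo) (h i * spike_density R q d e i)%:E < +oo)%E.
  exact: le_lt_trans hS (ltry _).
have phii := integrable_dspike q_gt1 h_ge0 soo.
rewrite spline_proj_grid//.
pose h' l := if (i < l)%N then h l else 0.
have h'0 l : 0 <= h' l by rewrite /h'; case: ifP.
pose psi := stepf (@dspike R q d e) h'.
have h'h : (\sum_(i <oo) (h' i * spike_density R q d e i)%:E <= S%:E)%E.
  apply: le_trans hS; apply: lee_nneseries => l _; rewrite lee_fin.
    by rewrite mulr_ge0// ltW// spike_density_gt0.
  by rewrite ler_wpM2r ?(ltW (spike_density_gt0 _ _ _ _ _))// /h'; case: ifP.
have psii : Leb.-integrable cube (EFin \o psi).
  by apply: (integrable_dspike q_gt1 h'0); exact: le_lt_trans h'h (ltry _).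
(* [X] is the copy of spike [i] in the cube [Q] of side [q ^- scale e i] around [x]. It lies in the
   cell of [x], because after the first [scale e i] digits both [x] and the points of the spike have
   at least [a mu] zeros. *)
pose Q := grid_cell (fun=> scale e i) x; pose X := Q `&` spike q e i.
have cellP l : (forall mu, m mu <= l)%N -> grid_union q l (grid_cell m x).
  exact: grid_union_grid_cell.
have mcell : measurable (grid_cell m x).
  apply: (measurable_grid_union q_gt1 (cellP (scale e i.+1) _)) => mu.
  by rewrite scaleS leq_add2l ltnW.
have mX : measurable X.
  apply: measurableI; last exact: measurable_spike.
  exact: (measurable_grid_union q_gt1 (grid_union_grid_cell (n := scale e i) _ _)).
have corner y : X y -> grid_cell m x y /\ forall mu,
    0 <= q%:R ^+ m mu * tnth x mu - (digits q (m mu) (tnth x mu))%:R <= q%:R^-1 /\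
    0 <= q%:R ^+ m mu * tnth y mu - (digits q (m mu) (tnth y mu))%:R <= q%:R^-1.
  move=> [[yc yx] [_ ys]].
  have H mu : digits q (m mu) (tnth y mu) = digits q (m mu) (tnth x mu) /\
    0 <= q%:R ^+ m mu * tnth x mu - (digits q (m mu) (tnth x mu))%:R <= q%:R^-1 /\
    0 <= q%:R ^+ m mu * tnth y mu - (digits q (m mu) (tnth y mu))%:R <= q%:R^-1.
    have /andP[x0 _] := xc mu; have /andP[y0 _] := yc mu.
    have xa' : (digits q (scale e i + (a mu).+2) (tnth x mu) %% q ^ (a mu).+2 < q ^ 1)%N.
      by rewrite expn1; exact: xa.
    have ya' : (digits q (scale e i + e i) (tnth y mu) %% q ^ e i < q ^ 0)%N.
      by have /andP[] := ys mu.
    have xE : digits q (m mu) (tnth x mu) = _ := digits_corner q_gt1 x0 (leqnSn (1 + a mu)%N) xa'.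
    have yE : digits q (m mu) (tnth y mu) = _ := digits_corner q_gt1 y0 (ltnW (ae mu) : (0 + a mu <= e i)%N) ya'.
    split; first by rewrite xE yE yx.
    split.
      exact: (digits_corner_itv q_gt1 x0 (leqnn _ : 1 + a mu < (a mu).+2)%N xa').
    exact: (digits_corner_itv q_gt1 y0 (ae mu : 0 + a mu < e i)%N ya').
  by split; [split => // mu; have [] := H mu|move=> mu; have [] := H mu].
have Xcell y : X y -> grid_cell m x y by move=> /corner[].
pose A := h i * \prod_mu (q%:R ^+ m mu * c mu).
pose B := \prod_mu (q%:R ^+ m mu * C mu).
have qm_ge0 mu : 0 <= q%:R ^+ m mu :> R by rewrite exprn_ge0.
have B0 : 0 <= B by apply: prodr_ge0 => mu _; rewrite mulr_ge0.
have tD := @dspike_trivIset R q d e.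
have mc := @measurable_unit_cube R d.
pose one : Rd R d -> R := cst 1.
have oneX : Leb.-integrable cube (EFin \o (one \_ X)).
  apply: (bounded_integrable (C := 1)) => //; first exact: lebesgue_unit_cube_lty.
    by apply: measurable_funTS; apply/(measurable_restrictT _ mX); exact: measurable_cst.
  by move=> y _; rewrite patchE; case: ifP; rewrite ?normr1// normr0.
have psicell : Leb.-integrable cube (EFin \o (psi \_ (grid_cell m x))).
  rewrite -restrict_EFin; apply/(integrable_restrict _ mcell mc).
  by apply: integrableS psii => //; exact: measurableI.
(* Points of [X] that belong to no earlier spike give the gain [A]; the loss is [B] times the part
   [psi] of [phi] coming from later spikes. *)
have lower y : cube y -> A * (one \_ X) y - B * (psi \_ (grid_cell m x)) y <=
    phi y * grid_kernel m x y.
  move=> _; rewrite !patchE.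
  have [yc|nyc] := pselect (grid_cell m x y); last first.
    rewrite !memNset ?mulr0 ?subrr//; last by move=> /Xcell.
    have [yh|nyh] := pselect (half_cube y); first by rewrite grid_kernel_out// mulr0.
    by rewrite stepf_dspike_out// mul0r.
  have yh := yc.1.
  have KB : - B <= grid_kernel m x y.
    by rewrite lerNl (le_trans _ (grid_kernel_bounded m y xc))// -normrN ler_norm.
  rewrite (mem_set yc).
  have Xle : X y -> \prod_mu (q%:R ^+ m mu * c mu) <= grid_kernel m x y.
    move=> Xy; have [_ Xc] := corner _ Xy; rewrite grid_kernel_in//.
    apply: ler_prod => mu _; rewrite mulr_ge0//=.
    by rewrite ler_wpM2l// kernel_ge//; have [] := Xc mu.
  have [[l yl]|nol] := pselect (exists l, dspike q e l y); last first.
    rewrite /psi !stepf_out; try by move=> l yl; apply: nol; exists l.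
    rewrite mul0r mulr0 subr0 memNset ?mulr0// => -[_ ys]; apply: nol.
    have [l0 yl0 l0min] : exists2 l0, spike q e l0 y & forall l, (l < l0)%N -> ~ spike q e l y.
      have ex : exists l, `[< spike q e l y >] by exists i; exact/asboolP.
      case: (ex_minnP ex) => l0 /asboolP yl0 l0min; exists l0 => // l ll0 yl.
      by have := l0min l (asboolT yl); rewrite leqNgt ll0.
    by exists l0; apply/dspikeE.
  rewrite /psi !(stepf_in _ tD yl) /h'; have [li|il|il] := ltngtP l i.
  (* An earlier spike is a union of cubes of side [q ^- scale e i]; if it met the cell of [x] it
     would contain [x]. *)
  - have /dspikeE[ys _] := yl; case: (xs l li).
    have [_ H] := @grid_union_spike R q q_gt1 d e _ _ li.
    apply: H ys => // mu; have := yc.2 mu; rewrite /m.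
    have /andP[x0 _] := xc mu; have /andP[y0 _] := yh mu.
    by rewrite (digits_div q_gt1 (scale e i) (a mu) x0) (digits_div q_gt1 (scale e i) (a mu) y0) => ->.
  - rewrite memNset; last by move=> -[_ ys]; have /dspikeE[_ /(_ _ il)] := yl.
    by rewrite mulr0 sub0r -mulNr mulrC ler_wpM2l.
  - rewrite mulr0 subr0 il.
    have Xy : X y.
      split; last by rewrite -il; exact: dspike_sub yl.
      split => // mu; have := yc.2 mu; rewrite /m.
      have /andP[x0 _] := xc mu; have /andP[y0 _] := yh mu.
      by rewrite (digits_div q_gt1 (scale e i) (a mu) x0) (digits_div q_gt1 (scale e i) (a mu) y0) => ->.
    by rewrite mem_set// (_ : one y = 1)// mulr1 /A ler_wpM2l// Xle.
have intX : \int[Leb]_(y in cube) (one \_ X) y = \prod_(mu < d) (q%:R ^+ scale e i)^-1 *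
    spike_density R q d e i.
  rewrite -Rintegral_mkcondr Rintegral_cst ?mul1r//; last exact: measurableI.
  have [_ _ H] := spike_equidistributed R q_gt1 d e i.
  rewrite setIidr; last by move=> y [[yh _] _]; exact: icube_sub.
  have XE : Leb X = (\prod_(mu < d) (q%:R ^+ scale e i)^-1 * spike_density R q d e i)%:E.
    by rewrite /X H ?lebesgue_grid_cell//; exact: grid_union_grid_cell.
  by move: (congr1 fine XE).
have intpsi : \int[Leb]_(y in cube) (psi \_ (grid_cell m x)) y <=
    \prod_mu (q%:R ^+ m mu)^-1 * S.
  rewrite -Rintegral_mkcondr setIidr; last by move=> y [yh _]; exact: icube_sub.
  have H := integral_dspike_le q_gt1 (c := h') (n := i.+1) h'0.
  have /H {}H : forall l, (l < i.+1)%N -> h' l = 0 by move=> l; rewrite ltnS /h' leqNgt => /negbTE ->.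
  have /H {}H : grid_union q (scale e i.+1) (grid_cell m x).
    by apply: cellP => mu; rewrite scaleS leq_add2l ltnW.
  rewrite -lee_fin /Rintegral fineK; last first.
    apply: integrable_fin_num => //; apply: integrableS psii => //.
    by move=> y [yh _]; exact: icube_sub.
  apply: (le_trans H); rewrite lebesgue_grid_cell// EFinM lee_wpmul2l//.
  by rewrite lee_fin; apply: prodr_ge0 => mu _; rewrite invr_ge0.
have lowi : Leb.-integrable cube
    (EFin \o (fun y => A * (one \_ X) y - B * (psi \_ (grid_cell m x)) y)).
  apply: eq_integrable (integrableB mc (integrableZl mc A oneX) (integrableZl mc B psicell)) => //.
have := le_Rintegral mc lowi (integrable_mul_grid_kernel m xc phii) lower.
apply: le_trans.
rewrite RintegralB//; last 2 first.
- apply: eq_integrable (integrableZl mc A oneX) => //.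
- apply: eq_integrable (integrableZl mc B psicell) => //.
rewrite !RintegralZl// intX lerB//.
  rewrite /A -[leLHS]mulrA -[leRHS]mulrA ler_wpM2l//.
  rewrite [leRHS]mulrA -big_split mulrC ler_wpM2r ?(ltW (spike_density_gt0 R q_gt1 d e i))//.
  rewrite le_eqVlt; apply/orP; left; apply/eqP; apply: eq_bigr => mu _.
  by rewrite /m exprD/=; field; rewrite gt_eqF// exprn_gt0// ltr0n ltnW.
(* The bound [B] of the kernel times the volume of the cell is the product of the [C mu], whatever
   the grid. *)
apply: (le_trans (ler_wpM2l B0 intpsi)); rewrite mulrA /B -big_split mulrC.
rewrite le_eqVlt; apply/orP; left; apply/eqP; congr (_ * _); apply: eq_bigr => mu _.
by rewrite /= mulrAC divff ?mul1r// gt_eqF// exprn_gt0// ltr0n ltnW.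
Qed.

End lower_bound.

End grid_partitions.

(** * Dimension at least two *)

Section bad_boxes.
Context (R : realType) (q : nat) (q_gt1 : (1 < q)%N) (d : nat).
Notation Leb := (lebesgue_tuple R d.+1).
Implicit Types (w n : nat).

(* The exponents a with sum (d + 1) w and a mu <= w for mu > 0. *)
Definition exponents w (f : {ffun 'I_d -> 'I_w.+1}) (mu : 'I_d.+1) : nat :=
  if unlift ord0 mu is Some j then val (f j) else (d.+1 * w - \sum_j val (f j))%N.

Lemma exponents_sum w (f : {ffun 'I_d -> 'I_w.+1}) :
  (\sum_mu exponents f mu = d.+1 * w)%N.
Proof.
rewrite big_ord_recl /exponents unlift_none.
rewrite [X in (_ + X)%N](eq_bigr (fun j => val (f j))) => [|j _]; last by rewrite liftK.
rewrite subnK// (leq_trans (_ : _ <= \sum_(j < d) w)%N)//.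
  by apply: leq_sum => j _; rewrite -ltnS ltn_ord.
by rewrite sum_nat_const card_ord leq_mul2r leqnSn orbT.
Qed.

Lemma exponents_le w (f : {ffun 'I_d -> 'I_w.+1}) mu : (exponents f mu <= d.+1 * w)%N.
Proof. by rewrite -(exponents_sum f) (bigD1 mu)//= leq_addr. Qed.

(** In direction [mu] the [a mu + 1] digits after the first [n] vanish and the next one does not.
    The zeros put the point in the first q-th of its cell, where the kernel is bounded below. The
    nonzero digit determines [a mu], so that boxes with different exponents are disjoint. *)
Definition bad_box n (a : 'I_d.+1 -> nat) : set (Rd R d.+1) :=
  periodic_box q n (fun mu => (a mu).+2) (fun=> 1%N) (fun=> q).

Lemma bad_box_disjoint n a b x mu : bad_box n a x -> bad_box n b x -> a mu = b mu.
Proof.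
wlog ab : a b / (a mu < b mu)%N.
  move=> H xa xb; have [ab|ba|//] := ltngtP (a mu) (b mu); first exact: H xa xb.
  by apply/esym; exact: H xb xa.
move=> [xc xa] [_ xb]; have /andP[x0 _] := xc mu.
have /andP[xa0 _] := xa mu; have /andP[_ xbq] := xb mu.
rewrite -[X in (_ < X)%N]expn1 in xbq.
have xE := digits_corner q_gt1 x0 (_ : 1 + (a mu).+2 <= (b mu).+2)%N xbq.
by move: xa0; rewrite xE ?modnMl.
Qed.

Definition bad_set n w : set (Rd R d.+1) :=
  \bigcup_(f : {ffun 'I_d -> 'I_w.+1}) bad_box n (exponents f).

(** The [w.+1 ^ d] boxes all have the same density, because their exponents have the same sum. *)
Definition bad_density w : R :=
  (w.+1)%:R ^+ d * ((q.-1)%:R ^+ d.+1 / q%:R ^+ (d.+1 * w + 2 * d.+1)).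

Lemma bad_set_equidistributed n w : equidistributed q n (bad_set n w) (bad_density w).
Proof.
have E (f : {ffun 'I_d -> 'I_w.+1}) :
    periodic_density R q (fun mu => (exponents f mu).+2) (fun=> 1%N) (fun=> q) =
    (q.-1)%:R ^+ d.+1 / q%:R ^+ (d.+1 * w + 2 * d.+1).
  rewrite /periodic_density big_split/= prodr_const card_ord subn1; congr (_ * _).
  under eq_bigr do rewrite -exprVn.
  rewrite prodrXr -exprVn; congr (_ ^+ _).
  under eq_bigr do rewrite -addn2.
  by rewrite big_split/= exponents_sum sum_nat_const card_ord [(d.+1 * 2)%N]mulnC.
have -> : bad_density w = \sum_(f : {ffun 'I_d -> 'I_w.+1})
    periodic_density R q (fun mu => (exponents f mu).+2) (fun=> 1%N) (fun=> q).
  rewrite (eq_bigr _ (fun f _ => E f)) sumr_const card_ffun !card_ord.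
  by rewrite -[RHS]mulr_natl natrX.
apply: equidistributed_bigcup => //.
- apply/trivIsetP => f g _ _ /eqP fg; apply/eqP/negPn/negP => /set0P[x [xf xg]].
  apply: fg; apply/ffunP => j; apply: val_inj.
  have := bad_box_disjoint (lift ord0 j) xf xg.
  by rewrite /exponents !liftK.
- by move=> f; rewrite E divr_ge0// exprn_ge0// ler0n.
- move=> f; apply: periodic_box_equidistributed => // mu.
  by rewrite (ltnW q_gt1) -[X in (X <= _)%N]expn1 leq_exp2l.
Qed.

Lemma grid_union_bad_set n w e : (d.+1 * w + 2 <= e)%N -> grid_union q (n + e) (bad_set n w).
Proof.
move=> we; apply: grid_union_bigcup => f _; apply: grid_union_periodic_box => // mu.
by rewrite (leq_trans _ we)// addn2 !ltnS exponents_le.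
Qed.

End bad_boxes.

(** * Almost every point lies in infinitely many bad sets *)

Section borel_cantelli.
Context (R : realType) (q : nat) (q_gt1 : (1 < q)%N) (d : nat).
Notation Leb := (lebesgue_tuple R d).
Notation half_cube := (@icube R d).
Context (M : nat -> nat) (M_ndecr : forall i j, (i <= j)%N -> (M i <= M j)%N).
Context (A : nat -> set (Rd R d)) (p : nat -> R) (p_ge0 : forall i, 0 <= p i).
Hypothesis A_equi : forall i, equidistributed q (M i) (A i) (p i).
Hypothesis A_grid : forall i, grid_union q (M i.+1) (A i).
Hypothesis p_unbounded : forall m C, exists n, C <= \sum_(m <= i < n) p i.

Let mA i : measurable (A i). Proof. by have [] := A_equi i. Qed.

Let missed m n := half_cube `\` \bigcup_(i in [set i | (m <= i < n)%N]) A i.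

Let missed_grid m n : grid_union q (M n) (missed m n).
Proof.
apply: grid_unionD; first exact: grid_union_icube.
apply: grid_union_bigcup => i /= /andP[_ i_n].
exact: grid_unionW (M_ndecr i_n) (A_grid i).
Qed.

(** By equidistribution the measure is the product of the [1 - p i]. The bound by the inverse of 1 +
    s, with s the sum of the [p i], is enough to let it tend to 0, and is preserved because (1 -
    x)(1 + s + x) <= 1 + s for nonnegative s and x. *)
Let Leb_missed m n : (m <= n)%N ->
  exists2 v, Leb (missed m n) = v%:E & v * (1 + \sum_(m <= i < n) p i) <= 1.
Proof.
move=> /subnKC <-; elim: (n - m)%N => [|l [v vE vle]].
  exists 1; last by rewrite addn0 big_geq// addr0 mulr1.
  rewrite /missed bigcup0 ?setD0 ?lebesgue_icube// => i /=.
  by rewrite addn0; case: ltngtP.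
have v0 : 0 <= v by rewrite -lee_fin -vE.
exists (v * (1 - p (m + l)%N)); last first.
  rewrite addnS big_nat_recr ?leq_addr//=.
  have := p_ge0 (m + l); have : 0 <= \sum_(m <= i < m + l) p i by apply: sumr_ge0.
  move: vle; set s := \sum_(_ <= _ < _) _; set x := p _ => vs s0 x0.
  have : 0 <= v * x * s by rewrite !mulr_ge0.
  have : 0 <= v * x * x by rewrite !mulr_ge0.
  have -> : v * (1 - x) * (1 + (s + x)) = v * (1 + s) - v * x * s - v * x * x by ring.
  lra.
have -> : missed m (m + l.+1) = missed m (m + l) `\` A (m + l)%N.
  apply/seteqP; split => x.
    move=> [xc xn]; split; last by move=> Ax; apply: xn; exists (m + l)%N => //=; lia.
    by split => // -[i /= mi Ai]; apply: xn; exists i => //=; lia.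
  move=> [[xc xn] nA]; split => // -[i /= mi Ai].
  have [il|il] := eqVneq i (m + l)%N; first by apply: nA; rewrite -il.
  by apply: xn; exists i => //=; lia.
have mm := measurable_grid_union q_gt1 (missed_grid m (m + l)).
have lty : (Leb (missed m (m + l)) < +oo)%E by rewrite vE ltry.
transitivity (Leb (missed m (m + l)) - Leb (missed m (m + l) `&` A (m + l)%N))%E.
  exact: measureD.
have [_ _ H] := A_equi (m + l)%N.
by rewrite H// vE -EFinM -EFinB mulrBr mulr1.
Qed.

(* Second Borel-Cantelli lemma: equidistribution at the scale [M i] makes [A i]
   independent of the earlier sets. *)
Lemma lebesgue_lim_sup_set_setD : Leb (half_cube `\` lim_sup_set A) = 0%E.
Proof.
have mc : measurable half_cube.
  exact: (measurable_grid_union q_gt1 (@grid_union_icube R q d 0)).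
pose U m := half_cube `\` \bigcup_(i in [set i | (m <= i)%N]) A i.
have mU m : measurable (U m).
  by apply: measurableD => //; apply: bigcup_measurable.
have U0 m : Leb (U m) = 0%E.
  apply/eqP; rewrite eq_le measure_ge0 andbT; apply/lee_addgt0Pr => eps eps0.
  have [n Cn] := p_unbounded m eps^-1.
  have mn : (m <= n)%N.
    rewrite leqNgt; apply/negP => nm; move: Cn; rewrite big_geq; last exact: ltnW.
    by rewrite leNgt invr_gt0 eps0.
  have [v vE vle] := Leb_missed mn.
  rewrite add0e (@le_trans _ _ (Leb (missed m n)))//.
    apply: le_measure; rewrite ?inE//.
      exact: measurable_grid_union (missed_grid m n).
    by move=> x [xc xn]; split => // -[i /= /andP[mi _] Ai]; apply: xn; exists i.
  rewrite vE lee_fin.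
  have v0 : 0 <= v by rewrite -lee_fin -vE.
  move: Cn; rewrite -(ler_pM2l eps0) mulfV ?gt_eqF//.
  move: vle; set s := \sum_(_ <= _ < _) _; nra.
have -> : half_cube `\` lim_sup_set A = \bigcup_m U m.
  apply/seteqP; split => x.
    move=> [xc xn]; apply: contrapT => h; apply: xn => m _.
    by apply: contrapT => hm; apply: h; exists m.
  by move=> [m _ [xc xn]]; split => // xl; apply: xn; exact: xl.
apply/eqP; rewrite eq_le measure_ge0 andbT.
apply: (le_trans (measure_sigma_subadditive Leb mU _ (fun _ => id))).
  exact: bigcupT_measurable.
by rewrite eseries0// => i _ _; exact: U0.
Qed.

End borel_cantelli.

(** * Extraction from limits, and integer parts of logarithms *)

Section extraction.
Context (R : realType).

(** Otherwise [sigma] would be at least [eps] beyond [T], and so would its lower limit. *)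
Lemma limf_einf0_small (sigma : R -> R) :
  limf_einf (fun t => (sigma t)%:E) +oo = 0%E ->
  forall eps T : R, 0 < eps -> exists2 t, T < t & sigma t < eps.
Proof.
move=> s0 eps T eps0; apply: contrapT => h.
have le : (limf_esup (\- (fun t : R => (sigma t)%:E)) (+oo)%R <= (- eps)%:E)%E.
  apply: (@le_trans _ _ (ereal_sup ((\- (fun t : R => (sigma t)%:E))%E @` [set t : R | T < t]))).
    by apply: ereal_inf_lbound; exists [set t : R | T < t] => //; exists T; split => //; exact: num_real.
  apply: ub_ereal_sup => _ [t /= Tt <-]; change ((- sigma t)%:E <= (- eps)%:E)%E.
    rewrite lee_fin lerN2 leNgt.
  by apply/negP => st; apply: h; exists t.
have : (0 <= (- eps)%:E)%E.
  by rewrite -[leLHS]oppe0 -s0 /limf_einf oppeK.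
by rewrite lee_fin oppr_ge0 leNgt eps0.
Qed.

Lemma limn_esup_pinfty (u : nat -> \bar R) :
  (forall (C : R) m, exists2 n, (m <= n)%N & (C%:E <= u n)%E) -> limn_esup u = +oo%E.
Proof.
move=> H; rewrite limn_esup_lim.
have -> : esups u = cst +oo%E; last exact: lim_cst.
apply/funext => m; apply/eqyP => C _; have [n mn Cu] := H C m.
apply: (le_trans Cu); apply: ereal_sup_ubound; exists n => //.
Qed.

Lemma exp_between (Q : nat) (x : R) : (1 < Q)%N -> 1 <= x ->
  exists n, Q%:R ^+ n <= x < Q%:R ^+ n.+1.
Proof.
move=> Q1 x1.
have ex : exists n, x < Q%:R ^+ n.
  exists (Num.truncn x).+1; apply: (lt_trans (truncnS_gt _)).
  by rewrite -natrX ltr_nat ltn_expl.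
case: (ex_minnP ex) => -[|n]; first by rewrite expr0 ltNge x1.
move=> xn nmin; exists n; rewrite xn andbT leNgt; apply/negP => /nmin.
by rewrite ltnn.
Qed.

Lemma nneseries_le_bound (u : nat -> R) (C : R) : (forall i, 0 <= u i) ->
  (forall n, \sum_(i < n) u i <= C) -> (\sum_(i <oo) (u i)%:E <= C%:E)%E.
Proof.
move=> u0 uC; apply: lime_le; first by apply: is_cvg_nneseries => i _ _; rewrite lee_fin.
by apply: nearW => n; rewrite sumEFin lee_fin big_mkord.
Qed.

End extraction.

(* [i |-> (block i, block_pos i)] enumerates the pairs [(j, s)] with [s < N j]
   in lexicographic order. *)
Section flattening.
Context (N : nat -> nat) (N_gt0 : forall j, (0 < N j)%N).

Definition block_start (j : nat) : nat := \sum_(l < j) N l.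

Lemma block_startS j : block_start j.+1 = (block_start j + N j)%N.
Proof. by rewrite /block_start big_ord_recr. Qed.

Lemma leq_block_start j : (j <= block_start j)%N.
Proof.
elim: j => // j IH; rewrite block_startS -addn1.
exact: leq_add IH (N_gt0 j).
Qed.

Lemma block_start_mono i j : (i <= j)%N -> (block_start i <= block_start j)%N.
Proof.
move=> /subnKC <-; elim: (j - i)%N => [|n IH]; first by rewrite addn0.
by rewrite addnS block_startS (leq_trans IH)// leq_addr.
Qed.

Let block_ex i : exists j, (i < block_start j.+1)%N.
Proof. by exists i; exact: leq_block_start. Qed.

Definition block (i : nat) : nat := ex_minn (block_ex i).

Definition block_pos (i : nat) : nat := (i - block_start (block i))%N.

Lemma block_itv i : (block_start (block i) <= i < block_start (block i).+1)%N.
Proof.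
rewrite /block; case: ex_minnP => -[|j] ij jmin; rewrite ij andbT.
  by rewrite /block_start big_ord0.
by rewrite leqNgt; apply/negP => /jmin; rewrite ltnn.
Qed.

Lemma blockD j s : (s < N j)%N -> block (block_start j + s) = j.
Proof.
move=> sN; have := block_itv (block_start j + s).
set l := block _ => /andP[l1 l2].
apply/eqP; rewrite eqn_leq; apply/andP; split; rewrite leqNgt; apply/negP => H.
  by have := block_start_mono H; rewrite block_startS; lia.
by have := block_start_mono H; lia.
Qed.

Lemma block_posD j s : (s < N j)%N -> block_pos (block_start j + s) = s.
Proof. by move=> sN; rewrite /block_pos blockD// addKn. Qed.

Lemma leq_block j i : (block_start j <= i)%N -> (j <= block i)%N.
Proof.
move=> ji; rewrite leqNgt; apply/negP => H.
have := block_start_mono H; have := block_itv i; lia.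
Qed.

Lemma sum_block (V : nmodType) (F : nat -> V) j :
  \sum_(i < block_start j) F (block i) = \sum_(l < j) F l *+ N l.
Proof.
elim: j => [|j IH]; first by rewrite /block_start !big_ord0.
rewrite big_ord_recr -IH /= -!(big_mkord xpredT (fun i => F (block i))).
rewrite (big_cat_nat (n := block_start j)) ?block_start_mono//=; congr (_ + _).
rewrite -{1}[block_start j]add0n big_addn block_startS addKn big_mkord.
rewrite (eq_bigr (fun=> F j)) => [|s _]; last by rewrite addnC blockD.
by rewrite sumr_const card_ord.
Qed.

End flattening.

(* The height [h] is dictated by [sigma]; the rectangles are then as eccentric
   as [log h] permits, which makes the bad set larger than the spike by the
   factor [(log h) ^ d] that enters the integral. *)
Lemma spike_parameters (R : realType) (q : nat) (q_gt1 : (1 < q)%N) (d : nat) (d_gt0 : (0 < d)%N)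
    (sigma : R -> R) (sigma_gt0 : forall t, 0 <= t -> 0 < sigma t)
    (sigma_liminf : limf_einf (fun t => (sigma t)%:E) +oo = 0%E)
    (c lam eta : R) : 0 < c -> 0 < lam -> 0 < eta ->
  exists h w e, [/\ 1 <= h, (d.+1 * w + 2 <= e)%N,
    lam <= h * spike_density R q d.+1 (fun=> e) 0 * (q%:R ^+ (d.+1 * w) * c),
    h * spike_density R q d.+1 (fun=> e) 0 <= eta * bad_density R q d w &
    sigma h * h * logp h ^+ d * spike_density R q d.+1 (fun=> e) 0 <=
      eta * bad_density R q d w].
Proof.
move=> c0 lam0 eta0; set D := d.+1; pose q' : R := q%:R.
have q1 : 1 < q' by rewrite ltr1n.
have q0 : 0 < q' by apply: lt_trans q1.
have qn n : 0 < q' ^+ n by rewrite exprn_gt0.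
have qS (m n : nat) : q' ^+ m < q' ^+ n -> (m < n)%N by rewrite ltr_eXn2l.
(* Chosen so that [h < q ^ (D * D * w.+1)] gives [ln h <= w.+1 * L]. *)
pose L : R := (D * D)%:R * ln q'.
have L0 : 0 < L by rewrite mulr_gt0 ?ln_gt0// ltr0n.
have q3 : q' ^+ (3 * D) = q' ^+ D * q' ^+ (2 * D) by rewrite -exprD.
pose K := lam * q' ^+ (3 * D) / c.
have K0 : 0 < K by rewrite divr_gt0// mulr_gt0.
(* In the last estimate the factors [K] and [L ^+ d] appear, and [eps] cancels them to leave
   [eta]. *)
pose eps := eta / (K * L ^+ d).
have eps0 : 0 < eps by rewrite divr_gt0// mulr_gt0// exprn_gt0.
(* The first term makes the number of shapes exceed [K / eta]; the second makes [c * q' ^+ s] at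
   least [lam * q' ^+ (2 * D)], which leaves room for [s + 2 <= e]. *)
pose W := (Num.truncn (K / eta + lam * q' ^+ (2 * D) / c)).+1.
have WK : K / eta + lam * q' ^+ (2 * D) / c < W%:R by exact: truncnS_gt.
have A0 : 0 < K / eta by rewrite divr_gt0.
have B0 : 0 < lam * q' ^+ (2 * D) / c by rewrite divr_gt0// mulr_gt0.
have [h Th sh] := limf_einf0_small sigma_liminf (q' ^+ (D * D * W)) eps0.
have h1 : 1 <= h by rewrite (le_trans _ (ltW Th))// exprn_ege1// ltW.
have h0 : 0 < h by apply: lt_le_trans h1.
(* The base [q ^ (D * D)] ensures [q ^ (D * s) <= h], where [s = D * w] is the sum of the exponents.
   This is why all rectangles can be larger than the spike. *)
have [w] : exists w, (q ^ (D * D))%:R ^+ w <= h < (q ^ (D * D))%:R ^+ w.+1.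
  by apply: exp_between => //; rewrite -{1}(expn0 q) ltn_exp2l.
rewrite natrX -/q' -!exprM => /andP[wh hw].
have Ww : (W <= w)%N.
  by have := qS _ _ (lt_trans Th hw); rewrite ltn_pmul2l// ltnS.
pose s := (D * w)%N.
have cs : lam * q' ^+ (2 * D) <= c * q' ^+ s.
  rewrite mulrC [c * _]mulrC mulrC -ler_pdivrMr// (@le_trans _ _ W%:R)//.
    by rewrite (le_trans _ (ltW WK))// lerDr ltW.
  rewrite /q' -natrX ler_nat (leq_trans Ww)// (leq_trans (ltnW (ltn_expl w q_gt1)))//.
  by rewrite leq_exp2l// /s mulSn leq_addr.
pose X := h * c * q' ^+ s / lam.
have sX : q' ^+ (D * (s + 2)) <= X.
  rewrite ler_pdivlMr//; have -> : (D * (s + 2) = D * D * w + 2 * D)%N.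
    by rewrite mulnDr mulnA [(D * 2)%N]mulnC.
  have -> : q' ^+ (D * D * w + 2 * D) * lam = q' ^+ (D * D * w) * (lam * q' ^+ (2 * D)).
    by rewrite exprD; ring.
  by rewrite -[leRHS]mulrA; apply: ler_pM => //; rewrite ?mulr_ge0// ltW.
have X1 : 1 <= X by rewrite (le_trans _ sX)// exprn_ege1// ltW.
(* The largest [e], that is the smallest spike, for which the main term of the projection still
   reaches [lam]. *)
have [e] : exists e, (q ^ D)%:R ^+ e <= X < (q ^ D)%:R ^+ e.+1.
  by apply: exp_between => //; rewrite -{1}(expn0 q) ltn_exp2l.
rewrite natrX -/q' -!exprM => /andP[eX Xe].
have se : (s + 2 <= e)%N.
  by have := qS _ _ (le_lt_trans sX Xe); rewrite ltn_pmul2l// ltnS.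
pose rho := spike_density R q D (fun=> e) 0.
have rhoE : rho = (q' ^+ (D * e))^-1 by rewrite /rho /spike_density mulnC.
have rho0 : 0 < rho by rewrite rhoE invr_gt0.
have hrho : h * rho <= lam * q' ^+ D / (c * q' ^+ s).
  rewrite rhoE ler_pdivrMr// mulrAC ler_pdivlMr; last by rewrite mulr_gt0.
  move: Xe; rewrite ltr_pdivrMr// mulnS exprD => /ltW Xe.
  by rewrite mulrA (le_trans Xe)//; lra.
have bd : w.+1%:R ^+ d / q' ^+ (s + 2 * D) <= bad_density R q d w.
  rewrite /bad_density -/D -/s ler_wpM2l ?exprn_ge0// -/q' ler_peMl// ?invr_ge0 ?(ltW (qn _))//.
  by rewrite exprn_ege1// ler1n -ltnS prednK// ltnW.
(* This is where the dimension [d.+1] is at least 2: a positive power of [w.+1] beats the constant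
   [K / eta]. *)
have KW : K <= eta * w.+1%:R ^+ d.
  rewrite mulrC -ler_pdivrMr// (@le_trans _ _ w.+1%:R)//.
    rewrite (@le_trans _ _ W%:R)//; last by rewrite ler_nat (leq_trans Ww).
    by rewrite (le_trans _ (ltW WK))// lerDl ltW.
  by rewrite -[leLHS]expr1 ler_weXn2l// ler1n.
have bound x : x * q' ^+ (2 * D) <= eta * w.+1%:R ^+ d ->
    x / q' ^+ s <= eta * bad_density R q d w.
  move=> xle; apply: (le_trans _ (ler_wpM2l (ltW eta0) bd)).
  rewrite exprD invfM mulrA [leRHS]mulrA mulrAC ler_wpM2r ?invr_ge0 ?(ltW (qn _))//.
  by rewrite ler_pdivlMr.
exists h, w, e; split => //.
- have -> : h * rho * (q' ^+ s * c) = X * lam / q' ^+ (D * e).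
    by rewrite rhoE /X; field; rewrite !gt_eqF//=.
  by rewrite ler_pdivlMr// mulrC ler_wpM2r// ltW.
- apply: (le_trans hrho); rewrite invfM mulrA; apply: bound.
  have -> : lam * q' ^+ D / c * q' ^+ (2 * D) = K by rewrite /K q3; ring.
  exact: KW.
have lh : 0 <= logp h <= w.+1%:R * L.
  rewrite /logp le_max lexx/= ge_max mulr_ge0 ?(ltW L0)//=.
  rewrite (le_trans (_ : _ <= ln (q' ^+ (D * D * w.+1))))//.
    by rewrite ler_ln ?posrE// ltW.
  by rewrite lnXn// -[leLHS]mulr_natl natrM /L; lra.
rewrite (@le_trans _ _ (eps * (w.+1%:R * L) ^+ d * (lam * q' ^+ D / (c * q' ^+ s))))//.
  have -> : sigma h * h * logp h ^+ d * rho = sigma h * logp h ^+ d * (h * rho) by ring.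
  have sg0 := ltW (sigma_gt0 _ (ltW h0)); have /andP[l0 lL] := lh.
  apply: ler_pM => //.
  - by rewrite mulr_ge0// exprn_ge0.
  - by rewrite mulr_ge0// ltW.
  apply: ler_pM => //; [exact: exprn_ge0|exact: ltW|].
  by apply: lerXn2r => //; rewrite nnegrE// (le_trans l0).
rewrite invfM [X in _ * X <= _]mulrA mulrA; apply: bound.
rewrite le_eqVlt; apply/orP; left; apply/eqP.
rewrite /eps /K (exprMn d w.+1%:R).
rewrite q3.
by field; rewrite !gt_eqF// ?exprn_gt0.
Qed.

(** * The sequence of spikes in dimension at least two *)

Section spike_sequence.
Context (R : realType) (q : nat) (q_gt1 : (1 < q)%N) (d : nat) (d_gt0 : (0 < d)%N).
Context (sigma : R -> R) (sigma_gt0 : forall t, 0 <= t -> 0 < sigma t).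
Hypothesis sigma_liminf : limf_einf (fun t => (sigma t)%:E) +oo = 0%E.

Lemma bad_density_gt0 w : 0 < bad_density R q d w.
Proof.
rewrite mulr_gt0 ?exprn_gt0 ?ltr0n// divr_gt0 ?exprn_gt0 ?ltr0n// ?(ltnW q_gt1)//.
by rewrite -ltnS prednK// ltnW.
Qed.

Lemma bad_density_le1 w : bad_density R q d w <= 1.
Proof.
have [mA AI H] := @bad_set_equidistributed R q q_gt1 d 0 w.
have := H _ (@grid_union_icube R q d.+1 0).
rewrite setIidr// lebesgue_icube mul1e -lee_fin => <-.
rewrite -(@lebesgue_icube R d.+1); apply: le_measure => //; rewrite inE//.
exact: (measurable_grid_union q_gt1 (@grid_union_icube R q d.+1 0)).
Qed.

(** The parameters obtained for [lam = j.+1] and [eta j] are repeated [N j] times, where [N j] is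
    about the inverse of the bad density. A block then adds between 1 and 2 to the sum of the
    densities, and at most 2 [eta j] = 2^-(j + 2) to either of the other sums, which are thus at
    most 1/2. *)
Lemma spike_sequence (c : R) : 0 < c ->
  exists (h : nat -> R) (w e : nat -> nat),
  let mass i := h i * spike_density R q d.+1 e i in
  [/\ forall i, 1 <= h i,
      forall i, (d.+1 * w i + 2 <= e i)%N,
      forall lam, exists m, forall i, (m <= i)%N ->
        lam <= mass i * (q%:R ^+ (d.+1 * w i) * c),
      (\sum_(i <oo) (mass i)%:E <= (2^-1)%:E)%E /\
      (\sum_(i <oo) (sigma (h i) * h i * logp (h i) ^+ d * spike_density R q d.+1 e i)%:E
        <= (2^-1)%:E)%E &
      forall m C, exists n, C <= \sum_(m <= i < n) bad_density R q d (w i)].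
Proof.
move=> c0; pose p w := bad_density R q d w.
pose eta j : R := (2 ^+ j.+3)^-1.
pose P j (x : R * (nat * nat)) := let: (h, (w, e)) := x in
  [/\ 1 <= h, (d.+1 * w + 2 <= e)%N,
    j.+1%:R <= h * spike_density R q d.+1 (fun=> e) 0 * (q%:R ^+ (d.+1 * w) * c),
    h * spike_density R q d.+1 (fun=> e) 0 <= eta j * p w &
    sigma h * h * logp h ^+ d * spike_density R q d.+1 (fun=> e) 0 <= eta j * p w].
have [f fP] : {f : nat -> R * (nat * nat) & forall j, P j (f j)}.
  apply: (@choice _ _ P) => j; have j0 : 0 < j.+1%:R :> R by rewrite ltr0n.
  have eta0 : 0 < eta j by rewrite invr_gt0 exprn_gt0.
  have [h [w [e H]]] := spike_parameters q_gt1 d_gt0 sigma_gt0 sigma_liminf c0 j0 eta0.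
  by exists (h, (w, e)).
pose h j := (f j).1; pose w j := (f j).2.1; pose e j := (f j).2.2.
have {}fP j : P j (h j, (w j, e j)) by have := fP j; rewrite /h /w /e; case: (f j) => ? [].
pose N j := (Num.truncn (p (w j))^-1).+1.
have N0 j : (0 < N j)%N by [].
have p0 j : 0 < p j by exact: bad_density_gt0.
have Np j : 1 <= p (w j) * (N j)%:R <= 2.
  have p1 : p (w j) <= 1 by exact: bad_density_le1.
  have i0 : 0 <= (p (w j))^-1 by rewrite invr_ge0 ltW.
  have /andP[t1 t2] := truncn_itv i0.
  apply/andP; split; first by rewrite -ler_pdivrMl// mulr1 ltW.
  rewrite /N -natr1 mulrDr mulr1 (_ : 2 = 1 + 1)// lerD//.
  by rewrite -ler_pdivlMl// mulr1.
pose J := block N0.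
have sum_le (F : nat -> R) : (forall j, 0 <= F j) -> (forall j, F j <= eta j * p (w j)) ->
    (\sum_(i <oo) (F (J i))%:E <= (2^-1)%:E)%E.
  move=> F0 Fle; apply: nneseries_le_bound => [i //|n].
  apply: (@le_trans _ _ (\sum_(i < block_start N n) F (J i))).
    rewrite -!(big_mkord xpredT (fun i => F (J i))).
    rewrite [leRHS](big_cat_nat (n := n)) ?leq_block_start//=.
    by rewrite lerDl sumr_ge0.
  rewrite sum_block; apply: (@le_trans _ _ (\sum_(l < n) (2 ^+ l.+2)^-1)).
    apply: ler_sum => l _; rewrite -[F l *+ N l]mulr_natr.
    rewrite (le_trans (ler_wpM2r _ (Fle l)))// -mulrA.
    have /andP[_ H] := Np l.
    have -> : (2 ^+ l.+2)^-1 = eta l * 2 :> R.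
      by rewrite /eta [2 ^+ l.+3]exprSr; field; rewrite expf_neq0.
    by rewrite ler_wpM2l// invr_ge0 exprn_ge0.
  rewrite (_ : \sum_(l < n) _ = 2^-1 - (2 ^+ n.+1)^-1); last first.
    elim: n => [|n IH]; first by rewrite big_ord0 expr1 subrr.
    rewrite big_ord_recr/= IH ![2 ^+ n.+2]exprS invfM.
    by set z := (2 ^+ n.+1)^-1; lra.
  by rewrite gerBl invr_ge0 exprn_ge0.
have rho0 i : 0 < spike_density R q d.+1 (fun=> e i) 0 by exact: spike_density_gt0.
have h1 i : 1 <= h i by have [] := fP i.
exists (h \o J), (w \o J), (e \o J); split.
- by move=> i; exact: h1.
- by move=> i /=; have [] := fP (J i).
- move=> lam; exists (block_start N (Num.truncn lam).+1) => i mi.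
  have [_ _ le _ _] := fP (J i); apply: le_trans le.
  rewrite (le_trans (ltW (truncnS_gt lam)))// ler_nat.
  exact: leq_trans (leq_block N0 mi) (leqnSn _).
- split.
    apply: (sum_le (fun j => h j * spike_density R q d.+1 (fun=> e j) 0)).
      by move=> j; rewrite mulr_ge0 ?(ltW (rho0 _))// (le_trans _ (h1 j)).
    by move=> j; have [] := fP j.
  apply: (sum_le (fun j => sigma (h j) * h j * logp (h j) ^+ d *
    spike_density R q d.+1 (fun=> e j) 0)).
    move=> j; have h0 : 0 <= h j by rewrite (le_trans _ (h1 j)).
    rewrite mulr_ge0 ?(ltW (rho0 _))// !mulr_ge0 ?(ltW (sigma_gt0 _))//.
    by rewrite exprn_ge0// /logp le_max lexx.
  by move=> j; have [] := fP j.
move=> m C; pose S := \sum_(i < m) p (w (J i)).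
(* Each block contributes at least 1, so [n] blocks make up for [C] and for the [m] omitted terms,
   whose sum is [S]. *)
pose n := maxn m (Num.truncn (C + S)).+1.
have mn : (m <= block_start N n)%N.
  exact: leq_trans (leq_maxl _ _) (leq_block_start N0 n).
exists (block_start N n).
rewrite -(lerD2l S) /S -(big_mkord xpredT (fun i => p (w (J i)))) -(big_cat_nat (n := m))//=.
rewrite !big_mkord addrC (sum_block N0 (fun j => p (w j))).
rewrite (le_trans (ltW (truncnS_gt _)))//.
apply: (@le_trans _ _ n%:R); first by rewrite ler_nat leq_maxr.
rewrite -[leLHS]mulr1 mulr_natl -[n in leLHS]card_ord -sumr_const; apply: ler_sum => l _.
by rewrite -[_ *+ N l]mulr_natr; have /andP[] := Np l.
Qed.

End spike_sequence.

(** * Assembly of the example in dimension at least two *)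

Definition divergent_example (R : realType) d (k : 'I_d -> nat) (sigma : R -> R) : Prop :=
  exists phi : Rd R d -> R,
    [/\ forall x, unit_cube R d x -> 0 <= phi x,
        measurable_fun (unit_cube R d) phi,
        (1 < d)%N ->
          (lebesgue_tuple R d).-integrable (unit_cube R d) (EFin \o phi),
        (lebesgue_tuple R d).-integrable (unit_cube R d)
          (fun x => (sigma (phi x) * phi x * logp (phi x) ^+ d.-1)%:E) &
        exists (B : set (Rd R d)) (Delta : nat -> multipartition R k),
          [/\ measurable B, B `<=` unit_cube R d,
              (0 < lebesgue_tuple R d B)%E,
              mesh (Delta n) @[n --> \oo] --> 0 &
              forall x, B x ->
                limn_esup (fun n => `|spline_proj_ext (Delta n) phi x|%E)
                  = +oo%E]].

(** A single base must serve all directions. Enlarging [q] only shrinks the corner on which the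
    kernel is bounded below, so a number larger than the bases of all directions will do. *)
Lemma kernel_constants (R : realType) d (k : 'I_d -> nat) (k_gt0 : forall mu, (0 < k mu)%N) :
  exists q (c C : 'I_d -> R), [/\ (1 < q)%N, forall mu, 0 < c mu, forall mu, 0 <= C mu,
    forall mu u v, 0 <= u <= 1 -> 0 <= v <= 1 -> `|bern_kernel (k mu) u v : R| <= C mu &
    forall mu u v, 0 <= u <= q%:R^-1 -> 0 <= v <= q%:R^-1 ->
      c mu <= bern_kernel (k mu) u v :> R].
Proof.
pose P mu (x : nat * R * R) := let: (q, c, C) := x in [/\ (1 < q)%N, 0 < c, 0 <= C,
    forall u v, 0 <= u <= 1 -> 0 <= v <= 1 -> `|bern_kernel (k mu) u v : R| <= C &
    forall u v, 0 <= u <= q%:R^-1 -> 0 <= v <= q%:R^-1 -> c <= bern_kernel (k mu) u v :> R].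
have [f fP] : {f : 'I_d -> nat * R * R & forall mu, P mu (f mu)}.
  apply: (@choice _ _ P) => mu.
  have [c [q [c0 q1 cP]]] := bern_kernel_corner R (k_gt0 mu).
  by have [C C0 CP] := bern_kernel_bounded R (k mu); exists (q, c, C).
pose q mu := (f mu).1.1.
have {}fP mu : P mu (q mu, (f mu).1.2, (f mu).2).
  by have := fP mu; rewrite /q; case: (f mu) => -[].
exists (\sum_mu q mu).+2, (fun mu => (f mu).1.2), (fun mu => (f mu).2); split => //.
- by move=> mu; have [] := fP mu.
- by move=> mu; have [] := fP mu.
- by move=> mu; have [] := fP mu.
move=> mu u v /andP[u0 uq] /andP[v0 vq]; have [q1 _ _ _ H] := fP mu.
have qle : (\sum_mu q mu).+2%:R^-1 <= (q mu)%:R^-1 :> R.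
  rewrite lef_pV2 ?posrE ?ltr0n// ?(ltnW q1)// ler_nat.
  by rewrite (bigD1 mu)//= -2!addnS leq_addr.
by apply: H; rewrite ?u0 ?v0 (le_trans _ qle).
Qed.

Lemma divergent_example_ge2 (R : realType) d (d_gt0 : (0 < d)%N)
    (k : 'I_d.+1 -> nat) (k_gt0 : forall mu, (0 < k mu)%N)
    (sigma : R -> R) (sigma_gt0 : forall t, 0 <= t -> 0 < sigma t)
    (sigma_liminf : limf_einf (fun t => (sigma t)%:E) +oo = 0%E) :
  divergent_example k sigma.
Proof.
have [q [c [C [q1 c0 C0 Cle cge]]]] := kernel_constants R k_gt0.
have pc0 : 0 < \prod_mu c mu by apply: prodr_gt0 => mu _; exact: c0.
have [h [w [e [h1 we lamP [mass_le smass_le] punb]]]] :=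
  spike_sequence q1 d_gt0 sigma_gt0 sigma_liminf pc0.
have h0 i : 0 <= h i by rewrite (le_trans _ (h1 i)).
have rho0 i : 0 < spike_density R q d.+1 e i by exact: spike_density_gt0.
pose Leb := lebesgue_tuple R d.+1.
pose phi := stepf (@dspike R q d.+1 e) h.
pose A i := @bad_set R q d (scale e i) (w i).
pose U := \bigcup_i @spike R q d.+1 e i.
(* Each shape of rectangle requires its own grid, so the partitions of stage [i] form a block with
   one entry for each shape. *)
pose N i := #|{ffun 'I_d -> 'I_(w i).+1}|.
have N0 i : (0 < N i)%N by apply/card_gt0P; exists [ffun=> ord0].
pose a i s := exponents (nth [ffun=> ord0] (enum {ffun 'I_d -> 'I_(w i).+1}) s).
pose J := block N0.
pose m n (mu : 'I_d.+1) := (scale e (J n) + a (J n) (block_pos N0 n) mu)%N.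
pose Delta n : multipartition R k := grid_partition R q1 k_gt0 (m n).
have leq_scale_id i : (i <= scale e i)%N.
  elim: i => // i IH; rewrite scaleS -addn1 leq_add//.
  by rewrite (leq_trans _ (we i))// addn2.
have tD := @dspike_trivIset R q d.+1 e.
have mD := @measurable_dspike R q q1 d.+1 e.
have mA i : measurable (A i).
  by have [] := @bad_set_equidistributed R q q1 d (scale e i) (w i).
have mU : measurable U by apply: bigcupT_measurable => i; exact: measurable_spike.
have mL : measurable (lim_sup_set A).
  by apply: bigcap_measurable => // i _; exact: bigcup_measurable.
have mI : measurable (@icube R d.+1).
  exact: (measurable_grid_union q1 (@grid_union_icube R q d.+1 0)).
have phii : Leb.-integrable (unit_cube R d.+1) (EFin \o phi).
  by apply: integrable_dspike => //; exact: le_lt_trans mass_le (ltry _).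
exists phi; split => //.
- by move=> x _; exact: stepf_ge0.
- exact: measurable_funTS (measurable_stepf h tD mD).
- pose g t := sigma t * t * logp t ^+ d.
  apply: (eq_integrable _ (EFin \o stepf (@dspike R q d.+1 e) (g \o h))) => //.
  + exact: measurable_unit_cube.
  + by move=> x _ /=; rewrite -(stepf_comp _ h (g := g))// /g mulr0 mul0r.
  + apply: integrable_dspike => // [i|]; last exact: le_lt_trans smass_le (ltry _).
    rewrite /= /g !mulr_ge0// ?(ltW (sigma_gt0 _ _))//.
    by rewrite exprn_ge0// /logp le_max lexx.
exists (lim_sup_set A `\` U), Delta; split.
- exact: measurableD.
- by move=> x [/(_ 0%N Logic.I)[i _ [f _ [xc _]]] _]; exact: icube_sub.
(* Since the heights are at least 1, the measure of all the spikes is at most their total mass.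
   Almost every point being in the upper limit of the bad sets, at least half of the cube is
   left. *)
- have LU : (Leb U <= (2^-1)%:E)%E.
    apply: (le_trans (measure_sigma_subadditive _ _ mU (@subset_refl _ U))) => //.
      by move=> i; exact: measurable_spike.
    apply: le_trans mass_le; apply: lee_nneseries => i _ //.
    apply: (@le_trans _ _ (spike_density R q d.+1 e i)%:E).
      by rewrite le_eqVlt; apply/orP; left; apply/eqP; exact: lebesgue_spike.
    by rewrite lee_fin ler_peMl// ltW.
  have L0 : Leb (@icube R d.+1 `\` lim_sup_set A) = 0%E.
    apply: (@lebesgue_lim_sup_set_setD R q q1 d.+1 (scale e) _ A (fun i => bad_density R q d (w i))).
    + exact: leq_scale.
    + by move=> i; rewrite ltW// bad_density_gt0.
    + by move=> i; exact: bad_set_equidistributed.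
    + by move=> i; rewrite scaleS; exact: grid_union_bad_set.
    + exact: punb.
  rewrite lt0e measure_ge0 andbT; apply/eqP => B0.
  have : (Leb (@icube R d.+1) <= (2^-1)%:E)%E.
    apply: (@le_trans _ _ (Leb ((lim_sup_set A `\` U) `|` (@icube R d.+1 `\` lim_sup_set A) `|` U))).
      apply: le_measure; rewrite ?inE//.
        by do 2?apply: measurableU => //; exact: measurableD.
      move=> x xc; have [xU|xU] := pselect (U x); first by right.
      by left; have [xL|xL] := pselect (lim_sup_set A x); [left|right].
    apply: (le_trans (measureU2 _ _ _)) => //.
      by apply: measurableU; exact: measurableD.
    rewrite -[leRHS]add0e leeD//.
    apply: (le_trans (measureU2 _ _ _)); try exact: measurableD.
    by rewrite /= [X in (X + _)%E]B0 [X in (_ + X)%E]L0 adde0.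
  by rewrite [X in (X <= _)%E]lebesgue_icube lee_fin; lra.
- apply/cvgrPdist_lt => eps eps0.
  have [i iP] : exists i, (q%:R ^+ i)^-1 < eps.
    exists (Num.truncn eps^-1).+1; rewrite -ltf_pV2 ?posrE ?invr_gt0 ?exprn_gt0 ?ltr0n ?(ltnW q1)//.
    rewrite invrK (lt_trans (truncnS_gt _))// -natrX ltr_nat ltn_expl//.
  exists (block_start N i) => // n /= ni; rewrite sub0r normrN.
  have ji : (i <= scale e (J n))%N.
    exact: leq_trans (leq_block N0 ni) (leq_scale_id (J n)).
  have /andP[m0 mle] := @mesh_grid_partition R q q1 _ k k_gt0 (m n) i
    (fun mu => leq_trans ji (leq_addr _ _)).
  by rewrite ger0_norm// (le_lt_trans mle).
move=> x [Lx Ux]; apply: limn_esup_pinfty => K l.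
(* The term added to [K] absorbs the contribution of the later spikes, whose total mass is at most
   1/2. *)
have [i0 i0P] := lamP (K + 2^-1 * \prod_mu C mu).
have [i /= il [f _ [xc xf]]] := Lx (maxn i0 l) Logic.I.
pose s := index f (enum {ffun 'I_d -> 'I_(w i).+1}).
have sN : (s < N i)%N by rewrite /N cardE index_mem mem_enum.
exists (block_start N i + s)%N.
  rewrite (leq_trans _ (leq_addr _ _))// (leq_trans _ (leq_block_start N0 i))//.
  exact: leq_trans (leq_maxr _ _) il.
have -> : Delta (block_start N i + s)%N = grid_partition R q1 k_gt0
    (fun mu => scale e i + exponents f mu)%N.
  rewrite /Delta; congr grid_partition; apply/funext => mu.
  by rewrite /m /J blockD// block_posD// /a nth_index// mem_enum.
rewrite /spline_proj_ext phii lee_fin (le_trans _ (ler_norm _))//.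
apply: le_trans (spline_proj_spikes_ge q1 k_gt0 C0 Cle (fun mu => ltW (c0 mu)) cge h0 mass_le (i := i) xc _ _ _).
- rewrite lerBrDr big_split/= -expr_sum exponents_sum i0P//.
  exact: leq_trans (leq_maxl _ _) il.
- by move=> mu; rewrite (leq_ltn_trans (exponents_le f mu))// (leq_trans _ (we i))// addn2 ltnS.
- by move=> mu; have /andP[] := xf mu.
- by move=> j _ sj; apply: Ux; exists j.
Qed.

(** * Dimension one *)

Section equidistributed_integral.
Context (R : realType) (q : nat) (q_gt1 : (1 < q)%N) (d : nat).
Notation Leb := (lebesgue_tuple R d).
Notation cube := (unit_cube R d).

Lemma Rintegral_cube_indic (X : set (Rd R d)) : measurable X -> X `<=` cube ->
  Leb.-integrable cube (EFin \o (\1_X : Rd R d -> R)) /\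
  \int[Leb]_(y in cube) (\1_X y : R) = fine (Leb X).
Proof.
move=> mX Xc; have mc := @measurable_unit_cube R d.
split; last by rewrite /Rintegral integral_indic// setIidl.
apply: (bounded_integrable (C := 1)) => //.
- exact: lebesgue_unit_cube_lty.
- by move=> y _; rewrite indicE ger0_norm// lern1 leq_b1.
Qed.

(** On each grid cube [f] is within [omega] of its value at a sample point, and [A] fills the
    proportion [p] of the part of [V] there. The error [omega] is paid twice: bounding [f] from
    below on the intersection with [A] and from above on [V]. *)
Lemma equidistributed_Rintegral_ge n A (p : R) V (f : Rd R d -> R) (C omega : R) :
  equidistributed q n A p -> 0 <= p -> grid_union q n V ->
  measurable_fun setT f -> 0 <= C -> (forall y, V y -> `|f y| <= C) ->
  (forall y y', V y -> V y' ->
    (forall mu, digits q n (tnth y mu) = digits q n (tnth y' mu)) -> `|f y - f y'| <= omega) ->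
  p * (\int[Leb]_(y in cube) (f \_ V) y - 2 * omega * fine (Leb V)) <=
  \int[Leb]_(y in cube) (f \_ (V `&` A)) y.
Proof.
move=> [mA Ac HA] p0 VL mf C0 fC fomega; have mc := @measurable_unit_cube R d.
have mV := measurable_grid_union q_gt1 VL.
pose g (z : grid_index q d n) : set (Rd R d) := grid_cube q n (fun mu => z mu).
have mg z : measurable (g z) by exact: measurable_grid_cube.
have Vc : V `<=` @icube R d by exact: VL.1.
have gP y : @icube R d y -> exists z, g z y.
  move=> yc; exists [ffun mu => Ordinal (digits_lt q_gt1 n (yc mu))].
  by rewrite /g grid_cubeE//; split => // mu; rewrite ffunE.
have gdig y y' z : g z y -> g z y' ->
    forall mu, digits q n (tnth y mu) = digits q n (tnth y' mu).
  by rewrite /g grid_cubeE// => -[_ yz] [_ y'z] mu; rewrite yz y'z.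
have [t tP] : {t : grid_index q d n -> Rd R d &
    forall z, (exists y, V y /\ g z y) -> V (t z) /\ g z (t z)}.
  apply: (@choice _ _ (fun z y => (exists y, V y /\ g z y) -> V y /\ g z y)) => z.
  have [[y yP]|h] := pselect (exists y, V y /\ g z y); first by exists y.
  (* Cubes that do not meet [V] receive an arbitrary sample point. *)
  by exists [tuple 0 | _ < d] => /h.
pose F (a : grid_index q d n -> R) W y := \sum_z a z * \1_(W `&` g z) y : R.
have FE a W y z : W y -> g z y -> F a W y = a z.
  move=> Wy zy; rewrite /F (bigD1 z)//= indicE mem_set// mulr1 big1 ?addr0// => z' z'z.
  rewrite indicE memNset ?mulr0// => -[_ z'y]; case/eqP: z'z.
  by apply: (@grid_cubes_trivIset R q q_gt1 d n) => //; exists y.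
have Fout a W y : ~ W y -> F a W y = 0.
  by move=> Wy; rewrite /F big1// => z _; rewrite indicE memNset ?mulr0// => -[].
have FP a W : measurable W -> W `<=` @icube R d ->
    Leb.-integrable cube (EFin \o F a W) /\
    \int[Leb]_(y in cube) F a W y = \sum_z a z * fine (Leb (W `&` g z)).
  move=> mW Wc.
  have H z : Leb.-integrable cube (EFin \o (\1_(W `&` g z) : Rd R d -> R)) /\
      \int[Leb]_(y in cube) (\1_(W `&` g z) y : R) = fine (Leb (W `&` g z)).
    apply: Rintegral_cube_indic; first exact: measurableI.
    by move=> y [/Wc /icube_sub].
  have Hz z : Leb.-integrable cube (EFin \o (fun y => a z * \1_(W `&` g z) y)).
    by apply: eq_integrable (integrableZl mc (a z) (H z).1) => //.
  split.
    have Hs := integrable_sum mc (index_enum (grid_index q d n)) (P := xpredT)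
      (fun z _ => Hz z).
    by apply: eq_integrable Hs => // y _; rewrite /= /F sumEFin.
  rewrite Rintegral_sum//; apply: eq_bigr => z _.
  by rewrite RintegralZl ?(H z).2//; exact: (H z).1.
have fi W : measurable W -> W `<=` V -> Leb.-integrable cube (EFin \o (f \_ W)).
  move=> mW WV; apply: (bounded_integrable (C := C)) => //.
  - exact: lebesgue_unit_cube_lty.
  - by apply: measurable_funTS; apply/(measurable_restrictT _ mW); exact: measurable_funTS.
  - move=> y _; rewrite patchE; case: ifPn; first by rewrite inE => /WV/fC.
    by move=> _; rewrite normr0.
pose up z := f (t z) + omega; pose lo z := f (t z) - omega.
have mVA : measurable (V `&` A) by exact: measurableI.
have VAV : V `&` A `<=` V by move=> y [].
have VAc : V `&` A `<=` @icube R d by move=> y [/Vc].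
have [upi upE] := FP up V mV Vc; have [loi loE] := FP lo (V `&` A) mVA VAc.
have [onei oneE] := FP (fun=> 1) V mV Vc.
pose v z := fine (Leb (V `&` g z)).
have vE z : fine (Leb (V `&` A `&` g z)) = p * v z.
  have gu : grid_union q n (V `&` g z).
    apply: grid_unionI VL _; split; first by move=> y; rewrite /g grid_cubeE// => -[].
    move=> y y' yc y'c yy'; rewrite /g !grid_cubeE// => -[_ yz]; split => // mu.
    by rewrite -yy'.
  have E : Leb (V `&` A `&` g z) = (Leb (V `&` g z) * p%:E)%E by rewrite setIAC HA.
  move: (congr1 fine E); rewrite fineM ?[_ * p]mulrC//.
  rewrite ge0_fin_numE// (le_lt_trans _ (lebesgue_unit_cube_lty R d))//.
  apply: le_measure; rewrite ?inE//; first exact: measurableI.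
  by move=> y [/Vc/icube_sub].
have vV : \sum_z v z = fine (Leb V).
  under eq_bigr do rewrite -[v _]mul1r.
  rewrite -oneE -(Rintegral_cube_indic mV _).2; last by move=> y /Vc/icube_sub.
  apply: eq_Rintegral => y _; have [Vy|Vy] := pselect (V y).
    by have [z zy] := gP _ (Vc _ Vy); rewrite (FE _ _ _ z)// indicE mem_set.
  by rewrite Fout// indicE memNset.
apply: (@le_trans _ _ (\int[Leb]_(y in cube) F lo (V `&` A) y)); last first.
  apply: le_Rintegral => //; first exact: fi.
  move=> y _; rewrite patchE; case: ifPn; rewrite ?inE ?notin_setE => Wy.
    have [z zy] := gP _ (VAc _ Wy); rewrite (FE _ _ _ z)// /lo.
    have [Vt gt] := tP z (ex_intro _ y (conj (VAV _ Wy) zy)).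
    have := fomega _ _ Vt (VAV _ Wy) (gdig _ _ _ gt zy).
    by rewrite ler_norml => /andP[_]; lra.
  by rewrite Fout.
rewrite loE; under eq_bigr do rewrite vE mulrCA.
rewrite -mulr_sumr ler_wpM2l// lerBlDr.
have -> : \sum_z lo z * v z + 2 * omega * fine (Leb V) = \sum_z up z * v z.
  rewrite -vV mulr_sumr -big_split; apply: eq_bigr => z _ /=; rewrite /up /lo; ring.
rewrite -upE; apply: le_Rintegral => //; first exact: fi.
move=> y _; rewrite patchE; case: ifPn; rewrite ?inE ?notin_setE => Wy.
  have [z zy] := gP _ (Vc _ Wy); rewrite (FE _ _ _ z)// /up.
  have [Vt gt] := tP z (ex_intro _ y (conj Wy zy)).
  have := fomega _ _ Wy Vt (gdig _ _ _ zy gt).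
  by rewrite ler_norml => /andP[_]; lra.
by rewrite Fout.
Qed.

End equidistributed_integral.

(** * Contributions of the spikes to the projection inside one cell *)

Section spikes_in_cells.
Context (R : realType) (q : nat) (q_gt1 : (1 < q)%N) (d : nat) (k : 'I_d -> nat).
Context (k_gt0 : forall mu, (0 < k mu)%N).
Notation Leb := (lebesgue_tuple R d).
Notation cube := (unit_cube R d).
Notation half_cube := (@icube R d).

Let q_gt0 n : (0 < q ^ n)%N. Proof. by rewrite expn_gt0 (ltnW q_gt1). Qed.

Lemma Rintegral_grid_kernel m x : half_cube x ->
  \int[Leb]_(y in cube) grid_kernel q k m x y = 1.
Proof.
move=> xc; rewrite (Rintegral_unit_cube_prod
  (f := fun mu => uniform_kernel (k mu) (q ^ m mu) (tnth x mu))).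
  apply: big1 => mu _; have dq := digits_lt q_gt1 (m mu) (xc mu).
  by apply: (Rintegral_uniform_kernel (k_gt0 mu) (q_gt0 _) dq); rewrite in_cell_digits.
move=> mu; have dq := digits_lt q_gt1 (m mu) (xc mu).
have [C C0 CP] := uniform_kernel_bounded R (k mu) (q ^ m mu).
have lam01 : (@lebesgue_measure R `[0%R, 1%R] < +oo)%E.
  by rewrite lebesgue_measure_itv/= lte_fin ltr01 sube0 ltry.
apply: (@bounded_integrable _ _ _ _ _ _ ((q ^ m mu)%:R * C)) => //.
- exact: measurable_funTS (measurable_uniform_kernel (k_gt0 mu) (q_gt0 _) _).
- by move=> y _; apply: (CP _ _ _ dq); rewrite in_cell_digits.
Qed.

Context (C : 'I_d -> R) (C_ge0 : forall mu, 0 <= C mu).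
Hypothesis kernel_le : forall mu u v, 0 <= u <= 1 -> 0 <= v <= 1 ->
  `|bern_kernel (k mu) u v : R| <= C mu.
Context (e : nat -> nat) (n : nat) (x : Rd R d).
Hypothesis xc : half_cube x.
Hypothesis x_spikes : forall l, (l < n)%N -> ~ spike q e l x.
Notation rho := (spike_density R q d e).
Notation m := (fun=> scale e n).
Notation K := (grid_kernel q k m x).
Notation cell := (grid_cell q m x).
Let B := \prod_mu (q%:R ^+ scale e n * C mu).

Let B_ge0 : 0 <= B.
Proof. by apply: prodr_ge0 => mu _; rewrite mulr_ge0// exprn_ge0. Qed.

Let K_le y : `|K y| <= B.
Proof. exact: (grid_kernel_bounded q_gt1 C_ge0 kernel_le m y xc). Qed.

Let cellP : grid_union q (scale e n) cell.
Proof. exact: grid_union_grid_cell. Qed.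

Let r := fine (Leb cell).

Let B_r : B * r = \prod_mu C mu.
Proof.
rewrite /r /B; have := lebesgue_grid_cell q_gt1 m xc => /(congr1 fine)/= ->.
rewrite -big_split; apply: eq_bigr => mu _ /=.
by field; rewrite gt_eqF// exprn_gt0// ltr0n ltnW.
Qed.

Let Leb_cell : Leb cell = r%:E.
Proof. by rewrite /r (lebesgue_grid_cell q_gt1 m xc). Qed.

(** Spikes of index below [n] are unions of cubes of the grid, so one that met the cell would
    contain [x]. *)
Let cell_spike l y : cell y -> spike q e l y -> (n <= l)%N.
Proof.
move=> [yc yx] sy; rewrite leqNgt; apply/negP => ln; apply: (x_spikes ln).
have [_ H] := @grid_union_spike R q q_gt1 d e _ _ ln.
by apply: H sy.
Qed.

Let mcell : measurable cell.
Proof. exact: measurable_grid_union cellP. Qed.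

Let cell_cube : cell `<=` cube. Proof. by move=> y [/icube_sub]. Qed.

Let fine_cell_spike l : (n <= l)%N -> fine (Leb (cell `&` spike q e l)) = r * rho l.
Proof.
move=> nl; have [_ _ H] := spike_equidistributed R q_gt1 d e l.
have E : Leb (cell `&` spike q e l) = (r * rho l)%:E.
  by rewrite EFinM -Leb_cell H//; apply: grid_unionW cellP => //; exact: leq_scale.
by move: (congr1 fine E).
Qed.

(* At the scale of spike [i] the kernel is constant up to [omega], so that the
   equidistributed spike sees its mean, which is 1 on the whole cell. *)
Lemma Rintegral_kernel_dspike_ge i (omega : R) : (n <= i)%N ->
  (forall y y', cell y -> cell y' ->
    (forall mu, digits q (scale e i) (tnth y mu) = digits q (scale e i) (tnth y' mu)) ->
    `|K y - K y'| <= omega) ->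
  0 <= omega ->
  rho i * (1 - (\prod_mu C mu) * \sum_(n <= l < i) rho l - 2 * omega * r) <=
  \int[Leb]_(y in cube) (K \_ (cell `&` @dspike R q d e i)) y.
Proof.
move=> ni Komega omega0; have mc := @measurable_unit_cube R d.
pose V := cell `\` \bigcup_(l in [set l | (l < i)%N]) spike q e l.
have VL : grid_union q (scale e i) V.
  apply: grid_unionD; first by apply: grid_unionW cellP => //; exact: leq_scale.
  by apply: grid_union_bigcup => l /= li; exact: grid_union_spike.
have mV := measurable_grid_union q_gt1 VL.
have Vcell : V `<=` cell by move=> y [].
have -> : cell `&` @dspike R q d e i = V `&` spike q e i.
  apply/seteqP; split => y.
    move=> [yc /dspikeE[ys yl]]; split => //; split => // -[l /= li]; exact: yl.
  move=> [[yc yl] ys]; split => //; apply/dspikeE; split => // l li sl.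
  by apply: yl; exists l.
have mK := measurable_grid_kernel q_gt1 k_gt0 m x.
apply: le_trans (equidistributed_Rintegral_ge q_gt1 (spike_equidistributed R q_gt1 d e i)
  (ltW (spike_density_gt0 R q_gt1 d e i)) VL mK B_ge0 (fun y _ => K_le y)
  (fun y y' Vy Vy' => Komega y y' (Vcell _ Vy) (Vcell _ Vy'))).
rewrite ler_wpM2l ?(ltW (spike_density_gt0 R q_gt1 d e i))//.
have Vr : fine (Leb V) <= r.
  rewrite -lee_fin -Leb_cell fineK; first by rewrite le_measure ?inE.
  rewrite ge0_fin_numE// (@le_lt_trans _ _ (Leb cell))// ?Leb_cell ?ltry//.
  by rewrite -Leb_cell le_measure ?inE.
apply: lerB; last by rewrite ler_wpM2l// mulr_ge0.
(* A null set, where some coordinate is 1; the vanishing of the kernel off the cell is only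
   available on [half_cube], so the bound [B] is used here. *)
pose Z := cube `\` half_cube.
have mI : measurable half_cube.
  exact: (measurable_grid_union q_gt1 (@grid_union_icube R q d 0)).
have mZ : measurable Z by exact: measurableD.
have Z0 : Leb Z = 0%E.
  have -> : Leb Z = (Leb cube - Leb (cube `&` half_cube))%E.
    by apply: measureD => //; exact: lebesgue_unit_cube_lty.
  rewrite setIidr; last exact: icube_sub.
  by rewrite [X in (X - _)%E]lebesgue_unit_cube [X in (_ - X)%E]lebesgue_icube subee.
have indic X : measurable X -> X `<=` cube ->
    Leb.-integrable cube (EFin \o (fun y => B * \1_X y)) /\
    \int[Leb]_(y in cube) (B * \1_X y) = B * fine (Leb X).
  move=> mX Xc; have [H1 H2] := Rintegral_cube_indic mX Xc.
  by split; [apply: eq_integrable (integrableZl mc B H1) => //|rewrite RintegralZl// H2].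
have [Zi ZE] := indic Z mZ (@subDsetl _ _ _).
have mS l : measurable (cell `&` spike q e l) by apply: measurableI => //; exact: measurable_spike.
have SC l : cell `&` spike q e l `<=` cube by move=> y [/cell_cube].
have [Si SE] := (fun l => (indic _ (mS l) (SC l)).1, fun l => (indic _ (mS l) (SC l)).2).
(* On the part of the cell that is removed from [V], at least one summand equals [B], so [K - S] is
   at most 0 there. Subtracting [S] from the kernel thus bounds its restriction to [V] from
   below. *)
pose S y := \sum_(l <- index_iota n i) B * \1_(cell `&` spike q e l) y.
have Sint : \int[Leb]_(y in cube) S y = (\prod_mu C mu) * \sum_(n <= l < i) rho l.
  rewrite Rintegral_sum// mulr_sumr big_seq [RHS]big_seq; apply: eq_bigr => l.
  by rewrite mem_index_iota => /andP[nl _]; rewrite SE fine_cell_spike// -B_r; ring.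
have Sintg : Leb.-integrable cube (EFin \o S).
  have H := integrable_sum mc (index_iota n i) (P := xpredT) (fun l _ => Si l).
  by apply: eq_integrable H => // y _; rewrite /= /S sumEFin.
have KVi : Leb.-integrable cube (EFin \o (K \_ V)).
  apply: (bounded_integrable (C := B)) => //.
  - exact: lebesgue_unit_cube_lty.
  - by apply: measurable_funTS; apply/(measurable_restrictT _ mV); exact: measurable_funTS.
  - by move=> y _; rewrite patchE; case: ifPn => // _; rewrite normr0.
have Ki : Leb.-integrable cube (EFin \o K).
  apply: (bounded_integrable (C := B)) => //; first exact: lebesgue_unit_cube_lty.
  exact: measurable_funTS.
have KSZ : Leb.-integrable cube (EFin \o (fun y => K y - S y - B * \1_Z y)).
  apply: eq_integrable (integrableB mc (integrableB mc Ki Sintg) Zi) => //.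
have KS : Leb.-integrable cube (EFin \o (fun y => K y - S y)).
  apply: eq_integrable (integrableB mc Ki Sintg) => //.
apply: (@le_trans _ _ (\int[Leb]_(y in cube) (K y - S y - B * \1_Z y))).
  rewrite RintegralB// RintegralB// Sint Rintegral_grid_kernel// ZE.
  have -> : fine (Leb Z) = 0 by move: (congr1 fine Z0).
  by rewrite mulr0 subr0.
apply: le_Rintegral => // y yc.
have S0 : 0 <= S y by apply: sumr_ge0 => l _; rewrite mulr_ge0.
have Z1 : 0 <= B * \1_Z y by rewrite mulr_ge0.
have KB : K y <= B by apply: le_trans (K_le y); exact: ler_norm.
rewrite patchE; case: ifPn; rewrite ?inE ?notin_setE => Vy; first by lra.
change (K y - S y - B * \1_Z y <= 0).
have [yh|yh] := pselect (half_cube y); last first.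
  by rewrite [\1_Z y]indicE mem_set// mulr1; lra.
have [yx|yx] := pselect (cell y); last by rewrite (grid_kernel_out q_gt1 k xc yh yx); lra.
have [l li sl] : exists2 l, (l < i)%N & spike q e l y.
  apply: contrapT => h; apply: Vy; split => // -[l /= li sl]; apply: h; by exists l.
have : B <= S y; last by lra.
rewrite /S (bigD1_seq l)/= ?iota_uniq// ?mem_index_iota ?li ?(cell_spike yx sl)//.
rewrite indicE mem_set// mulr1 lerDl; apply: sumr_ge0 => l' _; by rewrite mulr_ge0.
Qed.

(** Spikes with index between [i0] and [i1] contribute through the lower bound on the kernel
    integrals. Those below [n] miss the cell, and all others are bounded by their mass times the
    supremum of the kernel, which gives the term with [S]. *)
Lemma spline_proj_dspikes_ge (c : nat -> R) (S : R) (i0 i1 : nat) : (forall i, 0 <= c i) ->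
  (\sum_(i <oo) (c i * rho i)%:E < +oo)%E -> (n <= i0)%N ->
  (\sum_(i <oo) ((if (i0 <= i < i1)%N then 0 else c i) * rho i)%:E <= S%:E)%E ->
  (forall i, (i0 <= i)%N ->
    rho i / 2 <= \int[Leb]_(y in cube) (K \_ (cell `&` @dspike R q d e i)) y) ->
  \sum_(i0 <= i < i1) c i * (rho i / 2) - (\prod_mu C mu) * S <=
  spline_proj (grid_partition R q_gt1 k_gt0 m) (stepf (@dspike R q d e) c) x.
Proof.
move=> c0 coo ni0 hS cellge; have mc := @measurable_unit_cube R d.
have fi := integrable_dspike q_gt1 c0 coo.
rewrite spline_proj_grid//.
have tD := @dspike_trivIset R q d e.
have mD := @measurable_dspike R q q_gt1 d e.
have rho0 i : 0 <= rho i by rewrite ltW// spike_density_gt0.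
pose b i := if (n <= i)%N && ~~ (i0 <= i < i1)%N then c i else 0.
have b0 i : 0 <= b i by rewrite /b; case: ifP.
have bS : (\sum_(i <oo) (b i * rho i)%:E <= S%:E)%E.
  apply: le_trans hS; apply: lee_nneseries => i _; rewrite lee_fin ?mulr_ge0//.
  by rewrite ler_wpM2r// /b; case: (n <= i)%N; case: (i0 <= i < i1)%N => //=.
pose psi := stepf (@dspike R q d e) b.
have psii : Leb.-integrable cube (EFin \o psi).
  by apply: (integrable_dspike q_gt1 b0); exact: le_lt_trans bS (ltry _).
have psicell : Leb.-integrable cube (EFin \o (psi \_ cell)).
  rewrite -restrict_EFin; apply/(integrable_restrict _ mcell mc).
  by apply: integrableS psii => //; exact: measurableI.
have intpsi : \int[Leb]_(y in cube) (psi \_ cell) y <= r * S.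
  rewrite -Rintegral_mkcondr setIidr//.
  have H := integral_dspike_le q_gt1 (c := b) (n := n) b0.
  have /H {}H : forall l, (l < n)%N -> b l = 0 by move=> l ln; rewrite /b leqNgt ln.
  have {}H := H _ _ _ cellP.
  rewrite -lee_fin /Rintegral fineK; last first.
    by apply: integrable_fin_num => //; apply: integrableS psii.
  by apply: (le_trans H); rewrite Leb_cell EFinM lee_wpmul2l// lee_fin fine_ge0.
have mK := measurable_grid_kernel q_gt1 k_gt0 m x.
pose G i := K \_ (cell `&` @dspike R q d e i).
have Gi i : Leb.-integrable cube (EFin \o G i).
  have mX : measurable (cell `&` @dspike R q d e i) by exact: measurableI.
  apply: (bounded_integrable (C := B)) => //.
  - exact: lebesgue_unit_cube_lty.
  - by apply: measurable_funTS; apply/(measurable_restrictT _ mX); exact: measurable_funTS.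
  - by move=> y _; rewrite /G patchE; case: ifPn => // _; rewrite normr0.
have cGi i : Leb.-integrable cube (EFin \o (fun y => c i * G i y)).
  by apply: eq_integrable (integrableZl mc (c i) (Gi i)) => //.
pose T y := \sum_(i <- index_iota i0 i1) c i * G i y.
have Ti : Leb.-integrable cube (EFin \o T).
  have H := integrable_sum mc (index_iota i0 i1) (P := xpredT) (fun i _ => cGi i).
  by apply: eq_integrable H => // y _; rewrite /= /T sumEFin.
have Bpsi : Leb.-integrable cube (EFin \o (fun y => B * (psi \_ cell) y)).
  by apply: eq_integrable (integrableZl mc B psicell) => //.
have TBi : Leb.-integrable cube (EFin \o (fun y => T y - B * (psi \_ cell) y)).
  by apply: eq_integrable (integrableB mc Ti Bpsi) => //.
apply: (@le_trans _ _ (\int[Leb]_(y in cube) (T y - B * (psi \_ cell) y))).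
  rewrite RintegralB// RintegralZl//; apply: lerB; last by rewrite -B_r -mulrA ler_wpM2l.
  rewrite Rintegral_sum// big_seq [leRHS]big_seq; apply: ler_sum => i.
  rewrite mem_index_iota => /andP[i0i _]; rewrite RintegralZl//.
  by rewrite ler_wpM2l// cellge.
apply: le_Rintegral => //; first exact: integrable_mul_grid_kernel.
have T0 y : (forall i, ~ (cell y /\ @dspike R q d e i y)) -> T y = 0.
  by move=> h; rewrite /T big1// => i _; rewrite /G patchE memNset ?mulr0//; exact: h.
move=> y yc.
have [yx|yx] := pselect (cell y); last first.
  rewrite T0; last by move=> i [].
  rewrite patchE memNset// mulr0 subr0.
  have [yh|yh] := pselect (half_cube y); first by rewrite grid_kernel_out// mulr0.
  by rewrite stepf_dspike_out// mul0r.
rewrite patchE mem_set//.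
have [[l yl]|nol] := pselect (exists l, @dspike R q d e l y); last first.
  rewrite T0 => [|i [_ yi]]; last by apply: nol; exists i.
  by rewrite /psi !stepf_out ?mulr0 ?mul0r ?subr0// => i yi; apply: nol; exists i.
have nl := cell_spike yx (dspike_sub yl).
rewrite /psi !(stepf_in _ tD yl) /b nl/=.
have Gl i : i != l -> G i y = 0.
  move=> il; rewrite /G patchE memNset// => -[_ yi]; case/eqP: il.
  by apply: tD => //; exists y.
have [il|il] := boolP (i0 <= l < i1)%N.
  rewrite mulr0 subr0 /T (bigD1_seq l)/= ?iota_uniq// ?mem_index_iota//.
  rewrite big1 ?addr0 => [|i il']; last by rewrite Gl// mulr0.
  by rewrite /G patchE mem_set.
have -> : T y = 0.
  rewrite /T big_seq big1// => i; rewrite mem_index_iota => ii; rewrite Gl ?mulr0//.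
  by apply: contraNneq il => <-.
rewrite sub0r mulrC -mulrN ler_wpM2l// lerNl (le_trans _ (K_le y))//.
by rewrite -normrN ler_norm.
Qed.

End spikes_in_cells.

(** The first factor is the scaling of the kernel; [q%:R ^+ s / q%:R ^+ N] is the side of a fine
    cell measured in coarse cells. The bound tends to 0 with [N] for fixed [s]. *)
Lemma grid_kernel_lipschitz (R : realType) (q : nat) (q_gt1 : (1 < q)%N) (k : 'I_1 -> nat)
    (L : R) s N x y y' : 0 <= L ->
  (forall u v v' : R, 0 <= u <= 1 -> 0 <= v <= 1 -> 0 <= v' <= 1 ->
    `|bern_kernel (k ord0) u v - bern_kernel (k ord0) u v'| <= L * `|v - v'|) ->
  @icube R 1 x -> grid_cell q (fun=> s) x y -> grid_cell q (fun=> s) x y' ->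
  (forall mu, digits q N (tnth y mu) = digits q N (tnth y' mu)) ->
  `|grid_kernel q k (fun=> s) x y - grid_kernel q k (fun=> s) x y'| <=
  q%:R ^+ s * (L * (q%:R ^+ s / q%:R ^+ N)).
Proof.
move=> L0 LP xc yx y'x yy'; rewrite !grid_kernel_in// !big_ord1 -mulrBr.
have qn n : 0 < q%:R ^+ n :> R by rewrite exprn_gt0// ltr0n ltnW.
have d01 z : @icube R 1 z ->
    0 <= q%:R ^+ s * tnth z ord0 - (digits q s (tnth z ord0))%:R <= 1.
  move=> /(_ ord0)/andP[z0 _]; have /andP[h1 h2] := digits_itv q_gt1 s z0.
  move: h1 h2; rewrite ler_pdivrMr// ltr_pdivlMr// -natr1 => h1 h2.
  by rewrite subr_ge0 mulrC h1/= lerBlDr addrC ltW.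
rewrite normrM ger0_norm ?(ltW (qn _))// ler_wpM2l ?(ltW (qn _))//.
apply: (le_trans (LP _ _ _ (d01 _ xc) (d01 _ yx.1) (d01 _ y'x.1))).
rewrite ler_wpM2l// yx.2 y'x.2.
have -> : q%:R ^+ s * tnth y ord0 - (digits q s (tnth x ord0))%:R -
    (q%:R ^+ s * tnth y' ord0 - (digits q s (tnth x ord0))%:R) =
    q%:R ^+ s * (tnth y ord0 - tnth y' ord0) by ring.
rewrite normrM ger0_norm ?(ltW (qn _))// ler_wpM2l ?(ltW (qn _))//.
have /andP[y0 _] := yx.1 ord0; have /andP[y'0 _] := y'x.1 ord0.
have := digits_itv q_gt1 N y0; have := digits_itv q_gt1 N y'0; rewrite yy'.
rewrite -natr1 mulrDl mul1r => /andP[h1 h2] /andP[h3 h4].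
by rewrite ler_norml; apply/andP; split; lra.
Qed.

Lemma sum_half_pow_le1 (R : realType) n : \sum_(i < n) (2 ^+ i.+1)^-1 <= 1 :> R.
Proof.
have -> : \sum_(i < n) (2 ^+ i.+1)^-1 = 1 - (2 ^+ n)^-1 :> R.
  elim: n => [|n IH]; first by rewrite big_ord0 expr0 invr1 subrr.
  rewrite big_ord_recr/= IH exprS invfM.
  by set z := (2 ^+ n)^-1; lra.
by rewrite gerBl invr_ge0 exprn_ge0.
Qed.

(** The exponent [e i] is the integer part of the logarithm of [h i] in base [q], which makes the
    mass of order 1. Smallness of [sigma (h i)] then gives condition (i). The last inequality holds
    for large heights; it bounds by 1/4 both the measure of all the spikes and its multiple by [C],
    and controls the truncated spikes through the factor [2 ^+ i]. *)
Lemma spike_sequence1 (R : realType) (q : nat) (q_gt1 : (1 < q)%N) (sigma : R -> R)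
    (sigma_liminf : limf_einf (fun t => (sigma t)%:E) +oo = 0%E) (C : R) : 0 <= C ->
  exists (h : nat -> R) (e : nat -> nat), forall i,
  [/\ 0 <= h i, (0 < e i)%N, 1 <= h i * spike_density R q 1 e i <= q%:R,
      sigma (h i) <= (2 ^+ i.+1)^-1 &
      (1 + C) * 4 * 2 ^+ i * spike_density R q 1 e i <= (2 ^+ i.+1)^-1].
Proof.
move=> C0; have q0 : 0 < q%:R :> R by rewrite ltr0n ltnW.
have q1 : 1 <= q%:R :> R by rewrite ler1n ltnW.
pose P i (x : R * nat) := let: (h, e) := x in
  [/\ 0 <= h, (0 < e)%N, 1 <= h * spike_density R q 1 (fun=> e) i <= q%:R,
      sigma h <= (2 ^+ i.+1)^-1 &
      (1 + C) * 4 * 2 ^+ i * spike_density R q 1 (fun=> e) i <= (2 ^+ i.+1)^-1].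
have [f fP] : {f : nat -> R * nat & forall i, P i (f i)}; last first.
  exists (fun i => (f i).1), (fun i => (f i).2) => i.
  by have := fP i; rewrite /P /spike_density; case: (f i).
apply: (@choice _ _ P) => i.
(* The density is less than [q / h], so [h > q * D] makes it at most the inverse of [D]. *)
pose D : R := (1 + C) * 4 * 2 ^+ i * 2 ^+ i.+1.
have two n : 1 <= 2 ^+ n :> R by rewrite exprn_ege1// ler1n.
have D1 : 1 <= D by rewrite /D !mulr_ege1//; lra.
have eps0 : 0 < (2 ^+ i.+1)^-1 :> R by rewrite invr_gt0 exprn_gt0.
have [h Th sh] := limf_einf0_small sigma_liminf (q%:R * D) eps0.
have qh : q%:R < h by rewrite (le_lt_trans _ Th)// ler_peMr// ltW.
have h1 : 1 <= h by rewrite (le_trans q1)// ltW.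
have [e /andP[eh he]] := exp_between q_gt1 h1.
have h0 : 0 < h by rewrite (lt_le_trans _ h1).
have qe0 : 0 < q%:R ^+ e :> R by rewrite exprn_gt0.
exists (h, e); rewrite /P /spike_density muln1; split => //; last 2 first.
- exact: ltW.
- rewrite ler_pdivrMr// [leRHS]mulrC ler_pdivlMr ?exprn_gt0//.
  rewrite -(ler_pM2l q0) -exprS -/D; apply: ltW; exact: lt_trans he.
- exact: ltW.
- have := lt_trans qh he; rewrite -{1}[q%:R]expr1 ltr_eXn2l//.
  by rewrite ltr1n.
rewrite ler_pdivlMr// mul1r eh/= ler_pdivrMr// -exprS; exact: ltW.
Qed.

Lemma divergent_example_1 (R : realType) (k : 'I_1 -> nat) (k_gt0 : forall mu, (0 < k mu)%N)
    (sigma : R -> R) (sigma_gt0 : forall t, 0 <= t -> 0 < sigma t)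
    (sigma_liminf : limf_einf (fun t => (sigma t)%:E) +oo = 0%E) :
  divergent_example k sigma.
Proof.
have [q [_ [C [q1 _ C0 Cle _]]]] := kernel_constants R k_gt0.
have [L L0 LP] := bern_kernel_lipschitz R (k ord0).
pose Cc := \prod_mu C mu; have Cc0 : 0 <= Cc by apply: prodr_ge0 => mu _.
have [h [e heP]] := spike_sequence1 q1 sigma_liminf Cc0.
have h0 i : 0 <= h i by have [] := heP i.
pose rho i := spike_density R q 1 e i.
have rho0 i : 0 < rho i by exact: spike_density_gt0.
have rho2 i : 2 ^+ i * rho i <= (2 ^+ i.+1)^-1.
  have [_ _ _ _] := heP i; apply: le_trans; rewrite -/(rho i) -[leRHS]mulrA.
  rewrite ler_peMl ?mulr_ge0 ?exprn_ge0// ?(ltW (rho0 i))//; move: Cc0; rewrite -/Cc; lra.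
have rhoC i : (1 + Cc) * rho i <= (2 ^+ i.+1)^-1 / 4.
  have [_ _ _ _ H] := heP i; rewrite ler_pdivlMr//; apply: le_trans H.
  rewrite -/(rho i) -/Cc mulrAC -[leRHS]mulrA ler_wpM2l//; first by move: Cc0; lra.
  by rewrite ler_peMl ?(ltW (rho0 i))// exprn_ege1// ler1n.
have rhole i : rho i <= (2 ^+ i.+1)^-1 / 4.
  apply: le_trans (rhoC i); rewrite ler_peMl ?(ltW (rho0 i))//; move: Cc0; lra.
have half0 i : 0 <= (2 ^+ i.+1)^-1 :> R by rewrite invr_ge0 exprn_ge0.
pose Leb := lebesgue_tuple R 1.
pose phi := stepf (@dspike R q 1 e) h.
pose U := \bigcup_i @spike R q 1 e i.
pose Delta n : multipartition R k := grid_partition R q1 k_gt0 (fun=> scale e n).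
have tD := @dspike_trivIset R q 1 e.
have mD := @measurable_dspike R q q1 1 e.
have mU : measurable U by apply: bigcupT_measurable => i; exact: measurable_spike.
have mI : measurable (@icube R 1).
  exact: (measurable_grid_union q1 (@grid_union_icube R q 1 0)).
have mc := @measurable_unit_cube R 1.
have leq_scale_id i : (i <= scale e i)%N.
  elim: i => // i IH; rewrite scaleS -addn1 leq_add//.
  by have [] := heP i.
have qn n : 0 < q%:R ^+ n :> R by rewrite exprn_gt0// ltr0n ltnW.
have small_pow (eps : R) : 0 < eps -> exists i, (q%:R ^+ i)^-1 < eps.
  move=> eps0; exists (Num.truncn eps^-1).+1; rewrite -ltf_pV2 ?posrE ?invr_gt0 ?exprn_gt0 ?ltr0n ?(ltnW q1)//.
  by rewrite invrK (lt_trans (truncnS_gt _))// -natrX ltr_nat ltn_expl.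
pose trunc (m : nat) i := Num.min (h i) m%:R.
have trunc0 m i : 0 <= trunc m i by rewrite /trunc le_min h0/=.
have truncE m : (fun y => Num.min (phi y) m%:R) = stepf (@dspike R q 1 e) (trunc m).
  apply/funext => y; rewrite (stepf_comp _ h (g := fun t => Num.min t m%:R))//.
  by rewrite min_l.
have truncoo m : (\sum_(i <oo) (trunc m i * rho i)%:E < +oo)%E.
  apply: (@le_lt_trans _ _ (m%:R%:E : \bar R)); last exact: ltry.
  apply: nneseries_le_bound => [i|n]; first by rewrite mulr_ge0// ltW.
  rewrite -[leRHS]mulr1; apply: le_trans (ler_wpM2l _ (sum_half_pow_le1 R n)) => //.
  rewrite mulr_sumr; apply: ler_sum => i _; apply: ler_pM => //; first exact: ltW.
    by rewrite /trunc ge_min lexx orbT.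
  by apply: (le_trans (rhole i)); have := half0 i; lra.
have diverges x n : @icube R 1 x -> ~ U x -> forall K : R, exists M, forall m : nat, (M <= m)%N ->
    K <= spline_proj (Delta n) (fun y => Num.min (phi y) m%:R) x.
  move=> xc xU K.
  have xs l : (l < n)%N -> ~ spike q e l x by move=> _ sl; apply: xU; exists l.
  set s := scale e n; pose Lq := L * q%:R ^+ s.
  have Lq0 : 0 <= Lq by rewrite mulr_ge0// ltW.
  (* From the index [I0] on, the oscillation of the kernel on the cubes of the spike costs at most
     1/4. The earlier spikes cost another 1/4, which leaves at least half of the mean 1. *)
  have [I0 I0P] : exists i, (q%:R ^+ i)^-1 < (8 * (Lq + 1))^-1.
    by apply: small_pow; rewrite invr_gt0; lra.
  pose I := maxn n I0; have nI : (n <= I)%N by exact: leq_maxl.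
  have cellge i : (I <= i)%N -> rho i / 2 <= \int[Leb]_(y in unit_cube R 1)
      (grid_kernel q k (fun=> s) x \_ (grid_cell q (fun=> s) x `&` @dspike R q 1 e i)) y.
    move=> Ii; have ni : (n <= i)%N by exact: leq_trans Ii.
    pose omega := q%:R ^+ s * (L * (q%:R ^+ s / q%:R ^+ scale e i)).
    have omega0 : 0 <= omega by rewrite !mulr_ge0// ?invr_ge0 ltW.
    have := Rintegral_kernel_dspike_ge q1 k_gt0 C0 Cle xc xs ni
      (fun y y' => @grid_kernel_lipschitz R q q1 k L s (scale e i) x y y' L0 LP xc) omega0.
    apply: le_trans; rewrite ler_wpM2l ?(ltW (rho0 i))//.
    have -> : fine (Leb (grid_cell q (fun=> s) x)) = (q%:R ^+ s)^-1.
      by have := lebesgue_grid_cell q1 (fun=> s) xc => /(congr1 fine)/=; rewrite big_ord1.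
    have sum_le : Cc * \sum_(n <= l < i) rho l <= 1 / 4.
      apply: (@le_trans _ _ (Cc * \sum_(l < i) rho l)).
        rewrite ler_wpM2l// -(big_mkord xpredT rho) [leRHS](big_cat_nat (n := n))//=.
        by rewrite lerDr sumr_ge0// => l _; exact: ltW.
      apply: (@le_trans _ _ (\sum_(l < i) (2 ^+ l.+1)^-1 / 4)).
        rewrite mulr_sumr; apply: ler_sum => l _; apply: le_trans (rhoC l).
        by rewrite ler_wpM2r ?(ltW (rho0 l))// lerDr.
      by rewrite -mulr_suml ler_wpM2r// sum_half_pow_le1.
    have om : 2 * omega * (q%:R ^+ s)^-1 <= 1 / 4.
      have -> : 2 * omega * (q%:R ^+ s)^-1 = 2 * Lq * (q%:R ^+ scale e i)^-1.
        by rewrite /omega /Lq; field; rewrite !gt_eqF.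
      apply: (@le_trans _ _ (2 * Lq * (8 * (Lq + 1))^-1)).
        rewrite ler_wpM2l ?mulr_ge0// (le_trans _ (ltW I0P))// lef_pV2 ?posrE//.
        rewrite ler_weXn2l ?ler1n ?(ltnW q1)// (leq_trans _ (leq_scale_id i))//.
        by rewrite (leq_trans _ Ii)// leq_maxr.
      by rewrite ler_pdivrMr; lra.
    by change (2^-1 <= 1 - Cc * \sum_(n <= l < i) rho l - 2 * omega * (q%:R ^+ s)^-1); lra.
  (* [S] bounds the mass outside the range from [I] to [I']. Each index below [I] contributes at
     most [q], hence at most [q * 2 ^+ I] times 2^-(i + 1). An index [i] from [I'] on has truncated
     height at most [m <= 2 ^+ i], hence mass at most 2^-(i + 1). *)
  pose S : R := q%:R * 2 ^+ I + 1.
  (* Each of the [T] spikes from [I] on contributes at least 1/2. *)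
  pose T := (Num.truncn (2 * (K + Cc * S))).+1.
  (* Beyond this level none of the first [I + T] heights is truncated. *)
  exists (\sum_(i < I + T) (Num.truncn (h i)).+1)%N => m Mm.
  have hm i : (i < I + T)%N -> trunc m i = h i.
    move=> iT; apply: min_l; apply: (le_trans (ltW (truncnS_gt _))); rewrite ler_nat.
    by apply: leq_trans Mm; rewrite (bigD1 (Ordinal iT))//= leq_addr.
  pose I' := maxn (I + T) m.
  have hS : (\sum_(i <oo) ((if (I <= i < I')%N then 0 else trunc m i) * rho i)%:E <= S%:E)%E.
    apply: nneseries_le_bound => [i|N]; first by rewrite mulr_ge0 ?(ltW (rho0 _))//; case: ifP.
    have S0 : 0 <= S by rewrite addr_ge0// mulr_ge0// exprn_ge0.
    rewrite -[leRHS]mulr1; apply: le_trans (ler_wpM2l S0 (sum_half_pow_le1 R N)).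
    rewrite mulr_sumr; apply: ler_sum => i _.
    case: ifPn => [_|]; first by rewrite mul0r mulr_ge0.
    rewrite negb_and -ltnNge -leqNgt mulrDl mul1r => /orP[iI|iI'].
      rewrite (@le_trans _ _ q%:R)//.
        have [_ _ /andP[_ +] _ _] := heP i; apply: le_trans.
        by rewrite ler_wpM2r ?(ltW (rho0 i))// ge_min lexx.
      apply: (@le_trans _ _ (q%:R * 2 ^+ I * (2 ^+ i.+1)^-1)); last by rewrite lerDl.
      rewrite -mulrA ler_peMr// ler_pdivlMr ?exprn_gt0// mul1r.
      by rewrite ler_weXn2l// ler1n.
    apply: (@le_trans _ _ (2 ^+ i.+1)^-1); last by rewrite lerDr !mulr_ge0// exprn_ge0.
    apply: le_trans (rho2 i); rewrite ler_wpM2r ?(ltW (rho0 i))// ge_min; apply/orP; right.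
    rewrite -natrX ler_nat (leq_trans _ (ltnW (ltn_expl i (leqnn 2))))//.
    exact: leq_trans (leq_maxr _ _) iI'.
  rewrite truncE; apply: le_trans (spline_proj_dspikes_ge q1 k_gt0 C0 Cle xc xs (trunc0 m)
    (truncoo m) nI hS cellge).
  rewrite -/Cc lerBrDr; apply: (@le_trans _ _ (\sum_(I <= i < I + T) 2^-1)).
    rewrite sumr_const_nat addKn -mulr_natr.
    by have := truncnS_gt (2 * (K + Cc * S)); rewrite -/T; lra.
  rewrite [leRHS](big_cat_nat (n := (I + T)%N)) ?leq_addr ?leq_maxl//=.
  rewrite -[leLHS]addr0; apply: lerD; last first.
    by apply: sumr_ge0 => i _; rewrite mulr_ge0// divr_ge0// ltW.
  rewrite big_seq [leRHS]big_seq; apply: ler_sum => i; rewrite mem_index_iota => /andP[_ iT].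
  rewrite hm// mulrA -[leLHS]mul1r ler_wpM2r//.
  by have [_ _ /andP[]] := heP i.
exists phi; split => //.
- by move=> x _; exact: stepf_ge0.
- exact: measurable_funTS (measurable_stepf h tD mD).
- pose g t := sigma t * t * logp t ^+ 0.
  apply: (eq_integrable _ (EFin \o stepf (@dspike R q 1 e) (g \o h))) => //.
  + by move=> x _ /=; rewrite -(stepf_comp _ h (g := g))// /g mulr0 mul0r.
  have gE i : g (h i) = sigma (h i) * h i by rewrite /g expr0 mulr1.
  have g0 i : 0 <= g (h i) by rewrite gE mulr_ge0// ltW// sigma_gt0.
  apply: integrable_dspike => //.
  apply: (@le_lt_trans _ _ (q%:R%:E : \bar R)); last exact: ltry.
  apply: nneseries_le_bound => [i|n]; first exact: mulr_ge0 (g0 i) (ltW (rho0 i)).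
  rewrite -[leRHS]mulr1; apply: le_trans (ler_wpM2l _ (sum_half_pow_le1 R n)) => //.
  rewrite mulr_sumr; apply: ler_sum => i _; have [_ _ /andP[_ hq] sh _] := heP i.
  rewrite /= gE -mulrA mulrC; apply: ler_pM => //; first by rewrite mulr_ge0// ltW.
  by rewrite ltW// sigma_gt0.
exists (@icube R 1 `\` U), Delta; split.
- exact: measurableD.
- by move=> x [/icube_sub].
- have LU : (Leb U <= (2^-1)%:E)%E.
    apply: (le_trans (measure_sigma_subadditive _ _ mU (@subset_refl _ U))) => //.
      by move=> i; exact: measurable_spike.
    apply: (@le_trans _ _ (\sum_(i <oo) (rho i)%:E)%E).
      apply: lee_nneseries => i _ //.
      by rewrite le_eqVlt; apply/orP; left; apply/eqP; exact: lebesgue_spike.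
    apply: nneseries_le_bound => [i|n]; first exact: ltW.
    apply: (@le_trans _ _ (\sum_(i < n) (2 ^+ i.+1)^-1 * 2^-1)).
      by apply: ler_sum => i _; apply: (le_trans (rhole i)); have := half0 i; lra.
    by rewrite -mulr_suml -[leRHS]mul1r ler_wpM2r// sum_half_pow_le1.
  rewrite lt0e measure_ge0 andbT; apply/eqP => B0.
  have : (Leb (@icube R 1) <= (2^-1)%:E)%E.
    apply: (@le_trans _ _ (Leb ((@icube R 1 `\` U) `|` U))).
      apply: le_measure; rewrite ?inE//; first by apply: measurableU => //; exact: measurableD.
      by move=> x xc; have [xU|xU] := pselect (U x); [right|left].
    apply: (le_trans (measureU2 _ _ _)) => //; first exact: measurableD.
    by rewrite [X in (X + _)%E]B0 add0e.
  by rewrite [X in (X <= _)%E]lebesgue_icube lee_fin; lra.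
- apply/cvgrPdist_lt => eps /small_pow[i iP].
  exists i => // n /= ni; rewrite sub0r normrN.
  have /andP[m0 mle] := @mesh_grid_partition R q q1 _ k k_gt0 (fun=> scale e n) i
    (fun mu => leq_trans ni (leq_scale_id n)).
  by rewrite ger0_norm// (le_lt_trans mle).
move=> x [xc xU]; have xdiv n := diverges x n xc xU.
(* The limit over truncations in [spline_proj_ext] is taken only for a function that is not
   integrable. If [phi] were integrable, the integral of [B * phi] would bound the projections of
   all its truncations at [x] on the initial grid. *)
have nphi : ~ Leb.-integrable (unit_cube R 1) (EFin \o phi).
  move=> phii; pose B := \prod_(mu < 1) (q%:R ^+ scale e 0 * C mu).
  have [M MP] := xdiv 0%N (\int[Leb]_(y in unit_cube R 1) (B * phi y) + 1).
  have := MP M (leqnn M); rewrite truncE spline_proj_grid//; last exact: integrable_dspike.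
  apply/negP; rewrite -ltNge; apply: (@le_lt_trans _ _ (\int[Leb]_(y in unit_cube R 1) (B * phi y))); last by lra.
  apply: le_Rintegral => //.
  - apply: integrable_mul_grid_kernel => //; exact: integrable_dspike.
  - by apply: eq_integrable (integrableZl mc B phii) => //.
  move=> y _; rewrite -truncE mulrC.
  have phi0 : 0 <= phi y by exact: stepf_ge0.
  have m0 : 0 <= Num.min (phi y) M%:R by rewrite le_min phi0/=.
  apply: (@le_trans _ _ (B * Num.min (phi y) M%:R)).
    rewrite ler_wpM2r// (le_trans (ler_norm _))//.
    exact: (grid_kernel_bounded q1 C0 Cle (fun=> scale e 0) y xc).
  by rewrite ler_wpM2l ?ge_min ?lexx// prodr_ge0// => mu _; rewrite mulr_ge0// ltW.
apply: limn_esup_pinfty => K l; exists l => //.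
rewrite /spline_proj_ext ifF; last by apply/negP.
suff -> : limn (fun m => (spline_proj (Delta l) (fun y => Num.min (phi y) m%:R) x)%:E) = +oo%E.
  by rewrite /= leey.
apply/cvg_lim => //; apply/cvgeryP/cvgryPge => K'.
by have [M MP] := xdiv l K'; exists M.
Qed.

Theorem theorem1p2 (R : realType) (d : nat) (d_gt0 : (0 < d)%N)
    (k : 'I_d -> nat) (k_gt0 : forall mu, (0 < k mu)%N)
    (sigma : R -> R) (sigma_gt0 : forall t, 0 <= t -> 0 < sigma t)
    (sigma_liminf : limf_einf (fun t => (sigma t)%:E) +oo = 0%E) :
  exists phi : Rd R d -> R,
    [/\ forall x, unit_cube R d x -> 0 <= phi x,
        measurable_fun (unit_cube R d) phi,
        (1 < d)%N ->
          (lebesgue_tuple R d).-integrable (unit_cube R d) (EFin \o phi),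
        (lebesgue_tuple R d).-integrable (unit_cube R d)
          (fun x => (sigma (phi x) * phi x * logp (phi x) ^+ d.-1)%:E) &
        exists (B : set (Rd R d)) (Delta : nat -> multipartition R k),
          [/\ measurable B, B `<=` unit_cube R d,
              (0 < lebesgue_tuple R d B)%E,
              mesh (Delta n) @[n --> \oo] --> 0 &
              forall x, B x ->
                limn_esup (fun n => `|spline_proj_ext (Delta n) phi x|%E)
                  = +oo%E]].
Proof.
case: d d_gt0 k k_gt0 => [//|[|d]] _ k k_gt0; first exact: divergent_example_1.
exact: divergent_example_ge2.
Qed.
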